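(* Let $K/k$ be a finite field extension and $G$ a finite group acting on the rational function field $K(x,y)$ by purely quasi-monomial $k$-automorphisms. Define $N=\{\sigma\in G:\sigma(x)=x,\ \sigma(y)=y\}$ and $H=\{\sigma\in G:\sigma(\alpha)=\alpha \text{ for all }\alpha\in K\}$. Then $K(x,y)^G$ is rational over $k$ except possibly in the following situation: $\operatorname{char}k\ne 2$ and $(G/N,HN/N)\simeq(C_4,C_2)$ or $(D_4,C_2)$ (i.e. $G/N\simeq C_4$, resp. $D_4$, and $HN/N$ has order $2$). More precisely, in the exceptional situation one may choose $u,v\in k(x,y)$ with $k(x,y)=k(u,v)$ (so $K(x,y)=K(u,v)$) such that: (i) when $(G/N,HN/N)\simeq(C_4,C_2)$: $K^N=k(\sqrt a)$ for some $a\in k\setminus k^2$, $G/N=\langle\sigma\rangle\simeq C_4$, and $\sigma$ acts on $K^N(u,v)$ by $\sqrt a\mapsto-\sqrt a$, $u\mapsto 1/u$, $v\mapsto -1/v$; (ii) when $(G/N,HN/N)\simeq(D_4,C_2)$: $K^N=k(\sqrt a,\sqrt b)$ is a biquadratic extension of $k$ with $a,b\in k\setminus k^2$, $G/N=\langle\sigma,\tau\rangle\simeq D_4$, and $\sigma:\sqrt a\mapsto-\sqrt a,\ \sqrt b\mapsto\sqrt b,\ u\mapsto 1/u,\ v\mapsto -1/v$, $\tau:\sqrt a\mapsto\sqrt a,\ \sqrt b\mapsto -\sqrt b,\ u\mapsto u,\ v\mapsto -v$. In case (i), $K(x,y)^G$ is $k$-rational if and only if the norm residue $2$-symbol $(a,-1)_k=0$.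 In case (ii), $K(x,y)^G$ is $k$-rational if and only if $(a,-b)_k=0$. Moreover, if $K(x,y)^G$ is not $k$-rational, then $k$ is an infinite field, the Brauer group $\operatorname{Br}(k)$ is non-trivial, and $K(x,y)^G$ is not $k$-unirational.
   Context: $G$ acts on $K(x,y)$ by purely quasi-monomial $k$-automorphisms means: $\sigma(K)\subset K$ for all $\sigma\in G$; $K^G=k$; and for every $\sigma\in G$, $\sigma(x)=x^{a_{11}}y^{a_{21}}$, $\sigma(y)=x^{a_{12}}y^{a_{22}}$ with $[a_{ij}]\in GL_2(\mathbb{Z})$. $C_n$ is the cyclic group of order $n$, $D_4$ the dihedral group of order $8$. A field is $k$-rational if purely transcendental over $k$; $k$-unirational if contained in a purely transcendental extension of $k$ (of finite transcendence degree). For $\operatorname{char}k\ne2$, $(a,b)_k\in\operatorname{Br}(k)$ denotes the class of the quaternion algebra with generators $u,v$, $u^2=a$, $v^2=b$, $uv=-vu$; it is $0$ iff this algebra is isomorphic to $M_2(k)$.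
   Formalization: The claim k(x,y)=k(u,v), K(x,y)=K(u,v) is impossible (σ² fixes u and v, so it would lie in N, yet G/N has an element σ of order 4); it is replaced by k(u,v)=k(x,y)^{HN/N} and K(u,v)=K(x,y)^H. *)

(* Defs.v *)
From HB Require Import structures.
From mathcomp Require Import all_boot all_order all_algebra all_fingroup.
From mathcomp Require Import all_solvable all_field.
From mathcomp Require Import boolp.
From mathcomp Require Export mpoly.
From mathcomp Require Import ring.

Set Implicit Arguments.
Unset Strict Implicit.
Unset Printing Implicit Defensive.

Import GRing.Theory.
Local Open Scope ring_scope.

(* Subfields of E are Prop-valued predicates on E.  A base field F of E is    *)
(* given by a map i : F -> E, always a field embedding below.                 *)

(* The subfield i(F)(S) of E. *)
Inductive adjoin (F E : fieldType) (i : F -> E) (S : E -> Prop) : E -> Prop :=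
| adjoin_base c : adjoin i S (i c)
| adjoin_gen z : S z -> adjoin i S z
| adjoin_sub z w : adjoin i S z -> adjoin i S w -> adjoin i S (z - w)
| adjoin_div z w : adjoin i S z -> adjoin i S w -> adjoin i S (z / w).

Definition alg_independent (F E : fieldType) (i : F -> E) (B : E -> Prop) :=
  forall (n : nat) (t : 'I_n -> E), injective t -> (forall j, B (t j)) ->
  forall p : {mpoly F[n]}, mmap i t p = 0 -> p = 0.

(* The subfield M of E is purely transcendental over i(F). *)
Definition rational (F E : fieldType) (i : F -> E) (M : E -> Prop) :=
  exists B : E -> Prop,
    alg_independent i B /\ forall z, M z <-> adjoin i B z.

Definition ratconst (n : nat) (F : fieldType) (c : F) : {fraction {mpoly F[n]}} :=
  tofrac (c%:MP).

(* The subfield M of E embeds over F in F(t_1, ..., t_n) for some n; only the *)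
(* values of f on M matter.                                                   *)
Definition unirational (F E : fieldType) (i : F -> E) (M : E -> Prop) :=
  exists (n : nat) (f : E -> {fraction {mpoly F[n]}}),
    [/\ forall c, f (i c) = ratconst n c,
        forall z w, M z -> M w -> f (z + w) = f z + f w
      & forall z w, M z -> M w -> f (z * w) = f z * f w].

Definition infinite_field (F : fieldType) := forall s : seq F, exists c, c \notin s.

Definition nonsquare (F : fieldType) (a : F) := forall c : F, c ^+ 2 != a.

Section Brauer.
Variable k : fieldType.

Definition central (A : falgType k) :=
  forall z : A, (forall w, z * w = w * z) -> exists c : k, z = c%:A.

Definition simple_alg (A : falgType k) :=
  forall I : {vspace A},
    (forall z w : A, z \in I -> (z * w \in I) && (w * z \in I)) ->
    I = 0%VS \/ I = fullv.

Definition central_simple (A : falgType k) := central A /\ simple_alg A.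

(* M_m(A) and M_n(B) are isomorphic k-algebras for some m, n >= 1.  A matrix  *)
(* ring over A is only an A-module in the library, hence the explicit clause  *)
(* on scalars.                                                                *)
Definition brauer_equiv (A B : falgType k) :=
  exists (m n : nat) (f : {rmorphism 'M[A]_m.+1 -> 'M[B]_n.+1}),
    bijective f /\ forall c : k, f (c%:A)%:M = (c%:A)%:M.

Definition brauer_nontrivial :=
  exists A B : falgType k,
    [/\ central_simple A, central_simple B & ~ brauer_equiv A B].

End Brauer.

(* The quaternion algebra with basis 1, u, v, uv (coordinates 0, 1, 2, 3) and *)
(* u^2 = a, v^2 = b, uv = - vu.                                               *)
Definition quaternion (k : fieldType) (a b : k) : Type := 'rV[k]_4.

Section Quaternion.
Variables (k : fieldType) (a b : k).
Local Notation Q := (quaternion a b).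

HB.instance Definition _ := Vector.on Q.

Definition mkquat (z0 z1 z2 z3 : k) : Q :=
  \row_(j < 4) nth 0 [:: z0; z1; z2; z3] j.

Definition quat_coord (z : Q) (j : 'I_4) : k := (z : 'rV[k]_4) 0 j.

Definition quat_mul (z w : Q) : Q :=
  let c q n := quat_coord q (inord n) in
  mkquat
    (c z 0 * c w 0 + a * (c z 1 * c w 1) + b * (c z 2 * c w 2)
       - a * b * (c z 3 * c w 3))
    (c z 0 * c w 1 + c z 1 * c w 0 - b * (c z 2 * c w 3) + b * (c z 3 * c w 2))
    (c z 0 * c w 2 + c z 2 * c w 0 + a * (c z 1 * c w 3) - a * (c z 3 * c w 1))
    (c z 0 * c w 3 + c z 3 * c w 0 + c z 1 * c w 2 - c z 2 * c w 1).

Lemma quatP (z w : Q) :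
  (forall n, (n < 4)%N -> quat_coord z (inord n) = quat_coord w (inord n)) ->
  z = w.
Proof.
by move=> eq_zw; apply/rowP => j; have:= eq_zw j (ltn_ord j); rewrite inord_val.
Qed.

Lemma quat_coordE z0 z1 z2 z3 n : (n < 4)%N ->
  quat_coord (mkquat z0 z1 z2 z3) (inord n) = nth 0 [:: z0; z1; z2; z3] n.
Proof. by move=> lt_n4; rewrite /quat_coord mxE inordK. Qed.

Lemma quat_coordD (z w : Q) j : quat_coord (z + w) j = quat_coord z j + quat_coord w j.
Proof. by rewrite /quat_coord mxE. Qed.

Lemma quat_coordZ (c : k) (z : Q) j : quat_coord (c *: z) j = c * quat_coord z j.
Proof. by rewrite /quat_coord mxE. Qed.

Local Ltac quat_ring :=
  apply: quatP => - [|[|[|[|//]]]] _;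
  rewrite /quat_mul ?(quat_coordD, quat_coordZ, quat_coordE) //=;
  rewrite ?(quat_coordD, quat_coordZ, quat_coordE) //=; ring.

Fact quat_mulA : associative quat_mul.
Proof. by move=> z w t; quat_ring. Qed.
Fact quat_mul1l : left_id (mkquat 1 0 0 0) quat_mul.
Proof. by move=> z; quat_ring. Qed.
Fact quat_mul1r : right_id (mkquat 1 0 0 0) quat_mul.
Proof. by move=> z; quat_ring. Qed.
Fact quat_mulDl : left_distributive quat_mul +%R.
Proof. by move=> z w t; quat_ring. Qed.
Fact quat_mulDr : right_distributive quat_mul +%R.
Proof. by move=> z w t; quat_ring. Qed.
Fact quat_1_neq0 : mkquat 1 0 0 0 != 0.
Proof.
apply/eqP => /(congr1 (fun z => quat_coord z (inord 0))).
by rewrite quat_coordE //= /quat_coord mxE => /eqP; rewrite oner_eq0.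
Qed.

HB.instance Definition _ := GRing.Zmodule_isNzRing.Build Q
  quat_mulA quat_mul1l quat_mul1r quat_mulDl quat_mulDr quat_1_neq0.

Lemma quat_mulE (z w : Q) : z * w = quat_mul z w. Proof. by []. Qed.
Lemma quat_oneE : (1 : Q) = mkquat 1 0 0 0. Proof. by []. Qed.

Fact quat_scaleAl (c : k) (z w : Q) : c *: (z * w) = c *: z * w.
Proof. by rewrite !quat_mulE; quat_ring. Qed.
HB.instance Definition _ := GRing.Lmodule_isLalgebra.Build k Q quat_scaleAl.

Fact quat_scaleAr (c : k) (z w : Q) : c *: (z * w) = z * (c *: w).
Proof. by rewrite !quat_mulE; quat_ring. Qed.
HB.instance Definition _ := GRing.Lalgebra_isAlgebra.Build k Q quat_scaleAr.
HB.instance Definition _ := Algebra_isFalgebra.Build k Q.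

Lemma quaternion_rel (u := mkquat 0 1 0 0) (v := mkquat 0 0 1 0) :
  [/\ u * u = a%:A, v * v = b%:A, u * v = - (v * u)
    & forall z0 z1 z2 z3 : k,
        mkquat z0 z1 z2 z3 = z0%:A + z1 *: u + z2 *: v + z3 *: (u * v)].
Proof.
rewrite /u /v; split; last move=> z0 z1 z2 z3.
- by rewrite quat_mulE quat_oneE; quat_ring.
- by rewrite quat_mulE quat_oneE; quat_ring.
- by rewrite -scaleN1r !quat_mulE; quat_ring.
- by rewrite quat_mulE quat_oneE; quat_ring.
Qed.

End Quaternion.

(* (a, b)_k = 0 in Br(k). *)
Definition norm_residue_zero (k : fieldType) (a b : k) :=
  brauer_equiv (quaternion a b) (k^o : falgType k).

Notation ratfun2 K := {fraction {mpoly K[2]}}.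

Section Action.
Variables (k : fieldType) (K : fieldExtType k).
Local Notation L := (ratfun2 K).

Definition xvar : L := tofrac ('X_0 : {mpoly K[2]}).
Definition yvar : L := tofrac ('X_1 : {mpoly K[2]}).

Definition iK (c : K) : L := ratconst 2 c.
Definition ik (c : k) : L := iK c%:A.

(* k(z, w) and K(z, w) *)
Definition k_gen2 (z w : L) : L -> Prop := adjoin ik (fun t => t = z \/ t = w).
Definition K_gen2 (z w : L) : L -> Prop := adjoin iK (fun t => t = z \/ t = w).

Variables (gT : finGroupType) (G : {group gT}) (to : action G L).

Definition fixed_by (A : {set gT}) (z : L) := forall s, s \in A -> to z s = z.

Record purely_quasi_monomial : Prop := PurelyQuasiMonomial {
  pqm_add : forall s, s \in G -> zmod_morphism (to^~ s);
  pqm_mul : forall s, s \in G -> monoid_morphism (to^~ s);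
  pqm_k : forall s c, s \in G -> to (ik c) s = ik c;
  pqm_K : forall s c, s \in G -> exists d, to (iK c) s = iK d;
  pqm_fix : forall c : K, fixed_by G (iK c) -> exists d : k, c = d%:A;
  pqm_monomial : forall s, s \in G ->
    exists A : 'M[int]_2,
      [/\ A \in unitmx, to xvar s = xvar ^ A 0 0 * yvar ^ A 1 0
        & to yvar s = xvar ^ A 0 1 * yvar ^ A 1 1]
}.

Definition actN : {set gT} :=
  [set s in G | (to xvar s == xvar) && (to yvar s == yvar)].

Definition actH : {set gT} :=
  [set s in G | `[< forall c : K, to (iK c) s = iK c >]].

Definition C4_case : Prop :=
  (G / actN \isog Zp 4)%g /\ #|(actH * actN / actN)%g| = 2%N.

Definition D4_case : Prop :=
  (G / actN \isog 'D_8)%g /\ #|(actH * actN / actN)%g| = 2%N.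

(* k(u, v) is the fixed field of HN in k(x, y); as N acts trivially on        *)
(* k(x, y) and H on K, it follows that K(u, v) = K(x, y)^H.                   *)
Definition uv_generators (u v : L) : Prop :=
  (forall z, k_gen2 u v z <-> k_gen2 xvar yvar z /\ fixed_by (actH * actN)%g z)
  /\ (forall z, K_gen2 u v z <-> fixed_by actH z).

(* sa and sb stand for the square roots of a and b. *)
Definition C4_data (a : k) (sa : K) (s : gT) (u v : L) : Prop :=
  [/\ uv_generators u v,
      [/\ nonsquare a, sa ^+ 2 = a%:A
        & forall c : K, fixed_by actN (iK c) <-> c \in <<1; sa>>%VS],
      s \in G /\ (G / actN = <[coset actN s]>)%g
    & [/\ to (iK sa) s = - iK sa, to u s = u^-1 & to v s = - v^-1]].

Definition D4_data (a b : k) (sa sb : K) (s t : gT) (u v : L) : Prop :=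
  [/\ uv_generators u v,
      [/\ nonsquare a /\ nonsquare b, sa ^+ 2 = a%:A /\ sb ^+ 2 = b%:A,
          \dim <<<<1; sa>>; sb>>%VS = 4%N
        & forall c : K, fixed_by actN (iK c) <-> c \in <<<<1; sa>>; sb>>%VS],
      [/\ s \in G, t \in G
        & (G / actN = <<[set coset actN s; coset actN t]>>)%g],
      [/\ to (iK sa) s = - iK sa, to (iK sb) s = iK sb,
          to u s = u^-1 & to v s = - v^-1]
    & [/\ to (iK sa) t = iK sa, to (iK sb) t = - iK sb,
          to u t = u & to v t = - v]].

Definition fixed_rational := rational ik (fixed_by G).
Definition fixed_unirational := unirational ik (fixed_by G).

End Action.

Arguments xvar {k K}.
Arguments yvar {k K}.

(* Main.v *)
Require Import Defs.
From HB Require Import structures.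
From mathcomp Require Import all_boot all_order all_algebra all_fingroup.
From mathcomp Require Import all_solvable all_field.
From mathcomp Require Import boolp ring zify polyXY.
From mathcomp Require generic_quotient.

(** A positive definite quadratic form on Z^2 invariant under the image of G in
    GL_2(Z), and a basis reduced for it, give monomials generating k(x, y) on
    which G acts either by signed permutations of two coordinates X, Y, or
    through S_3 x {1, -1} on three coordinates a, b, c with abc = 1.  Fixed
    fields are computed one variable at a time: if a G-stable field P and a
    transcendental t are such that every s in G maps t to an affine function of
    t over P, then P(t)^G is generated over P^G by one element.  For a, b, c
    with a 3-cycle the surface is a quadric, and affine coordinates are obtained
    by projection, by homogeneous coordinates or from Masuda's C_3-invariants,
    according to the image of H.  For X, Y in characteristic other than 2, the
    Cayley transforms p, q of X, Y are permuted up to sign, and K(x, y) is fibred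
    by z = p / q.  The only case that escapes is when H acts as {1, -1} and some
    element of G acts with order 4.

    In that case put n = v, resp. n = v sqrt b, and c = 1, resp. c = b.  Then
    n sigma(n) = - c, so that the coordinates of n in the basis 1, sqrt a are a
    point of the conic z^2 - a t^2 = - c over the fixed field.  If this field is
    rational or unirational, comparing leading coefficients yields a point over
    k.  Conversely a point over k is an m in k(sqrt a) with m sigma(m) = - c,
    sigma inverts both u and n / m, and 1 / (1 - u), 1 / (1 - n / m) are affine
    coordinates.  The conic has a point over k if and only if the quaternion
    algebra (a, - c) splits. *)

Set Implicit Arguments.
Unset Strict Implicit.
Unset Printing Implicit Defensive.

Import GRing.Theory.
Local Open Scope ring_scope.

(** * Subfields and algebraic dependence *)

(** The obstacle sits on the line with coordinate z. The sign change of both p and q fixes z, and a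
    rotation of order 4 sends z to - 1 / z. If some element of H moves z, the invariants of K(z)
    descend to K(w) with w = z + 1 / z, z - 1 / z or z^2. If H fixes X and Y, descent along K gives
    an invariant linear form in p, q. Without rotations, z or 1 / (1 - z) is moved affinely. When H
    acts as {1, -1} and there is a rotation, nothing of this applies: H is trivial on K(z), and the
    quotient of the line is a conic, possibly without a point.

    Algebraic independence of the coordinates found is not computed. The field L is algebraic over
    every subfield that contains the invariants, so two elements that generate such a subfield over
    K are independent because L has transcendence degree two. *)

Section Generated.
Variable L : fieldType.
Implicit Types X Y : L -> Prop.

Inductive gen X : L -> Prop :=
| gen_one : gen X 1
| gen_in z : X z -> gen X z
| gen_sub z w : gen X z -> gen X w -> gen X (z - w)
| gen_div z w : gen X z -> gen X w -> gen X (z / w).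

Definition genp X : {pred L} := fun z => `[< gen X z >].

Lemma genpP X z : reflect (gen X z) (z \in genp X).
Proof. exact: asboolP. Qed.

Fact genp_divring X : divring_closed (genp X).
Proof.
split; first by apply/genpP/gen_one.
- by move=> z w /genpP hz /genpP hw; apply/genpP/gen_sub.
- by move=> z w /genpP hz /genpP hw; apply/genpP/gen_div.
Qed.
HB.instance Definition _ X := GRing.isDivringClosed.Build L (genp X) (genp_divring X).

(** The generated subfield as a field type of its own, so that polynomials over it, their gcds and
    [algebraicOver] are available. It is related to [L] only through [gvalr]. *)
Record gfield X := GField { gval : L; _ : gval \in genp X }.
HB.instance Definition _ X := [isSub for @gval X].
HB.instance Definition _ X := [Choice of gfield X by <:].
HB.instance Definition _ X := [SubChoice_isSubIntegralDomain of gfield X by <:].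
HB.instance Definition _ X := [SubIntegralDomain_isSubField of gfield X by <:].

Definition gvalr X : {rmorphism gfield X -> L} := (val : {rmorphism gfield X -> L}).

Lemma gvalP X (c : gfield X) : gen X (gvalr X c).
Proof. by case: c => c hc; apply/genpP. Qed.

Lemma gval_ex X z : gen X z -> exists c : gfield X, gvalr X c = z.
Proof. by move/genpP=> hz; exists (GField hz). Qed.

Lemma gen_min X (P : L -> Prop) : P 1 ->
  (forall z w, P z -> P w -> P (z - w)) -> (forall z w, P z -> P w -> P (z / w)) ->
  (forall z, X z -> P z) -> forall z, gen X z -> P z.
Proof. by move=> h1 hB hV hX z; elim; auto. Qed.

Lemma gen_le X Y : (forall z, X z -> gen Y z) -> forall z, gen X z -> gen Y z.
Proof. by apply: gen_min; [apply: gen_one | apply: gen_sub | apply: gen_div]. Qed.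

Lemma gen0 X : gen X 0. Proof. by apply/genpP/rpred0. Qed.
Lemma genN X z : gen X z -> gen X (- z).
Proof. by move/genpP=> hz; apply/genpP; rewrite rpredN. Qed.
Lemma genD X z w : gen X z -> gen X w -> gen X (z + w).
Proof. by move=> /genpP hz /genpP hw; apply/genpP/rpredD. Qed.
Lemma genM X z w : gen X z -> gen X w -> gen X (z * w).
Proof. by move=> /genpP hz /genpP hw; apply/genpP/rpredM. Qed.
Lemma genV X z : gen X z -> gen X z^-1.
Proof. by move=> /genpP hz; apply/genpP; rewrite rpredV. Qed.
Lemma genX X z n : gen X z -> gen X (z ^+ n).
Proof. by move=> /genpP hz; apply/genpP/rpredX. Qed.
Lemma gen_nat X n : gen X n%:R. Proof. by apply/genpP/rpred_nat. Qed.
Lemma gen_prod X (I : Type) (r : seq I) (F : I -> L) :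
  (forall i, gen X (F i)) -> gen X (\prod_(i <- r) F i).
Proof. by move=> hF; apply/genpP/rpred_prod => i _; apply/genpP. Qed.
Lemma gen_sum X (I : Type) (r : seq I) (F : I -> L) :
  (forall i, gen X (F i)) -> gen X (\sum_(i <- r) F i).
Proof. by move=> hF; apply/genpP/rpred_sum => i _; apply/genpP. Qed.

Definition ext X (t : L) : L -> Prop := fun z => X z \/ z = t.

Lemma gen_ext X t z : gen X z -> gen (ext X t) z.
Proof. by apply: gen_le => w hw; apply: gen_in; left. Qed.
Lemma gen_extr X t : gen (ext X t) t. Proof. by apply: gen_in; right. Qed.

Lemma gen_ext_le X Y t z :
  (forall w, X w -> gen Y w) -> gen Y t -> gen (ext X t) z -> gen Y z.
Proof. by move=> hX ht; apply: gen_le => w [/hX|->]. Qed.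

Lemma gen_horner X (p : {poly gfield X}) t : gen (ext X t) (map_poly (gvalr X) p).[t].
Proof.
rewrite horner_coef; apply: gen_sum => i; rewrite coef_map.
by apply: genM; [apply/gen_ext/gvalP | apply/genX/gen_extr].
Qed.

Lemma gen_frac X t z : gen (ext X t) z -> exists p q : {poly gfield X},
  (map_poly (gvalr X) q).[t] != 0 /\
  z = (map_poly (gvalr X) p).[t] / (map_poly (gvalr X) q).[t].
Proof.
pose e p := (map_poly (gvalr X) p).[t].
have ec c : e c%:P = gvalr X c by rewrite /e map_polyC hornerC.
have eM p q : e (p * q) = e p * e q by rewrite /e rmorphM hornerM.
have eB p q : e (p - q) = e p - e q by rewrite /e rmorphB hornerD hornerN.
have e1 : e 1 = 1 by rewrite /e rmorph1 hornerC.
move=> hz; suff: exists p q, e q != 0 /\ z = e p / e q by [].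
elim: hz => {z} [|z|z w _ [p [q [q0 ->]]] _ [r [s [s0 ->]]]
  |z w _ [p [q [q0 ->]]] _ [r [s [s0 ->]]]].
- by exists 1, 1; rewrite e1 divr1 oner_neq0.
- case=> [Xz | ->].
    have [c <-] := gval_ex (gen_in Xz).
    by exists c%:P, 1; rewrite e1 ec divr1 oner_neq0.
  exists 'X, 1; rewrite e1 divr1 oner_neq0; split=> //.
  by rewrite /e map_polyX hornerX.
- exists (p * s - r * q), (q * s).
  by rewrite eB !eM mulf_neq0 //; split=> //; field; rewrite q0 s0.
(* [gen_div] admits the denominator 0, with quotient 0; this case has its own witness. *)
- have [r0|r0] := eqVneq (e r) 0.
    exists 0, 1; rewrite e1 oner_neq0 r0 mul0r invr0 mulr0; split=> //.
    by rewrite /e rmorph0 horner0 mul0r.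
  exists (p * s), (q * r); rewrite !eM mulf_neq0 //; split=> //.
  by rewrite invf_div mulf_div.
Qed.

Definition cl X : L -> Prop := algebraicOver (gvalr X).

Lemma cl_gen X z : gen X z -> cl X z.
Proof. by move/gval_ex=> [c <-]; apply: algebraic_id. Qed.

Lemma cl_le X Y : (forall z, X z -> cl Y z) -> forall z, gen X z -> cl Y z.
Proof.
apply: gen_min; [exact: algebraic1 | exact: algebraic_sub | exact: algebraic_div].
Qed.

Lemma cl_trans X Y z : (forall w, X w -> cl Y w) -> cl X z -> cl Y z.
Proof.
move=> hX [p p0 rp]; apply/integral_algebraic.
apply: (@integral_root _ _ (gvalr Y) (map_poly (gvalr X) p)) rp _.
  by rewrite map_poly_eq0.
move=> w /(nthP 0) [i _ <-]; apply/integral_algebraic.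
by rewrite coef_map; apply: cl_le (gvalP _).
Qed.

Lemma cl_mono X Y z : (forall w, X w -> gen Y w) -> cl X z -> cl Y z.
Proof. by move=> hX; apply: cl_trans => w /hX; apply: cl_gen. Qed.

End Generated.

(** * Exchange and transcendence degree *)

Section Exchange.
Variable L : fieldType.
Implicit Types X Y : L -> Prop.

Lemma poly_lift X (p : {poly L}) : p \is a polyOver (genp X) ->
  exists q : {poly gfield X}, map_poly (gvalr X) q = p.
Proof.
move=> /polyOverP hp; exists (map_poly (insubd (0 : gfield X)) p).
have h0 : insubd (0 : gfield X) 0 = 0.
  by apply: val_inj; rewrite /= /insubd insubT ?rpred0.
by apply/polyP => i; rewrite coef_map coef_map_id0 //= /insubd insubT.
Qed.

Lemma poly_over_map X (q : {poly gfield X}) : map_poly (gvalr X) q \is a polyOver (genp X).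
Proof. by apply/polyOverP => i; rewrite coef_map; apply/genpP/gvalP. Qed.

(** Polynomials over [L] with coefficients in the subfield can be compared for different subfields
    without a change of type. *)
Lemma cl_polyP X z : cl X z <->
  exists p : {poly L}, [/\ p != 0, p \is a polyOver (genp X) & root p z].
Proof.
split=> [[p p0 rp]|[p [p0 hp rp]]].
  exists (map_poly (gvalr X) p); split=> //; first by rewrite map_poly_eq0.
  exact: poly_over_map.
have [q hq] := poly_lift hp; exists q; last by rewrite hq.
by rewrite -(map_poly_eq0 (gvalr X)) hq.
Qed.

Lemma transc_eq0 X t (p : {poly L}) :
  ~ cl X t -> p \is a polyOver (genp X) -> p.[t] = 0 -> p = 0.
Proof.
move=> ht hp p0; apply/eqP/negPn/negP => pn0; apply: ht; apply/cl_polyP.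
by exists p; split=> //; apply/eqP.
Qed.

(** Steinitz exchange. A relation for z over X(w), cleared of denominators, is a polynomial relation
    between z and w over X. Read as a polynomial in w it stays nonzero, since its coefficients are
    polynomials in z and z is transcendental over X. *)
Lemma cl_exchange X z w : cl (ext X w) z -> ~ cl X z -> cl (ext X z) w.
Proof.
move=> /cl_polyP [p [p0 hp rp]] hz.
have [|hw] := pselect (cl X w).
  by apply: cl_mono => v hv; apply/gen_ext/gen_in.
pose i := gvalr X; pose e (c : {poly gfield X}) := (map_poly i c).[w].
(* A common denominator [e q] of the coefficients of p, by induction on the number of coefficients
   treated. *)
have [q [q0 hq]] : exists q, e q != 0 /\ forall j, exists c, p`_j * e q = e c.
  suff : forall n, exists q, e q != 0 /\ forall j, (j < n)%N -> exists c, p`_j * e q = e c.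
    case/(_ (size p)) => q [q0 hq]; exists q; split=> // j.
    have [/hq //|hj] := ltnP j (size p); exists 0.
    by rewrite nth_default // mul0r /e rmorph0 horner0.
  elim=> [|n [q [q0 hq]]].
    by exists 1; split=> //; rewrite /e rmorph1 hornerC oner_neq0.
  have /genpP/gen_frac [a [b [b0 hab]]] := polyOverP hp n.
  exists (b * q); have eM c d : e (c * d) = e c * e d by rewrite /e rmorphM hornerM.
  rewrite eM mulf_neq0 //; split=> // j; rewrite ltnS leq_eqVlt => /predU1P [->|/hq [c hc]].
    by exists (a * q); rewrite hab eM -!/(e _); field.
  by exists (b * c); rewrite eM mulrCA hc.
have [c hc] := choice hq.
pose F := \poly_(j < size p) c j.
have F0 : F != 0.
  apply/eqP => /polyP /(_ (size p).-1); rewrite coef0 coef_poly prednK ?size_poly_gt0 //.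
  rewrite leqnn => c0; have := hc (size p).-1; rewrite c0 /e rmorph0 horner0.
  by apply/eqP; rewrite mulf_neq0 // -lead_coefE lead_coef_eq0.
pose F' := map_poly (map_poly i) F.
have F'0 : F' != 0.
  apply: contra F0 => /eqP h; apply/eqP/polyP => j; apply/eqP.
  have /polyP/(_ j) := h; rewrite coef_map coef0 /= => hj.
  by rewrite coef0 -(map_poly_eq0 i); apply/eqP.
have P0 : (F'.[z%:P]).[w] = 0.
  have -> : F'.[z%:P].[w] = p.[z] * e q.
    rewrite [F'.[_]]horner_coef horner_sum [p.[z]]horner_coef mulr_suml.
    have sF : (size F' <= size p)%N by apply: leq_trans (size_poly _ _) (size_poly _ _).
    rewrite (big_ord_widen _ (fun j => (F'`_j * z%:P ^+ j).[w]) sF) big_mkcond /=.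
    apply: eq_bigr => j _; rewrite coef_map coef_poly ltn_ord.
    rewrite mulrAC hc hornerM -rmorphXn hornerC; case: ltnP => // /leq_sizeP /(_ j (leqnn _)).
    by rewrite coef_map coef_poly ltn_ord /= /e => ->; rewrite horner0 mul0r.
  by move/rootP: rp => ->; rewrite mul0r.
have hS j : (swapXY F')`_j \is a polyOver (genp X).
  by apply/polyOverP => l; rewrite coef_swapXY !coef_map; apply/genpP/gvalP.
(* The outer variable of [F'] stands for z, the inner one for w. After [swapXY] the coefficients in
   w are values at z of polynomials over X. *)
have PE : F'.[z%:P] = map_poly (horner_eval z) (swapXY F').
  by rewrite -horner_swapXY swapXYK.
apply/cl_polyP; exists F'.[z%:P]; split; last exact/rootP.
  have lP : (F'.[z%:P])`_(size (swapXY F')).-1 != 0.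
    rewrite PE coef_map /= /horner_eval; apply/eqP => h0.
    have := transc_eq0 hz (hS _) h0; apply/eqP.
    by rewrite -lead_coefE lead_coef_eq0 swapXY_eq0.
  by apply: contraNneq lP => ->; rewrite coef0.
apply/polyOverP => j; rewrite PE coef_map; apply/genpP.
have [g <-] := poly_lift (hS j); exact: gen_horner.
Qed.

Lemma trdeg_one X a b c : ~ cl X a -> ~ cl (ext X a) b ->
  cl (ext X c) a -> cl (ext X c) b -> False.
Proof.
move=> ha hb hca hcb; apply: hb; have hac := cl_exchange hca ha.
apply: cl_trans hcb => w [hw|-> //]; exact/cl_gen/gen_ext/gen_in.
Qed.

(** The form in which transcendence degree two is used. Were p algebraic over X, or q over X(p),
    then the two independent elements a, b would be algebraic over an extension of X by a single
    element. *)
Lemma trdeg_two X a b p q : ~ cl X a -> ~ cl (ext X a) b ->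
    cl (ext (ext X p) q) a -> cl (ext (ext X p) q) b ->
  ~ cl X p /\ ~ cl (ext X p) q.
Proof.
move=> ha hb hpa hpb; split=> h.
  apply: (trdeg_one ha hb (c := q)); [move: hpa | move: hpb];
    apply: cl_trans => w [[hw|->]|->].
  - exact/cl_gen/gen_ext/gen_in.
  - by apply: cl_mono h => v hv; apply/gen_ext/gen_in.
  - exact/cl_gen/gen_extr.
  - exact/cl_gen/gen_ext/gen_in.
  - by apply: cl_mono h => v hv; apply/gen_ext/gen_in.
  - exact/cl_gen/gen_extr.
apply: (trdeg_one ha hb (c := p)); [move: hpa | move: hpb];
  by apply: cl_trans => w [hw|-> //]; apply/cl_gen/gen_in.
Qed.

End Exchange.

(** * Finite groups acting on a field *)

Section FieldAction.
Variables (L : fieldType) (gT : finGroupType) (G : {group gT}) (to : action G L).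
Hypothesis toB : forall s, s \in G -> zmod_morphism (to^~ s).
Hypothesis toMm : forall s, s \in G -> monoid_morphism (to^~ s).
Implicit Types (s : gT) (z w t : L) (X : L -> Prop).

Lemma to_rmorph s : s \in G -> exists f : {rmorphism L -> L}, forall z, f z = to z s.
Proof.
move=> hs; pose f := to^~ s.
pose fA := GRing.isZmodMorphism.Build L L f (toB hs).
pose fM := GRing.isMonoidMorphism.Build L L f (toMm hs).
pose g : {rmorphism L -> L} := HB.pack f fA fM.
by exists g.
Qed.

Lemma to_comp z s r : s \in G -> r \in G -> to z (s * r)%g = to (to z s) r.
Proof. by case: to => f [_ fM] /=; apply: fM. Qed.
Lemma to_id z : to z 1%g = z.
Proof.
(* An [action] carries no identity axiom: it follows from 1 * 1 = 1 and injectivity. *)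
have toI : left_injective to by case: (to) => f [].
by apply: (toI 1%g); rewrite -to_comp // mulg1.
Qed.
Lemma toK z s : s \in G -> to (to z s) s^-1%g = z.
Proof. by move=> hs; rewrite -to_comp ?groupV // mulgV to_id. Qed.
Lemma toVK z s : s \in G -> to (to z s^-1%g) s = z.
Proof. by move=> hs; rewrite -to_comp ?groupV // mulVg to_id. Qed.

Definition inv z := forall s, s \in G -> to z s = z.

Definition stable X := forall s, s \in G -> forall z, gen X z -> gen X (to z s).

Lemma stable_ext X t : stable X -> (forall s, s \in G -> gen (ext X t) (to t s)) ->
  stable (ext X t).
Proof.
move=> hX ht s hs; have [f fE] := to_rmorph hs.
apply: gen_min => [|z w hz hw|z w hz hw|z [hz|->]].
- by rewrite -fE rmorph1; apply: gen_one.
- by rewrite -fE rmorphB !fE; apply: gen_sub.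
- by rewrite -fE fmorph_div !fE; apply: gen_div.
- by apply/gen_ext/hX => //; apply: gen_in.
- exact: ht.
Qed.

Section AffineStep.
Variables (X : L -> Prop) (t : L).
Hypothesis X_stable : stable X.
Hypothesis t_transc : ~ cl X t.
Hypothesis t_affine : forall s, s \in G -> exists a b, [/\ gen X a, gen X b & to t s = a * t + b].

Let PX := polyOver (genp X).

(** The action of s on X(t) is lifted to polynomials: s acts on the coefficients and the variable
    goes to its affine image. As t is transcendental over the stable field X, the factor a is
    nonzero and sizes are kept. *)
Lemma affine_twist s : s \in G -> exists tw : {rmorphism {poly L} -> {poly L}},
  [/\ forall p, p \is a PX -> tw p \is a PX, forall p, size (tw p) = size p
    & forall p, to p.[t] s = (tw p).[t]].
Proof.
move=> hs; have [f fE] := to_rmorph hs; have [a [b [ha hb hab]]] := t_affine hs.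
pose l := a *: 'X + b%:P.
have a0 : a != 0.
  apply/eqP => a0; apply: t_transc; apply: cl_gen.
  rewrite -(toK t hs) hab a0 mul0r add0r; apply: X_stable => //; exact: groupVr.
have sl : size l = 2%N by rewrite /l -mul_polyC size_MXaddC polyC_eq0 (negPf a0) size_polyC a0.
pose tw : {rmorphism {poly L} -> {poly L}} := comp_poly l \o map_poly f.
exists tw; split=> p /=.
- move=> /polyOverP hp; apply: polyOver_comp; last first.
    by rewrite rpredD ?polyOverZ ?polyOverX ?polyOverC //; apply/genpP.
  apply/polyOverP => i; rewrite coef_map; apply/genpP => /=; rewrite fE.
  by apply: X_stable => //; apply/genpP.
- by rewrite size_comp_poly2 // size_map_poly.
- by rewrite horner_comp -fE -horner_map fE hab /l !hornerE.
Qed.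

Lemma affine_inv_poly p : p \is a PX -> inv p.[t] ->
  forall s, s \in G -> forall tw : {rmorphism {poly L} -> {poly L}},
  (forall p, p \is a PX -> tw p \is a PX) -> (forall p, to p.[t] s = (tw p).[t]) -> tw p = p.
Proof.
move=> hp ip s hs tw twP twE; apply/eqP; rewrite -subr_eq0; apply/eqP.
apply: (transc_eq0 t_transc); first by rewrite rpredB ?twP.
by rewrite hornerD hornerN -twE ip // subrr.
Qed.

Lemma prod_to_inv z : inv (\prod_(s in G) to z s).
Proof.
move=> r hr; have [f fE] := to_rmorph hr.
rewrite -fE rmorph_prod /= [RHS](reindex_inj (mulIg r)).
apply: eq_big => s; first by rewrite groupMr.
by move=> hs; rewrite fE to_comp.
Qed.

(* [f] is an invariant polynomial in [t] of least positive degree; any other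
   invariant polynomial reduces to it by Euclidean division. *)
Lemma affine_step : exists f, inv f /\
  forall z, gen (ext X t) z -> inv z -> gen (fun w => (gen X w /\ inv w) \/ w = f) z.
Proof.
pose I p := p \is a PX /\ inv p.[t].
(* The size [n.+2] encodes a positive degree n + 1. The product of the images of t is invariant of
   degree [#|G|]. *)
have exI : exists n, `[< exists p, I p /\ size p = n.+2 >].
  have /choice [c hc] : forall s, exists p, s \in G ->
      [/\ p \is a PX, size p = 2%N & to t s = p.[t]].
    move=> s; have [hs|hs] := boolP (s \in G); last by exists 0.
    have [tw [twP twS twE]] := affine_twist hs.
    by exists (tw 'X) => _; rewrite twS size_polyX -twE hornerX twP ?polyOverX.
  pose p := \prod_(s in G) c s.
  exists #|G|.-1; apply/asboolP; exists p; split; last first.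
    rewrite size_prod => [|s /hc [_ cs _]]; last by rewrite -size_poly_gt0 cs.
    rewrite (eq_bigr (fun=> 2%N)) => [|s /hc []//].
    rewrite sum_nat_const -[#|in_mem^~ _|]/#|G|; have := cardG_gt0 G; lia.
  split; first by apply: rpred_prod => s /hc [].
  rewrite horner_prod (eq_bigr (fun s => to t s)) => [|s /hc []//].
  exact: prod_to_inv.
case: (ex_minnP exI) => n /asboolP [p0 [[p0X p0I] sp0]] nmin.
exists p0.[t]; split=> //.
set Y := fun w => _ \/ _.
have IY m : forall p, I p -> (size p <= m)%N -> gen Y p.[t].
  elim: m => [|m IH] p [pX pI] sp.
    by move: sp; rewrite size_poly_leq0 => /eqP ->; rewrite horner0; apply: gen0.
  have [sp1|sp1] := leqP (size p) 1.
    move: pX pI; rewrite (size1_polyC sp1) hornerC => /polyOverP/(_ 0%N).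
    by rewrite coefC => /genpP pX pI; apply: gen_in; left.
  have pdiv := divp_eq p p0; set q := p %/ p0 in pdiv; set r := p %% p0 in pdiv.
  have p0n0 : p0 != 0 by rewrite -size_poly_gt0 sp0.
  have sr : (size r < size p0)%N by rewrite ltn_modp.
  have [qX rX] : q \is a PX /\ r \is a PX.
    have [a ea] := poly_lift pX; have [b eb] := poly_lift p0X.
    by split; rewrite /q /r -ea -eb -?map_divp -?map_modp; apply: poly_over_map.
  (* The twist turns the division of p by p0 into another one, and uniqueness of quotient and
     remainder makes both invariant. *)
  have qr s : s \in G -> to q.[t] s = q.[t] /\ to r.[t] s = r.[t].
    move=> hs; have [tw [twP twS twE]] := affine_twist hs.
    have twp := affine_inv_poly pX pI hs twP twE.
    have twp0 := affine_inv_poly p0X p0I hs twP twE.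
    have e : p = tw q * p0 + tw r by rewrite -{1}twp pdiv rmorphD rmorphM twp0.
    have sr' : (size (tw r) < size p0)%N by rewrite twS.
    by rewrite !twE; have -> : tw q = q := divpP e sr'; have -> : tw r = r := modpP e sr'.
  clearbody q r; have Iq : I q by split=> // s /qr [].
  have Ir : I r by split=> // s /qr [].
  rewrite pdiv hornerD hornerM; apply: genD; first apply: genM.
  - apply: IH => //; have [->|q0] := eqVneq q 0; first by rewrite size_poly0.
    have e : size p = (size q + size p0).-1.
      rewrite pdiv; have [->|r0] := eqVneq r 0; first by rewrite addr0 size_mul.
      by rewrite size_polyDl size_mul // (polySpred q0) addSn /= (leq_trans sr (leq_addl _ _)).
    by move: sp; rewrite e sp0 !addnS => h; apply: leq_trans (leq_addr n _) h.
  - by apply: gen_in; right.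
  (* An invariant remainder of positive degree would contradict the minimality of p0. *)
  - have sr1 : (size r <= 1)%N.
      rewrite leqNgt; apply/negP => sr1.
      have /nmin : `[< exists p, I p /\ size p = (size r).-2.+2 >].
        by apply/asboolP; exists r; split=> //; case: (size r) sr1 => [|[|]].
      by move: sr; rewrite sp0; lia.
    case: Ir => _; rewrite (size1_polyC sr1) hornerC => rI.
    by apply: gen_in; left; split=> //; apply/genpP/polyOverP.
move=> z /gen_frac [p' [q' [q0 ze]]] zI.
set P := map_poly _ p' in ze; set Q := map_poly _ q' in q0 ze.
(* Numerator and denominator are multiplied by the other conjugates of Q(t). The denominator becomes
   a norm, hence invariant, and then the numerator is invariant because z is. *)
pose R := \prod_(s in G | s != 1%g) to Q.[t] s.
have QR : Q.[t] * R = \prod_(s in G) to Q.[t] s by rewrite (bigD1 1%g) //= to_id.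
have QRI : inv (Q.[t] * R) by rewrite QR; apply: prod_to_inv.
have R0 : R != 0.
  apply/prodf_neq0 => s /andP [hs _]; have [f fE] := to_rmorph hs.
  by rewrite -fE fmorph_eq0.
have [r [rX rE]] : exists r, r \is a PX /\ r.[t] = R.
  have /choice [c hc] : forall s, exists p, s \in G -> p \is a PX /\ to Q.[t] s = p.[t].
    move=> s; have [hs|hs] := boolP (s \in G); last by exists 0.
    have [tw [twP twS twE]] := affine_twist hs.
    by exists (tw Q) => _; rewrite twP //; apply: poly_over_map.
  exists (\prod_(s in G | s != 1%g) c s); split.
    by apply: rpred_prod => s /andP [/hc []].
  by rewrite horner_prod; apply: eq_bigr => s /andP [/hc []].
have -> : z = (P.[t] * R) / (Q.[t] * R) by rewrite ze; field; rewrite q0 R0.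
apply: gen_div; rewrite -rE -hornerM.
  apply: (IY (size (P * r))) => //; split; first by rewrite rpredM ?poly_over_map.
  move=> s hs; rewrite hornerM rE; have -> : P.[t] * R = z * (Q.[t] * R) by rewrite ze; field.
  by have [f fE] := to_rmorph hs; rewrite -fE rmorphM !fE zI // QRI.
by apply: (IY (size (Q * r))) => //; split; [rewrite rpredM ?poly_over_map | rewrite hornerM rE].
Qed.

End AffineStep.

End FieldAction.

Section AlgebraicExtension.
Variable L : fieldType.
Implicit Types X : L -> Prop.

(** The denominator is inverted by a Bezout relation with a polynomial [m] of least size vanishing
    at t; the result is then reduced modulo [m]. *)
Lemma gen_alg X (p : {poly L}) d t z :
    p \is a polyOver (genp X) -> p != 0 -> root p t -> (size p <= d.+1)%N ->
    gen (ext X t) z ->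
  exists q : {poly L}, [/\ q \is a polyOver (genp X), (size q <= d)%N & z = q.[t]].
Proof.
move=> pX p0 rp sp /gen_frac [a [b [b0 ze]]].
pose e q := (map_poly (gvalr X) q).[t].
have eM q r : e (q * r) = e q * e r by rewrite /e rmorphM hornerM.
have eD q r : e (q + r) = e q + e r by rewrite /e rmorphD hornerD.
have exm : exists n, `[< exists m, [/\ m != 0, e m = 0 & size m = n] >].
  have [q qE] := poly_lift pX; exists (size q); apply/asboolP; exists q; split=> //.
    by rewrite -(map_poly_eq0 (gvalr X)) qE.
  by rewrite /e qE; apply/rootP.
case: (ex_minnP exm) => n /asboolP [m [m0 em sm]] nmin.
have nd : (n <= d.+1)%N.
  have [q qE] := poly_lift pX.
  have := nmin (size q); rewrite -(size_map_poly (gvalr X)) qE => /(_ _)/leq_trans; apply=> //.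
  apply/asboolP; exists q; split; first by rewrite -(map_poly_eq0 (gvalr X)) qE.
    by rewrite /e qE; apply/rootP.
  by rewrite -(size_map_poly (gvalr X)) qE.
have cop : coprimep m b.
  rewrite /coprimep; set g := gcdp m b.
  have g0 : g != 0 by rewrite gcdp_eq0 negb_and m0.
  have /dvdpP [r mE] := dvdp_gcdl m b; have /dvdpP [r' bE] := dvdp_gcdr m b.
  rewrite -/g in mE bE.
  have eg : e g != 0 by move: b0; rewrite -/(e b) bE eM mulf_eq0 negb_or => /andP [].
  have r0 : r != 0 by apply: contraNneq m0 => r0; rewrite mE r0 mul0r.
  have /nmin : `[< exists m, [/\ m != 0, e m = 0 & size m = size r] >].
    apply/asboolP; exists r; split=> //.
    by move/eqP: em; rewrite mE eM mulf_eq0 (negPf eg) orbF => /eqP.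
  rewrite -sm mE size_mul // (polySpred g0) addnS /=.
  by rewrite -{2}[size r]addn0 leq_add2l leqn0 => /eqP ->.
have [u uE] := Bezout_eq1_coprimepP _ _ cop.
have eb : e u.2 * e b = 1.
  have := congr1 e uE; rewrite eD !eM em mulr0 add0r => ->.
  by rewrite /e rmorph1 hornerC.
exists (map_poly (gvalr X) ((a * u.2) %% m)); split.
- exact: poly_over_map.
- by rewrite size_map_poly -ltnS (leq_trans _ nd) // -sm ltn_modp.
rewrite -/(e _) ze -!/(e _).
have -> : e a / e b = e (a * u.2).
  by rewrite eM -[e u.2](mulfK b0) -/(e b) eb mul1r.
by rewrite {1}(divp_eq (a * u.2) m) eD eM em mulr0 add0r.
Qed.

End AlgebraicExtension.

Section FieldAction.
Variables (L : fieldType) (gT : finGroupType) (G : {group gT}) (to : action G L).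
Hypothesis toB : forall s, s \in G -> zmod_morphism (to^~ s).
Hypothesis toMm : forall s, s \in G -> monoid_morphism (to^~ s).
Implicit Types (s : gT) (z w t : L) (X : L -> Prop).

Lemma gen_fix X s z : s \in G -> (forall w, X w -> to w s = w) -> gen X z -> to z s = z.
Proof.
move=> hs hX; have [f fE] := to_rmorph toB toMm hs; rewrite -fE.
elim=> [|w /hX|w v _ hw _ hv|w v _ hw _ hv].
- by rewrite rmorph1.
- by rewrite -fE.
- by rewrite rmorphB hw hv.
- by rewrite fmorph_div hw hv.
Qed.

(** Galois descent by counting roots. By [gen_alg], z = q(t) with q of size at most [size ss]; the
    difference q - z vanishes at the [size ss] distinct images of t, so q is the constant z. *)
Lemma fixed_in_base X (p : {poly L}) t z (ss : seq gT) :
    p \is a polyOver (genp X) -> p != 0 -> root p t -> (size p <= (size ss).+1)%N ->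
    {subset ss <= G} -> (forall s w, s \in ss -> X w -> to w s = w) ->
    uniq [seq to t s | s <- ss] -> (0 < size ss)%N ->
    gen (ext X t) z -> (forall s, s \in ss -> to z s = z) ->
  gen X z.
Proof.
move=> pX p0 rp sp ssG ssX uss ss0 hz zfix.
have [q [qX sq zE]] := gen_alg pX p0 rp sp hz.
suff qz : q = z%:P by apply/genpP; move/polyOverP: qX => /(_ 0%N); rewrite qz coefC.
apply/eqP; rewrite -subr_eq0; apply/negPn/negP => n0.
have : (size [seq to t s | s <- ss] < size (q - z%:P)%R)%N.
  apply: max_poly_roots => //; apply/allP => _ /mapP [s hs ->].
  have sG := ssG _ hs; have [f fE] := to_rmorph toB toMm sG.
  have qf : map_poly f q = q.
    apply/polyP => i; rewrite coef_map /= fE; apply: (gen_fix (X := X) sG); last first.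
      exact/genpP/polyOverP.
    by move=> w; apply: ssX.
  have e : to z s = q.[to t s] by rewrite zE -!fE -{2}qf horner_map.
  by rewrite /root hornerD hornerN hornerC -e zfix // subrr.
rewrite size_map ltnNge; apply/negP/negPn; apply: leq_trans (size_polyD _ _) _.
by rewrite geq_max sq size_polyN (leq_trans (size_polyC_leq1 _)).
Qed.

Lemma fixed_in_quadratic X t h a b z : h \in G -> (forall w, X w -> to w h = w) ->
    gen X a -> gen X b -> t ^+ 2 = a * t + b -> to t h != t ->
    gen (ext X t) z -> to z h = z ->
  gen X z.
Proof.
move=> hG hX ha hb tab th hz zh; pose P : {poly L} := 'X^2 - (a *: 'X + b%:P).
have sl1 : (size (a *: 'X + b%:P)%R < size ('X^2 : {poly L})%R)%N.
  rewrite size_polyXn ltnS (leq_trans (size_polyD _ _)) // geq_max.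
  rewrite (leq_trans (size_scale_leq _ _)) ?size_polyX //.
  by rewrite (leq_trans (size_polyC_leq1 _)).
have sP : size P = 3 by rewrite /P size_polyDl ?size_polyN // size_polyXn.
apply: (fixed_in_base (p := P) (ss := [:: 1%g; h]) _ _ _ _ _ _ _ _ hz) => //=.
- rewrite rpredB ?polyOverXn // rpredD ?polyOverZ ?polyOverX ?polyOverC //; exact/genpP.
- by rewrite -size_poly_gt0 sP.
- by apply/rootP; rewrite /P !(hornerD, hornerN, hornerZ, hornerXn, hornerX, hornerC) tab subrr.
- by rewrite sP.
- by move=> s; rewrite !inE => /orP [] /eqP ->.
- by move=> s u; rewrite !inE => /orP [] /eqP -> hu; rewrite ?to_id // hX.
- by rewrite to_id inE eq_sym th.
- by move=> s; rewrite !inE => /orP [] /eqP -> //; rewrite to_id.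
Qed.

End FieldAction.

(** * Sums over cosets and independence of automorphisms *)

Section CosetSums.
Variables (R : nmodType) (gT : finGroupType) (G H : {group gT}).

(** F is constant on right cosets, so [repr C] stands for any element of C, and right multiplication
    by g permutes the cosets. This is the invariance of a trace. *)
Lemma sum_rcosets_mulr (F : gT -> R) g : g \in G ->
    (forall h s, h \in H -> s \in G -> F (h * s)%g = F s) ->
  \sum_(C in rcosets H G) F (repr C * g)%g = \sum_(C in rcosets H G) F (repr C).
Proof.
move=> hg hF.
have gI : injective (fun C : {set gT} => C :* g)%g by exact: rcoset_inj.
have reprE s : s \in G -> F (repr (H :* s)%g) = F s.
  by move=> hs; case: repr_rcosetP => h hh; apply: hF.
rewrite [RHS](reindex_inj gI) /=; apply: eq_big => C.
  apply/rcosetsP/rcosetsP => -[s hs].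
    by move=> ->; exists (s * g)%g; rewrite ?groupM // rcosetM.
  by move=> e; exists (s * g^-1)%g; rewrite ?groupM ?groupV // rcosetM -e rcosetK.
case/rcosetsP => s hs ->; rewrite -rcosetM reprE ?groupM //.
by case: repr_rcosetP => h hh; rewrite -mulgA hF ?groupM.
Qed.

End CosetSums.

Section FieldAction.
Variables (L : fieldType) (gT : finGroupType) (G : {group gT}) (to : action G L).
Hypothesis toB : forall s, s \in G -> zmod_morphism (to^~ s).
Hypothesis toMm : forall s, s \in G -> monoid_morphism (to^~ s).
Variables (X : L -> Prop) (H : {group gT}).
Hypothesis sHG : H \subset G.
Hypothesis memH : forall s, s \in G -> (s \in H <-> forall c, gen X c -> to c s = c).

(** The indicator function of H is an L-combination of the functions g |-> g(c) with c in X. It is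
    the product, over h outside H, of (g(c) - h(c)) / (c - h(c)) with c moved by h: such a factor
    vanishes at h and is 1 on H. *)
Lemma indicator_sum : exists r : seq (L * L), (forall p, p \in r -> gen X p.2) /\
  forall g, g \in G -> \sum_(p <- r) p.1 * to p.2 g = (g \in H)%:R.
Proof.
(* The factor [(g \notin T)%:R] expresses that the sum vanishes on T. *)
suff ind (T : seq gT) : {subset T <= G} -> all [predC H] T -> exists r : seq (L * L),
    (forall p, p \in r -> gen X p.2) /\
    forall g, g \in G -> \sum_(p <- r) p.1 * to p.2 g =
      \sum_(p <- r) p.1 * to p.2 g * (g \notin T)%:R
      /\ (g \in H -> \sum_(p <- r) p.1 * to p.2 g = 1).
  have [||r [rX rE]] := ind [seq s <- enum G | s \notin H].
  - by move=> s; rewrite mem_filter mem_enum => /andP [].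
  - by apply/allP => s; rewrite mem_filter /= => /andP [].
  exists r; split=> // g hg; have [r0 r1] := rE g hg.
  have [hH|hH] := boolP (g \in H); first exact: r1.
  by rewrite r0 big1 // => p _; rewrite mem_filter hH mem_enum hg mulr0.
elim: T => [|h T IH] sT aT.
  exists [:: (1, 1)]; split=> [p|g hg]; first by rewrite inE => /eqP ->; apply: gen_one.
  have [f fE] := to_rmorph toB toMm hg.
  by split=> [|_]; rewrite !big_seq1 /= -fE rmorph1 ?mulr1.
have {IH} [||r [rX rE]] := IH.
- by move=> s hs; apply: sT; rewrite inE hs orbT.
- by case/andP: aT.
have hG : h \in G by apply: sT; rewrite inE eqxx.
have [c [cX ch]] : exists c, gen X c /\ to c h != c.
  apply: contrapT => nc; case/andP: aT => /negP hH _; apply: hH; apply/(memH hG) => c cX.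
  by apply/eqP/negPn/negP => ch; apply: nc; exists c.
have d0 : c - to c h != 0 by rewrite subr_eq0 eq_sym.
exists ([seq (p.1 / (c - to c h), p.2 * c) | p <- r] ++
        [seq (- p.1 * to c h / (c - to c h), p.2) | p <- r]); split.
  move=> p; rewrite mem_cat => /orP [] /mapP [q hq ->] /=; last exact: rX.
  by apply: genM => //; apply: rX.
move=> g hg; have [f fE] := to_rmorph toB toMm hg; have [r0 r1] := rE g hg.
have e : \sum_(p <- [seq (p.1 / (c - to c h), p.2 * c) | p <- r] ++
        [seq (- p.1 * to c h / (c - to c h), p.2) | p <- r]) p.1 * to p.2 g
    = (\sum_(p <- r) p.1 * to p.2 g) * ((to c g - to c h) / (c - to c h)).
  rewrite big_cat !big_map /= mulr_suml -big_split /=; apply: eq_bigr => p _.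
  by rewrite -!fE rmorphM !fE; field.
rewrite -big_distrl /= e; split; last first.
  by move=> hH; rewrite r1 // mul1r (proj1 (memH hg) hH) // divff.
rewrite inE negb_or; have [->|gh] := eqVneq g h; first by rewrite subrr mul0r  !mulr0 ?mul0r.
by rewrite {1}r0 -big_distrl /=; ring.
Qed.

(** Independence of automorphisms modulo H. If all these sums vanished, combining them with the
    weights of [indicator_sum] would leave the term of the coset H alone, which is [psi 1]. *)
Lemma dedekind (psi : gT -> L) :
    (forall h s, h \in H -> s \in G -> psi (h * s)%g = psi s) -> psi 1%g != 0 ->
  exists c, gen X c /\ \sum_(C in rcosets H G) psi (repr C) * to c (repr C) != 0.
Proof.
move=> psiH psi1; have [r [rX rE]] := indicator_sum.
apply: contrapT => nc; move/eqP: psi1; apply.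
have : \sum_(p <- r) p.1 * (\sum_(C in rcosets H G) psi (repr C) * to p.2 (repr C)) = 0.
  rewrite big_seq big1 // => p hp; apply/eqP; rewrite mulf_eq0; apply/orP; right.
  by apply/negPn/negP => h0; apply: nc; exists p.2; split=> //; apply: rX.
have reprG C : C \in rcosets H G -> repr C \in G.
  case/rcosetsP => s hs ->; case: repr_rcosetP => h hh.
  by rewrite groupM // (subsetP sHG).
under eq_bigr do rewrite mulr_sumr.
rewrite exchange_big /= (bigD1 (H : {set gT})) /=; last first.
  by apply/rcosetsP; exists 1%g; rewrite ?rcoset1.
rewrite repr_group [X in _ + X]big1 ?addr0 => [|C /andP [hC CH]].
  under eq_bigr do rewrite mulrCA.
  by rewrite -mulr_sumr rE // group1 mulr1.
under eq_bigr do rewrite mulrCA.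
rewrite -mulr_sumr rE ?reprG //; case/rcosetsP: hC CH => s hs ->.
case: repr_rcosetP => h hh; case: (boolP ((h * s)%g \in H)); rewrite ?mulr0 //.
by rewrite groupMl // => /rcoset_id ->; rewrite eqxx.
Qed.

End FieldAction.

(** * Rationality of fixed fields *)

Section Independence.
Variable L : fieldType.
Implicit Types X : L -> Prop.

Lemma unzip2_inj (S T : eqType) (r : seq (S * T)) :
  uniq (unzip2 r) -> {in r &, injective snd}.
Proof.
elim: r => // q r IH /= /andP [qr ur] p p'; rewrite !inE.
have in2 p1 : p1 \in r -> p1.2 == q.2 = false.
  by move=> hp; apply: contraNF qr => /eqP <-; apply: map_f.
move=> /predU1P [->|hp] /predU1P [->|hp'] e //; last exact: IH.
  by have := in2 _ hp'; rewrite e eqxx.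
by have := in2 _ hp; rewrite e eqxx.
Qed.

(** A polynomial in f1, f2 is encoded as a list of coefficients with pairwise different exponents.
    It is read first as a polynomial in f2 over X(f1), then each coefficient as one in f1 over X. *)
Lemma bivariate_eq0 X f1 f2 (r : seq (L * (nat * nat))) :
    ~ cl X f1 -> ~ cl (ext X f1) f2 ->
    (forall p, p \in r -> gen X p.1) -> uniq (unzip2 r) ->
    \sum_(p <- r) p.1 * f1 ^+ p.2.1 * f2 ^+ p.2.2 = 0 ->
  forall p, p \in r -> p.1 = 0.
Proof.
move=> h1 h2 rX ru s0 p0 hp0.
have d : \sum_(p <- r | p.2.2 == p0.2.2) p.1 * f1 ^+ p.2.1 = 0.
  pose P := \sum_(p <- r) (p.1 * f1 ^+ p.2.1) *: 'X^(p.2.2).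
  have -> : \sum_(p <- r | p.2.2 == p0.2.2) p.1 * f1 ^+ p.2.1 = P`_(p0.2.2).
    rewrite /P coef_sum big_mkcond /=; apply: eq_bigr => p _.
    by rewrite coefZ coefXn [RHS]mulr_natr mulrb eq_sym.
  suff -> : P = 0 by rewrite coef0.
  apply: (transc_eq0 h2).
    rewrite /P big_seq; apply: rpred_sum => p hp.
    apply: polyOverZ; last by rewrite polyOverXn.
    by apply/genpP/genM; [apply/gen_ext/rX | apply/genX/gen_extr].
  by rewrite /P horner_sum -[RHS]s0; apply: eq_bigr => p _; rewrite hornerZ hornerXn.
pose Q := \sum_(p <- r | p.2.2 == p0.2.2) p.1 *: 'X^(p.2.1).
have Q0 : Q = 0.
  apply: (transc_eq0 h1).
    rewrite /Q big_seq_cond; apply: rpred_sum => p /andP [hp _].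
    by apply: polyOverZ; [apply/genpP/rX | rewrite polyOverXn].
  by rewrite /Q horner_sum -[RHS]d; apply: eq_bigr => p _; rewrite hornerZ hornerXn.
have /polyP /(_ p0.2.1) := Q0; rewrite coef0 /Q coef_sum big_mkcond /=.
rewrite (bigD1_seq p0) ?(map_uniq ru) //= eqxx coefZ coefXn eqxx mulr1.
rewrite big_seq_cond big1 ?addr0 // => p /andP [hp pp0].
have /negPf e : p.2 != p0.2.
  apply: contra pp0 => /eqP e; apply/eqP.
  exact: (unzip2_inj ru hp hp0 e).
case: eqP => [e2|_ //]; rewrite coefZ coefXn.
case: (eqVneq p0.2.1 p.2.1) => [e1|_]; last by rewrite mulr0.
by move/negP: e; case; case: (p.2) (p0.2) e1 e2 => a1 b1 [a2 b2] /= -> ->.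
Qed.

Lemma monomial_inj X f1 f2 (m n : nat * nat) : ~ cl X f1 -> ~ cl (ext X f1) f2 ->
  f1 ^+ m.1 * f2 ^+ m.2 = f1 ^+ n.1 * f2 ^+ n.2 -> m = n.
Proof.
move=> h1 h2 e; apply/eqP/negPn/negP => mn.
pose r : seq (L * (nat * nat)) := [:: (1, m); (-1, n)].
have rX p : p \in r -> gen X p.1.
  rewrite !inE => /orP [] /eqP -> /=; first exact: gen_one.
  exact/genN/gen_one.
have ru : uniq (unzip2 r) by rewrite /= inE mn.
have r0 : \sum_(p <- r) p.1 * f1 ^+ p.2.1 * f2 ^+ p.2.2 = 0.
  by rewrite /r !big_cons big_nil /= !mul1r !mulN1r mulNr e addr0 subrr.
by have /eqP := bivariate_eq0 h1 h2 rX ru r0 (mem_head _ _); rewrite oner_eq0.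
Qed.

Section Rational.
Variables (k : fieldType) (i : {rmorphism k -> L}).
Let X z := exists c, z = i c.

Lemma gen_base z : gen X z <-> exists c, z = i c.
Proof.
split=> [|[c ->]]; last by apply: gen_in; exists c.
elim=> {z} [|z //|_ _ _ [a ->] _ [b ->]|_ _ _ [a ->] _ [b ->]].
- by exists 1; rewrite rmorph1.
- by exists (a - b); rewrite rmorphB.
- by exists (a / b); rewrite fmorph_div.
Qed.

Lemma adjoinE (S : L -> Prop) z :
  adjoin i S z <-> gen (fun w => X w \/ S w) z.
Proof.
split; elim=> {z}.
- by move=> c; apply: gen_in; left; exists c.
- by move=> z hz; apply: gen_in; right.
- by move=> z w _ hz _ hw; apply: gen_sub.
- by move=> z w _ hz _ hw; apply: gen_div.
- by rewrite -(rmorph1 i); apply: adjoin_base.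
- by move=> z [[c ->]|hz]; [apply: adjoin_base | apply: Defs.adjoin_gen].
- by move=> z w _ hz _ hw; apply: adjoin_sub.
- by move=> z w _ hz _ hw; apply: adjoin_div.
Qed.

Lemma adjoin2_gen f1 f2 z :
  adjoin i (fun t => t = f1 \/ t = f2) z <-> gen (ext (ext X f1) f2) z.
Proof.
rewrite adjoinE; split; apply: gen_le => w; rewrite /ext.
  by case=> [h|[->|->]]; apply: gen_in; [left; left | left; right | right].
by case=> [[h|->]|->]; apply: gen_in; [left | right; left | right; right].
Qed.

Lemma alg_independent_two f1 f2 : ~ cl X f1 -> ~ cl (ext X f1) f2 ->
  alg_independent i (fun t => t = f1 \/ t = f2).
Proof.
move=> h1 h2 n t tI tB p p0.
have f12 : f1 != f2.
  by apply/eqP => e; apply: h2; rewrite -e; apply/cl_gen/gen_extr.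
(* The tuple t takes its values in {f1, f2}, in unknown number and order; [e m] is the pair of
   exponents that m gives to f1 and f2. *)
pose e (m : 'X_{1..n}) := (\sum_(j < n | t j == f1) m j, \sum_(j < n | t j == f2) m j)%N.
have eI : injective e.
  move=> m1 m2 [] e1 e2; apply/mnmP => j.
  have pick f (m : 'X_{1..n}) : t j = f -> (\sum_(j' < n | t j' == f) m j')%N = m j.
    move=> tj; rewrite (big_pred1 j) // => j' /=.
    by rewrite -tj; apply/eqP/eqP => [/tI|->].
  by case: (tB j) => tj; [move: e1 | move: e2]; rewrite !(pick _ _ tj).
pose r := [seq (i p@_m, e m) | m <- msupp p].
have r2 : unzip2 r = map e (msupp p) by rewrite /unzip2 -map_comp.
have mm m : mmap1 t m = f1 ^+ (e m).1 * f2 ^+ (e m).2.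
  rewrite /mmap1 /= !expr_sum [in RHS]big_mkcond [X in _ * X]big_mkcond -big_split /=.
  apply: eq_bigr => j _; case: (tB j) => ->; rewrite eqxx ?(negPf f12) ?mulr1 //.
  by rewrite eq_sym (negPf f12) mul1r.
have rs0 : \sum_(p <- r) p.1 * f1 ^+ p.2.1 * f2 ^+ p.2.2 = 0.
  rewrite -[RHS]p0 /mmap big_map; apply: eq_bigr => m _.
  by rewrite mm mulrA.
have rX q : q \in r -> gen X q.1.
  by case/mapP => m _ ->; apply: gen_in; exists p@_m.
have ru : uniq (unzip2 r) by rewrite r2 map_inj_uniq // msupp_uniq.
have rc := bivariate_eq0 h1 h2 rX ru rs0.
apply/mpolyP => m; rewrite mcoeff0.
have [hm|hm] := boolP (m \in msupp p); last by apply/eqP; rewrite mcoeff_eq0.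
have /rc /eqP : (i p@_m, e m) \in r by apply/mapP; exists m.
by rewrite fmorph_eq0 => /eqP.
Qed.

Lemma rational_of_two (M : L -> Prop) f1 f2 : ~ cl X f1 -> ~ cl (ext X f1) f2 ->
  (forall z, M z <-> gen (ext (ext X f1) f2) z) -> rational i M.
Proof.
move=> h1 h2 hM; exists (fun t => t = f1 \/ t = f2); split.
  exact: alg_independent_two.
by move=> z; rewrite hM -adjoin2_gen.
Qed.

End Rational.

End Independence.

Section Setup.
Variables (k : fieldType) (K : fieldExtType k) (L : fieldType) (iK : {rmorphism K -> L}).
Variables (x y : L) (gT : finGroupType) (G : {group gT}) (to : action G L).

Definition Kb (z : L) := exists c, z = iK c.
Definition kb (z : L) := exists c : k, z = iK c%:A.

(** The hypotheses for an abstract field L = K(x, y), without monomiality. The shape of the action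
    enters later, through the choice of coordinates. *)
Record semilinear_action : Prop := SemilinearAction {
  sl_add : forall s, s \in G -> zmod_morphism (to^~ s);
  sl_mul : forall s, s \in G -> monoid_morphism (to^~ s);
  sl_k : forall s (c : k), s \in G -> to (iK c%:A) s = iK c%:A;
  sl_K : forall s c, s \in G -> exists d, to (iK c) s = iK d;
  sl_fix : forall c, inv to (iK c) -> exists d : k, c = d%:A;
  sl_x : ~ cl Kb x;
  sl_y : ~ cl (ext Kb x) y;
  sl_gen : forall z, gen (ext (ext Kb x) y) z
}.

Hypothesis sl : semilinear_action.
Let toB := sl_add sl.
Let toMm := sl_mul sl.

Lemma Kb_stable : stable to Kb.
Proof.
move=> s hs z /gen_base [c ->]; have [d ->] := sl_K sl c hs.
by apply: gen_in; exists d.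
Qed.

(** The product of the T - s(z) over s in G has invariant coefficients and the root z. *)
Lemma cl_inv Y z : (forall w, inv to w -> gen Y w) -> cl Y z.
Proof.
move=> hY; apply/cl_polyP; exists (\prod_(s in G) ('X - (to z s)%:P)); split.
- by apply/monic_neq0/monic_prod => s _; apply: monicXsubC.
- apply/polyOverP => i; apply/genpP/hY => s hs.
  have [f fE] := to_rmorph toB toMm hs; rewrite -fE -coef_map /=.
  suff -> : map_poly f (\prod_(s in G) ('X - (to z s)%:P)) = \prod_(s in G) ('X - (to z s)%:P) by [].
  rewrite rmorph_prod /= [RHS](reindex_inj (mulIg s)); apply: eq_big => r.
    by rewrite groupMr.
  by move=> hr; rewrite rmorphB /= map_polyX map_polyC /= fE to_comp.
- rewrite (bigD1 1%g) //= to_id rootM root_XsubC eqxx //.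
Qed.

Definition affine_over Y t :=
  forall s, s \in G -> exists a b, [/\ gen Y a, gen Y b & to t s = a * t + b].

Lemma affine_stable Y t : stable to Y -> affine_over Y t -> stable to (ext Y t).
Proof.
move=> hY ht; apply: stable_ext => // s hs; have [a [b [ha hb ->]]] := ht s hs.
by apply: genD; [apply: genM; [apply: gen_ext|apply: gen_extr]|apply: gen_ext].
Qed.

(* The function field of a surface fibred over a curve: [t] is a fibre
   coordinate and [z] a coordinate on the base. *)
Lemma rational_fibration z t w :
    stable to (ext Kb z) -> affine_over (ext Kb z) t -> affine_over Kb w ->
    (forall v, gen (ext Kb z) v -> inv to v -> gen (ext Kb w) v) ->
    (forall v, inv to v -> gen (ext (ext Kb z) t) v) ->
  rational (fun c : k => iK c%:A) (inv to).
Proof.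
move=> sz tz wK hzw hgen.
have [_ tt] : ~ cl Kb z /\ ~ cl (ext Kb z) t.
  by apply: (trdeg_two (sl_x sl) (sl_y sl)); apply: cl_inv.
have [f2 [f2I f2E]] := affine_step toB toMm sz tt tz.
have [wt _] : ~ cl Kb w /\ ~ cl (ext Kb w) f2.
  have h v : inv to v -> gen (ext (ext Kb w) f2) v.
    move=> hv; apply: gen_le (f2E _ (hgen _ hv) hv) => u [[hu uI]|->].
      by apply: gen_ext; apply: hzw.
    exact: gen_extr.
  by apply: (trdeg_two (sl_x sl) (sl_y sl)); apply: cl_inv.
(* [affine_step] over K: the constants that remain are the invariants of K, which are those of k. *)
have [f1 [f1I f1E]] := affine_step toB toMm Kb_stable wt wK.
have invE v : inv to v <-> gen (ext (ext kb f1) f2) v.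
  split=> [hv|].
    apply: gen_le (f2E _ (hgen _ hv) hv) => u [[hu uI]|->]; last exact: gen_extr.
    apply: gen_ext; apply: gen_le (f1E _ (hzw _ hu uI) uI) => r [[hr rI]|->].
      apply: gen_ext; case/gen_base: hr rI => c -> cI; apply: gen_in.
      by have [d ->] := sl_fix sl cI; exists d.
    exact: gen_extr.
  move=> hv s hs; apply: (gen_fix toB toMm hs _ hv) => u [[[c ->]|->]|->].
  - exact: (sl_k sl c hs).
  - exact: f1I.
  - exact: f2I.
have kbK u : kb u -> Kb u by case=> c ->; exists c%:A.
have xt : ~ cl kb x.
  by move=> h; apply: (sl_x sl); apply: cl_mono h => u /kbK hu; apply: gen_in.
have yt : ~ cl (ext kb x) y.
  move=> h; apply: (sl_y sl); apply: cl_mono h => u [/kbK hu|->]; last exact: gen_extr.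
  exact/gen_ext/gen_in.
have [t1 t2] : ~ cl kb f1 /\ ~ cl (ext kb f1) f2.
  by apply: (trdeg_two xt yt); apply: cl_inv => v /invE.
exact: (@rational_of_two L k (iK \o in_alg K) (inv to) f1 f2 t1 t2 invE).
Qed.

Lemma rational_tower z t :
    affine_over Kb z -> affine_over (ext Kb z) t ->
    (forall v, inv to v -> gen (ext (ext Kb z) t) v) ->
  rational (fun c : k => iK c%:A) (inv to).
Proof.
move=> hz ht; apply: (rational_fibration (w := z)) => //.
exact: affine_stable Kb_stable hz.
Qed.

End Setup.

(** * Signed permutations of two coordinates *)

Section SignedBasis.
Variables (k : fieldType) (K : fieldExtType k) (L : fieldType) (iK : {rmorphism K -> L}).
Variables (x y : L) (gT : finGroupType) (G : {group gT}) (to : action G L).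
Hypothesis sl : semilinear_action iK x y to.
Let toB := sl_add sl.
Let toMm := sl_mul sl.
Variable H : {group gT}.
Hypothesis sHG : H \subset G.
Hypothesis memH : forall s, s \in G -> (s \in H <-> forall c, gen (Kb iK) c -> to c s = c).
Local Notation Kb := (Kb iK).

Lemma transc_neq (Z : L -> Prop) t c : ~ cl Z t -> gen Z c -> t - c != 0.
Proof. by move=> ht hc; rewrite subr_eq0; apply/eqP => e; apply/ht/cl_gen; rewrite e. Qed.

Definition sg (e : bool) (z : L) := if e then z^-1 else z.

Definition sact (X Y : L) s (w e1 e2 : bool) :=
  to X s = sg e1 (if w then Y else X) /\ to Y s = sg e2 (if w then X else Y).

Definition signed_basis (X Y : L) :=
  (forall z, gen (ext (ext Kb X) Y) z) /\
  forall s, s \in G -> exists w e1 e2, sact X Y s w e1 e2.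

(** In terms of signed permutation matrices: some element of G is a rotation of order 4, and the
    image of H is exactly {1, -1}. *)
Definition exceptional (X Y : L) :=
  [/\ exists s e, s \in G /\ sact X Y s true e (~~ e),
      exists h, h \in H /\ sact X Y h false true true
    & forall h, h \in H -> exists e, sact X Y h false e e].

Variables X Y : L.
Hypothesis XY : signed_basis X Y.

Lemma signed_transc : ~ cl Kb X /\ ~ cl (ext Kb X) Y.
Proof. by apply: (trdeg_two (sl_x sl) (sl_y sl)); apply: cl_gen; case: XY. Qed.

Let XT : ~ cl Kb X. Proof. by case: signed_transc. Qed.
Let YT : ~ cl Kb Y.
Proof.
case: signed_transc => _ h1 h2; apply: h1; apply: cl_mono h2 => w hw.
exact/gen_ext/gen_in.
Qed.

Let neq1 t : ~ cl Kb t -> [/\ t != 0, 1 - t != 0 & 1 + t != 0].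
Proof.
move=> ht; split.
- by rewrite -[t]subr0; apply: transc_neq ht (gen0 _).
- by rewrite -oppr_eq0 opprB; apply: transc_neq ht (gen_one _).
- by rewrite addrC -[1]opprK; apply: transc_neq ht (genN (gen_one _)).
Qed.

(** In the coordinate 1 / (1 - t) the inversion of t becomes the affine map c |-> 1 - c, in every
    characteristic. *)
Let c1 (t : L) := (1 - t)^-1.

Let c1E t : ~ cl Kb t -> t = 1 - (c1 t)^-1.
Proof. by move=> /neq1 [h0 h1 h2]; rewrite /c1 invrK; ring. Qed.

Let c1V t : ~ cl Kb t -> c1 t^-1 = 1 - c1 t.
Proof.
move=> /neq1 [h0 h1 h2]; rewrite /c1; field.
by rewrite h0 h1 -opprB oppr_eq0 h1.
Qed.

Let to_c1 t s : s \in G -> to (c1 t) s = c1 (to t s).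
Proof.
by move=> hs; have [f fE] := to_rmorph toB toMm hs; rewrite /c1 -!fE fmorphV rmorphB rmorph1.
Qed.

(** In characteristic 2 inversion adds 1 to the coordinate [c1]. So t and u are permuted up to
    constants, z = t + u is only translated, and t goes to t or z + t up to a constant. *)
Lemma rational_char2 : 2%:R = 0 :> L -> rational (fun c : k => iK c%:A) (inv to).
Proof.
move=> two; have [hgen hact] := XY; pose t := c1 X; pose u := c1 Y; pose z := t + u.
have mX Z : gen (ext Z t) X.
  by rewrite (c1E XT); apply: gen_sub (gen_one _) (genV (gen_extr _ _)).
have uE : u = z - t by rewrite /z; ring.
have opp (a : L) : - a = a.
  by apply/eqP; rewrite eq_sym -subr_eq0 opprK -mulr2n -mulr_natl two mul0r.
have red e (v : L) : ~ cl Kb v -> c1 (sg e v) = c1 v + e%:R.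
  by case: e => vT; rewrite /= ?addr0 // c1V // opp addrC.
apply: (@rational_tower _ _ _ _ _ _ _ _ _ sl z t).
- move=> s hs; have [w [e1 [e2 [a1 a2]]]] := hact s hs; have [f fE] := to_rmorph toB toMm hs.
  exists 1, (e1%:R + e2%:R); split; [exact: gen_one|by apply: genD; apply: gen_nat|].
  rewrite /z -fE rmorphD !fE /t /u !to_c1 // a1 a2.
  by case: w {a1 a2}; rewrite !red //; ring.
- move=> s hs; have [w [e1 [e2 [a1 a2]]]] := hact s hs.
  exists 1, ((if w then z else 0) + e1%:R); split; first exact: gen_one.
    by apply: genD (gen_nat _ _); case: w {a1 a2}; [apply: gen_extr | apply: gen0].
  rewrite /t to_c1 // a1; case: w {a1 a2}; rewrite red //; last by rewrite /t; ring.
  by rewrite -/u uE opp -[X in _ = X]/(1 * t + (z + e1%:R)); ring.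
- move=> v _; apply: gen_le (hgen v) => {}v [[hv|->]|->].
  + exact/gen_ext/gen_ext/gen_in.
  + exact: mX.
  + rewrite (c1E YT) -/u uE; apply: gen_sub (gen_one _) (genV _).
    by apply: gen_sub (gen_extr _ _); apply/gen_ext/gen_extr.
Qed.

Section OddChar.
Hypothesis two : 2%:R != 0 :> L.

(** The Cayley transform turns inversion into a change of sign: G acts on p, q by signed permutation
    matrices, and on z = p / q by inversions and signs. *)
Let cay (t : L) := (1 + t) / (1 - t).
Let p := cay X.
Let q := cay Y.
Let z := p / q.

Let cayV e t : ~ cl Kb t -> cay (sg e t) = (-1) ^+ e * cay t.
Proof.
case: e => [/neq1 [h0 h1 h2]|_] /=; last by rewrite mul1r.
rewrite /cay; field; rewrite h0 h1 /=.
by rewrite -opprB oppr_eq0 h1.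
Qed.

Let to_cay t s : s \in G -> to (cay t) s = cay (to t s).
Proof.
move=> hs; have [f fE] := to_rmorph toB toMm hs.
by rewrite /cay -!fE fmorph_div rmorphB rmorphD rmorph1.
Qed.

Let pqact s w e1 e2 : s \in G -> sact X Y s w e1 e2 ->
  to p s = (-1) ^+ e1 * (if w then q else p) /\ to q s = (-1) ^+ e2 * (if w then p else q).
Proof. by move=> hs [a1 a2]; rewrite /p /q !to_cay // a1 a2 !cayV //; case: (w). Qed.

Let cay_gen (Z : L -> Prop) t : ~ cl Kb t -> gen Z (cay t) -> gen Z t.
Proof.
move=> /neq1 [h0 h1 h2] hc.
have c10 : cay t + 1 != 0.
  have -> : cay t + 1 = 2%:R / (1 - t) by rewrite /cay; field.
  by rewrite mulf_neq0 // invr_neq0.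
have -> : t = (cay t - 1) / (cay t + 1).
  rewrite /cay; field; rewrite h1 /=.
  have -> : 1 + t + (1 - t) = 2%:R by ring.
  by rewrite two.
by apply: gen_div; [apply: gen_sub|apply: genD] => //; apply: gen_one.
Qed.

Let pq_gen (Z : L -> Prop) : (forall v, Kb v -> gen Z v) -> gen Z p -> gen Z q -> forall v, gen Z v.
Proof.
move=> hZ hp hq v; case: XY => /(_ v) hgen _; apply: gen_le hgen => u [[/hZ//|->]|->].
  exact: cay_gen.
exact: cay_gen.
Qed.

Let p0 : p != 0.
Proof. by case: (neq1 XT) => h0 h1 h2; rewrite mulf_neq0 ?invr_neq0. Qed.
Let q0 : q != 0.
Proof. by case: (neq1 YT) => h0 h1 h2; rewrite mulf_neq0 ?invr_neq0. Qed.
Let z0 : z != 0. Proof. by rewrite mulf_neq0 ?invr_neq0 ?p0 ?q0. Qed.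
Let pE : p = z * q. Proof. by rewrite /z mulfVK ?q0. Qed.

Let zq_gen v : gen (ext (ext Kb z) q) v.
Proof.
apply: pq_gen; last exact: gen_extr.
  by move=> u hu; apply/gen_ext/gen_ext/gen_in.
by rewrite pE; apply: genM; [apply/gen_ext|]; apply: gen_extr.
Qed.

Let zT : ~ cl Kb z.
Proof.
by have [] : ~ cl Kb z /\ ~ cl (ext Kb z) q
  by apply: (trdeg_two (sl_x sl) (sl_y sl)); apply: cl_gen.
Qed.

Let sgn_gen (Z : L -> Prop) (e : bool) : gen Z ((-1) ^+ e).
Proof. by apply/genX/genN/gen_one. Qed.

Let zact s w e1 e2 : s \in G -> sact X Y s w e1 e2 -> to z s = (-1) ^+ (e1 (+) e2) * sg w z.
Proof.
move=> hs /(pqact hs) [a1 a2]; have [f fE] := to_rmorph toB toMm hs.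
rewrite /z -fE fmorph_div !fE a1 a2 signr_addb; have := p0; have := q0.
by case: w e1 e2 {a1 a2} => [] [] []; rewrite /= ?expr0 ?expr1 => h1 h2; field; rewrite ?oppr_eq0 ?oner_eq0 ?h1 ?h2.
Qed.

Let z_stable : stable to (ext Kb z).
Proof.
apply: stable_ext => //; first exact: Kb_stable sl.
move=> s hs; have [w [e1 [e2 a]]] := (proj2 XY) s hs; rewrite (zact hs a).
by apply: genM => //; case: w {a}; [apply: genV|]; apply: gen_extr.
Qed.

Let q_affine : affine_over to (ext Kb z) q.
Proof.
move=> s hs; have [w [e1 [e2 a]]] := (proj2 XY) s hs; have [_ ->] := pqact hs a.
exists ((-1) ^+ e2 * (if w then z else 1)), 0; split.
- by apply: genM => //; case: (w); [apply: gen_extr|apply: gen_one].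
- exact: gen0.
- by case: (w); rewrite ?pE; ring.
Qed.

Let fibration w : affine_over to Kb w ->
  (forall v, gen (ext Kb z) v -> inv to v -> gen (ext Kb w) v) ->
  rational (fun c : k => iK c%:A) (inv to).
Proof. by move=> h1 h2; apply: (rational_fibration sl z_stable q_affine h1 h2). Qed.

Let c1_affine (w : L) : ~ cl Kb w -> (forall s, s \in G -> to w s = w \/ to w s = w^-1) ->
  affine_over to Kb (c1 w).
Proof.
move=> wT hw s hs; rewrite to_c1 //; case: (hw s hs) => ->.
  by exists 1, 0; split; [apply: gen_one|apply: gen0|ring].
by exists (-1), 1; split; [apply/genN/gen_one|apply: gen_one|rewrite c1V //; ring].
Qed.

Let c1_gen w v : ~ cl Kb w -> gen (ext Kb w) v -> gen (ext Kb (c1 w)) v.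
Proof.
move=> wT; apply: gen_ext_le => [u hu|]; first exact/gen_ext/gen_in.
by rewrite [X in gen _ X](c1E wT); apply: gen_sub (gen_one _) (genV (gen_extr _ _)).
Qed.

Let sgn_affine w : (forall s, s \in G -> exists e : bool, to w s = (-1) ^+ e * w) ->
  affine_over to Kb w.
Proof.
move=> hw s hs; have [e ->] := hw s hs; exists ((-1) ^+ e), 0.
by split; [|apply: gen0|rewrite addr0].
Qed.

(** If no element exchanges the coordinates, z is kept up to sign. Otherwise let g exchange them
    with equal signs. A diagonal element with unequal signs, multiplied by g, would be a rotation;
    so all signs are equal and z goes to z or 1 / z. *)
Let no_rotation : (forall s e1 e2, s \in G -> sact X Y s true e1 e2 -> e1 = e2) ->
  rational (fun c : k => iK c%:A) (inv to).
Proof.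
move=> hr; have [[g [e [hg ga]]]|ng] := pselect (exists g e, g \in G /\ sact X Y g true e e); last first.
  apply: (@fibration z) => // s hs; have [w [e1 [e2 a]]] := (proj2 XY) s hs.
  move: a; case: w => a; first by case: ng; exists s, e1; split=> //; rewrite {2}(hr _ _ _ hs a).
  exists ((-1) ^+ (e1 (+) e2)), 0; split; [by []|exact: gen0|].
  by rewrite (zact hs a) addr0.
apply: (@fibration (c1 z)) => [|v hv _]; last exact: c1_gen.
apply: c1_affine => // s hs; have [w [e1 [e2 a]]] := (proj2 XY) s hs.
have e12 : e1 = e2.
  move: a; case: w => [/(hr _ _ _ hs)//|] a.
  have : sact X Y (s * g)%g true (e1 (+) e) (e2 (+) e).
    have [f fE] := to_rmorph toB toMm hg.
    case: a ga => [a1 a2] [b1 b2]; split; rewrite to_comp // ?a1 ?a2 /sg.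
      by rewrite -fE; case: (e1); rewrite ?fmorphV fE b1; case: (e); rewrite /sg /= ?invrK.
    by rewrite -fE; case: (e2); rewrite ?fmorphV fE b2; case: (e); rewrite /sg /= ?invrK.
  by move=> /(hr _ _ _ (groupM hs hg)) /addIb.
by rewrite (zact hs a) e12 addbb mul1r; case: (w); [right|left].
Qed.

Let quad_fixed h w (a b : L) : h \in H -> gen (ext Kb w) a -> gen (ext Kb w) b ->
    z ^+ 2 = a * z + b -> to w h = w -> to z h != z ->
  forall v, gen (ext Kb z) v -> inv to v -> gen (ext Kb w) v.
Proof.
move=> hh ha hb zab wh zh v hv vI; have hG := subsetP sHG h hh.
apply: (fixed_in_quadratic toB toMm hG _ ha hb zab zh _ (vI h hG)) => [u [hu|->] //|].
  by apply: (proj1 (memH hG) hh); apply: gen_in.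
by apply: gen_ext_le hv => [u hu|]; [apply/gen_ext/gen_ext/gen_in | apply: gen_extr].
Qed.

Let z2 (e : bool) : z ^+ 2 != (-1) ^+ e.
Proof.
apply/eqP => h; apply: zT; apply/cl_polyP; exists ('X^2 - ((-1) ^+ e)%:P); split.
- by rewrite -size_poly_gt0 size_XnsubC.
- by rewrite rpredB ?polyOverXn ?polyOverC //; apply/genpP.
- by rewrite /root !(hornerD, hornerN, hornerXn, hornerC) h subrr.
Qed.

(** A nonscalar h in H moves z, either to d / z with a sign d or to - z. Then z is quadratic over
    K(w) for w = z + d / z or w = z^2, and w is fixed by h. On w the group acts by signs in the
    first case and by inversions in the second. *)
Let nonscalar h : h \in H -> ~ (exists e, sact X Y h false e e) ->
  rational (fun c : k => iK c%:A) (inv to).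
Proof.
move=> hh hn; have hG := subsetP sHG h hh; have [w [e1 [e2 a]]] := (proj2 XY) h hG.
have ha := zact hG a; move: a ha; case: w => a ha.
  pose w := z + (-1) ^+ (e1 (+) e2) / z.
  apply: (@fibration w).
    apply: sgn_affine => s hs; have [v [f1 [f2 b]]] := (proj2 XY) s hs.
    exists (f1 (+) f2 (+) (v && (e1 (+) e2))); have [f fE] := to_rmorph toB toMm hs.
    rewrite /w -fE rmorphD [f (_ ^+ _ / _)]fmorph_div rmorphXn rmorphN1 !fE (zact hs b) /sg; move: z0.
    by case: v (e1) (e2) (f1) (f2) {b} => [] [] [] [] [] h0; rewrite /= ?expr0 ?expr1; field; rewrite ?oppr_eq0 ?oner_eq0 ?h0.
  apply: (quad_fixed (a := w) (b := - (-1) ^+ (e1 (+) e2)) hh).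
  - exact: gen_extr.
  - exact: genN.
  - by rewrite /w; field; rewrite z0.
  - have [f fE] := to_rmorph toB toMm hG; rewrite /w -fE rmorphD [f (_ ^+ _ / _)]fmorph_div rmorphXn rmorphN1 !fE ha.
    by move: z0; case: (e1) (e2) => [] [] h0 /=; rewrite /= ?expr0 ?expr1; field; rewrite ?oppr_eq0 ?oner_eq0 ?h0.
  - rewrite ha; apply: contra (z2 (e1 (+) e2)) => /eqP e; apply/eqP.
    by rewrite expr2 -{1}e /sg mulfVK ?z0.
have e12 : e1 (+) e2.
  by move: hn a; case: (e1) (e2) => [] [] //= hn a; case: hn; [exists true | exists false].
rewrite e12 /= mulN1r in ha.
have zzT : ~ cl Kb (z ^+ 2).
  move=> h0; apply: zT.
  have h1 : cl (ext Kb (z ^+ 2)) z.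
    apply/cl_polyP; exists ('X^2 - (z ^+ 2)%:P); split.
    + by rewrite -size_poly_gt0 size_XnsubC.
    + by rewrite rpredB ?polyOverXn ?polyOverC //; apply/genpP/gen_extr.
    + by rewrite /root !(hornerD, hornerN, hornerXn, hornerC) subrr.
  by apply: cl_trans h1 => u [hu|-> //]; apply: cl_gen; apply: gen_in.
apply: (@fibration (c1 (z ^+ 2))).
  apply: c1_affine => // s hs; have [v [f1 [f2 b]]] := (proj2 XY) s hs.
  have [f fE] := to_rmorph toB toMm hs; rewrite -fE rmorphXn fE (zact hs b) exprMn.
  by rewrite sqrr_sign mul1r; case: (v); [right; rewrite exprVn | left].
move=> v hv vI; apply: c1_gen => //.
apply: (quad_fixed (a := 0) (b := z ^+ 2) hh _ _ _ _ _ hv vI).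
- exact: gen0.
- exact: gen_extr.
- by rewrite mul0r add0r.
- by have [f fE] := to_rmorph toB toMm hG; rewrite -fE rmorphXn fE ha sqrrN.
- by rewrite ha eq_sym -subr_eq0 opprK -mulr2n -mulr_natl mulf_neq0 ?z0.
Qed.

(** Here G / H acts faithfully on K, and p, q span a semilinear representation over K. The trace of
    a suitable multiple of p is a nonzero invariant linear form w = m p + n q. The other coordinate
    is then moved affinely over K(w). *)
Let trivial : (forall h, h \in H -> to X h = X /\ to Y h = Y) ->
  rational (fun c : k => iK c%:A) (inv to).
Proof.
move=> hXY.
have [c [hc nz]] : exists c, gen Kb c /\ \sum_(C in rcosets H G) to p (repr C) * to c (repr C) != 0.
  apply: (dedekind toB toMm sHG memH); last by rewrite to_id p0.
  move=> h s hh hs; have hG := subsetP sHG h hh; rewrite to_comp //; congr (to _ s).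
  by rewrite /p to_cay // (proj1 (hXY h hh)).
set w := \sum_(C in _) _ in nz.
have wI : inv to w.
  move=> g hg; have [f fE] := to_rmorph toB toMm hg.
  have reprG C : C \in rcosets H G -> repr C \in G.
    by case/rcosetsP => s hs ->; case: repr_rcosetP => h hh; rewrite groupM // (subsetP sHG).
  pose F s := to p s * to c s.
  rewrite -[RHS](@sum_rcosets_mulr _ _ G H F g hg) /w -?fE ?rmorph_sum.
    apply: eq_bigr => C /reprG hC.
    by rewrite /F !to_comp // rmorphM !fE.
  move=> h s hh hs; have hG := subsetP sHG h hh; rewrite /F !to_comp //.
  by rewrite /p to_cay // (proj1 (hXY h hh)) (proj1 (memH hG) hh c hc).
have [m [n [hm hn wE]]] : exists m n, [/\ gen Kb m, gen Kb n & w = m * p + n * q].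
  rewrite /w; apply: (big_ind (fun v => exists m n, [/\ gen Kb m, gen Kb n & v = m * p + n * q])) => [|_ _ [m [n [hm hn ->]]] [m' [n' [hm' hn' ->]]]|C hC].
  - by exists 0, 0; split; [apply: gen0|apply: gen0|ring].
  - by exists (m + m'), (n + n'); split; [apply: genD|apply: genD|ring].
  have hG : repr C \in G.
    by case/rcosetsP: hC => s hs ->; case: repr_rcosetP => h hh; rewrite groupM // (subsetP sHG).
  have [v [e1 [e2 a]]] := (proj2 XY) _ hG; have [-> _] := pqact hG a.
  have hd := Kb_stable sl hG hc; set d := to c _ in hd *.
  exists (if v then 0 else (-1) ^+ e1 * d), (if v then (-1) ^+ e1 * d else 0).
  by case: (v); split; try ring; try apply: gen0; apply: genM.
have wG : affine_over to Kb w.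
  by move=> s hs; exists 1, 0; split; [apply: gen_one|apply: gen0|rewrite wI //; ring].
have [n0|n0] := eqVneq n 0.
  have m0 : m != 0 by apply: contraNneq nz => m0; rewrite wE n0 m0 !mul0r addr0.
  have pw : p = w / m by rewrite wE n0; field.
  apply: (@rational_tower _ _ _ _ _ _ _ _ _ sl w q wG).
    move=> s hs; have [v [e1 [e2 a]]] := (proj2 XY) s hs; have [_ ->] := pqact hs a.
    case: (v).
      exists 0, ((-1) ^+ e2 * p); split; [exact: gen0| |by rewrite mul0r add0r].
      by apply: genM => //; rewrite pw; apply: gen_div (gen_extr _ _) (gen_ext _ hm).
    by exists ((-1) ^+ e2), 0; split; [|apply: gen0|rewrite addr0].
  move=> v _; apply: pq_gen; last exact: gen_extr.
    by move=> u hu; apply/gen_ext/gen_ext/gen_in.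
  rewrite pw; apply: gen_div; first exact/gen_ext/gen_extr.
  exact/gen_ext/gen_ext.
have qw : q = (w - m * p) / n by rewrite wE; field.
apply: (@rational_tower _ _ _ _ _ _ _ _ _ sl w p wG).
  move=> s hs; have [v [e1 [e2 a]]] := (proj2 XY) s hs; have [-> _] := pqact hs a.
  case: (v).
    exists (- (-1) ^+ e1 * m / n), ((-1) ^+ e1 * w / n); split.
    + by apply: gen_div (gen_ext _ hn); apply: genM (gen_ext _ hm); apply: genN.
    + by apply: gen_div (gen_ext _ hn); apply: genM (gen_extr _ _).
    + by rewrite qw; ring.
  by exists ((-1) ^+ e1), 0; split; [|apply: gen0|rewrite addr0].
move=> v _; apply: pq_gen; last first.
- rewrite qw; apply: gen_div; last exact/gen_ext/gen_ext.
  apply: gen_sub; first exact/gen_ext/gen_extr.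
  by apply: genM (gen_extr _ _); apply/gen_ext/gen_ext.
- exact: gen_extr.
- by move=> u hu; apply/gen_ext/gen_ext/gen_in.
Qed.

Lemma rational_odd_char : ~ exceptional X Y -> rational (fun c : k => iK c%:A) (inv to).
Proof.
move=> nex.
have [[s [e1 [e2 [hs [a e12]]]]]|nrot] := pselect (exists s e1 e2,
    s \in G /\ sact X Y s true e1 e2 /\ e1 != e2); last first.
  apply: no_rotation => s e1 e2 hs a; apply/eqP/negPn/negP => e12.
  by apply: nrot; exists s, e1, e2.
have [hsc|] := pselect (forall h, h \in H -> exists e, sact X Y h false e e); last first.
  by move/existsNP => [h /not_implyP [hh]]; apply: nonscalar.
(* A rotation exists and H is scalar, so an element of H acting as -1 would make the basis
   exceptional. *)
apply: trivial => h hh; have [[] [a1 a2]] := hsc h hh; last by [].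
case: nex; split=> //; last by exists h.
exists s, e1; split=> //; move: e12 a.
by case: (e1); case: (e2).
Qed.

End OddChar.

Lemma rational_signed : ~ (2%:R != 0 :> L /\ exceptional X Y) ->
  rational (fun c : k => iK c%:A) (inv to).
Proof.
move=> nex; have [two|two] := eqVneq (2%:R : L) 0; first exact: rational_char2.
by apply: rational_odd_char => // ex; apply: nex.
Qed.

End SignedBasis.

(** * Three coordinates with product one *)

Lemma ord3P (P : 'I_3 -> Prop) :
  P (Ordinal (isT : (0 < 3)%N)) -> P (Ordinal (isT : (1 < 3)%N)) ->
  P (Ordinal (isT : (2 < 3)%N)) -> forall i, P i.
Proof.
move=> h0 h1 h2 [[|[|[|//]]] hi].
- by rewrite (_ : Ordinal hi = Ordinal (isT : (0 < 3)%N)) //; apply: val_inj.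
- by rewrite (_ : Ordinal hi = Ordinal (isT : (1 < 3)%N)) //; apply: val_inj.
- by rewrite (_ : Ordinal hi = Ordinal (isT : (2 < 3)%N)) //; apply: val_inj.
Qed.

Notation o0 := (Ordinal (isT : (0 < 3)%N)).
Notation o1 := (Ordinal (isT : (1 < 3)%N)).
Notation o2 := (Ordinal (isT : (2 < 3)%N)).

Lemma sum3 (V : nmodType) (F : 'I_3 -> V) : \sum_i F i = F o0 + F o1 + F o2.
Proof.
rewrite !big_ord_recl big_ord0 addr0 addrA.
by congr (F _ + F _ + F _); apply: val_inj.
Qed.

Lemma prod3 (R : pzSemiRingType) (F : 'I_3 -> R) : \prod_i F i = F o0 * F o1 * F o2.
Proof.
rewrite !big_ord_recl big_ord0 mulr1 mulrA.
by congr (F _ * F _ * F _); apply: val_inj.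
Qed.

Section Hexagon.
Variables (k : fieldType) (K : fieldExtType k) (L : fieldType) (iK : {rmorphism K -> L}).
Variables (x y : L) (gT : finGroupType) (G : {group gT}) (to : action G L).
Hypothesis sl : semilinear_action iK x y to.
Let toB := sl_add sl.
Let toMm := sl_mul sl.
Local Notation Kb := (Kb iK).

Definition hx (a b : L) (i : 'I_3) : L := [:: a; b; (a * b)^-1]`_i.

Definition hact a b s (p : {perm 'I_3}) (e : bool) :=
  forall i, to (hx a b i) s = sg e (hx a b (p i)).

Definition hexagonal_basis (a b : L) :=
  (forall z, gen (ext (ext Kb a) b) z) /\
  forall s, s \in G -> exists p e, hact a b s p e.

Variables a b : L.
Hypothesis ab : hexagonal_basis a b.
Local Notation h := (hx a b).

Lemma hex_transc : ~ cl Kb a /\ ~ cl (ext Kb a) b.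
Proof. by apply: (trdeg_two (sl_x sl) (sl_y sl)); apply: cl_gen; case: ab. Qed.

Lemma hex_neq0 : a != 0 /\ b != 0.
Proof.
have [ha hb] := hex_transc; split; rewrite -[X in X != 0]subr0.
  exact: transc_neq ha (gen0 _).
exact: transc_neq hb (gen0 _).
Qed.

Lemma hex_poly_eq0 (r : seq (L * (nat * nat))) :
    (forall p, p \in r -> gen Kb p.1) -> uniq (unzip2 r) ->
    \sum_(p <- r) p.1 * a ^+ p.2.1 * b ^+ p.2.2 = 0 -> forall p, p \in r -> p.1 = 0.
Proof. by have [ha hb] := hex_transc; apply: bivariate_eq0. Qed.

Lemma hx_neq0 i : h i != 0.
Proof.
have [a0 b0] := hex_neq0.
by elim/ord3P: i => //=; rewrite invr_neq0 // mulf_neq0.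
Qed.

(** Exponents after multiplication by a b, which makes them nonnegative; the six pairs are
    different. *)
Let expo (i : 'I_3) (e : bool) : nat * nat :=
  nth (0, 0)%N (if e then [:: (0, 1); (1, 0); (2, 2)]%N else [:: (2, 1); (1, 2); (0, 0)]%N) i.

Let expoE i e : sg e (h i) * (a * b) = a ^+ (expo i e).1 * b ^+ (expo i e).2.
Proof.
have [a0 b0] := hex_neq0.
by elim/ord3P: i; case: e; rewrite /expo /hx /sg /= ?invrK; field; rewrite ?a0 ?b0.
Qed.

Lemma monom_inj (m n : nat * nat) :
  a ^+ m.1 * b ^+ m.2 = a ^+ n.1 * b ^+ n.2 -> m = n.
Proof.
by have [ha hb] := hex_transc; apply: monomial_inj ha hb.
Qed.

Lemma sg_hx_inj i j e f : sg e (h i) = sg f (h j) -> i = j /\ e = f.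
Proof.
move=> eq_ij; have : expo i e = expo j f by apply: monom_inj; rewrite -!expoE eq_ij.
by move: i j {eq_ij}; elim/ord3P; elim/ord3P; case: e; case: f.
Qed.

Lemma hx_neq1 i : h i != 1.
Proof.
apply/eqP => hi; have : expo i false = (1, 1)%N.
  by apply: monom_inj; rewrite -expoE /sg hi mul1r !expr1.
by move: i {hi}; elim/ord3P.
Qed.

(** The constants 2 and 3 move the unit a = b = c = 1 of the torus to the origin. They make the
    relations [hA_hB] and [hA_mul_hB] homogeneous, of degrees 1 and 2: a quadric surface.
    Permutations of a, b, c permute the [hal i]; inversion fixes these and exchanges [hA] and
    [hB]. *)
Definition hal i := h i + (h i)^-1 - 2%:R.
Definition hA := \sum_i h i - 3%:R.
Definition hB := \sum_i (h i)^-1 - 3%:R.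
Local Notation al := hal.
Local Notation A := hA.
Local Notation B := hB.

Lemma hA_hB : A + B = al o0 + al o1 + al o2.
Proof. by rewrite /hA /hB /hal !sum3; ring. Qed.

Lemma hA_mul_hB : A * B = al o0 * al o1 + al o0 * al o2 + al o1 * al o2.
Proof.
have [a0 b0] := hex_neq0.
by rewrite /hA /hB /hal !sum3 /hx /= ?invrK; field; rewrite ?a0 ?b0.
Qed.

Lemma hB_hal0 : B - al o0 = a * (A - al o0).
Proof.
have [a0 b0] := hex_neq0.
by rewrite /hA /hB /hal !sum3 /hx /= ?invrK; field; rewrite ?a0 ?b0.
Qed.

Lemma hB_hal1 : B - al o1 = b * (A - al o1).
Proof.
have [a0 b0] := hex_neq0.
by rewrite /hA /hB /hal !sum3 /hx /= ?invrK; field; rewrite ?a0 ?b0.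
Qed.

Lemma hA_sub_hB : A - B = - (1 - h o0) * (1 - h o1) * (1 - h o2).
Proof.
have [a0 b0] := hex_neq0.
by rewrite /hA /hB !sum3 /hx /= ?invrK; field; rewrite ?a0 ?b0.
Qed.

Lemma hA_neq_hB : A != B.
Proof.
by rewrite -subr_eq0 hA_sub_hB !mulf_neq0 ?oppr_eq0 // subr_eq0 eq_sym hx_neq1.
Qed.

Lemma hA_sub_hal : A - al o0 = - (1 - h o1) * (1 - h o2) /\ A - al o1 = - (1 - h o0) * (1 - h o2).
Proof.
have [a0 b0] := hex_neq0.
by split; rewrite /hA /hal !sum3 /hx /= ?invrK; field; rewrite ?a0 ?b0.
Qed.

(** Multiplied by a b, the three al contribute the monomials a^2 b, b, then a b^2, a, and a^2 b^2,
    1; these are distinct from each other and from a b. *)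
Lemma hal_free (c0 c1 c2 c3 : L) : gen Kb c0 -> gen Kb c1 -> gen Kb c2 -> gen Kb c3 ->
  c0 * al o0 + c1 * al o1 + c2 * al o2 + c3 = 0 -> [/\ c0 = 0, c1 = 0 & c2 = 0].
Proof.
move=> h0 h1 h2 h3 e; have [a0 b0] := hex_neq0.
pose r : seq (L * (nat * nat)) :=
  [:: (c0, (2, 1)%N); (c0, (0, 1)%N); (c1, (1, 2)%N); (c1, (1, 0)%N);
      (c2, (2, 2)%N); (c2, (0, 0)%N); (c3 - 2%:R * (c0 + c1 + c2), (1, 1)%N)].
have rX p : p \in r -> gen Kb p.1.
  rewrite !inE => /or4P [||| /or4P []] /eqP -> //=.
  by apply: gen_sub => //; apply: genM; [apply: gen_nat | apply: genD => //; apply: genD].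
have r0 : \sum_(p <- r) p.1 * a ^+ p.2.1 * b ^+ p.2.2 = 0.
  transitivity (a * b * (c0 * al o0 + c1 * al o1 + c2 * al o2 + c3)); last by rewrite e mulr0.
  rewrite /r !big_cons big_nil /= /hal /hx /= ?invrK.
  by field; rewrite a0 b0.
have rc := @hex_poly_eq0 r rX isT r0.
by split; [apply: (rc (c0, (2, 1)%N)) | apply: (rc (c1, (1, 2)%N)) | apply: (rc (c2, (2, 2)%N))];
  rewrite /r !inE eqxx ?orbT.
Qed.

(* [(A : B : al0 : al1 : al2)] embeds the torus birationally as a quadric. *)
Lemma hex_recover (Z : L -> Prop) d : d != 0 -> (forall v, Kb v -> gen Z v) ->
    gen Z (al o0 / d) -> gen Z (al o1 / d) -> gen Z (A / d) -> gen Z (B / d) ->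
  forall v, gen Z v.
Proof.
move=> d0 hZ g0 g1 gA gB v.
have [dA0 dA1] := hA_sub_hal.
have n0 : A - al o0 != 0.
  by rewrite dA0 mulf_neq0 ?oppr_eq0 // subr_eq0 eq_sym hx_neq1.
have n1 : A - al o1 != 0.
  by rewrite dA1 mulf_neq0 ?oppr_eq0 // subr_eq0 eq_sym hx_neq1.
case: ab => /(_ v) hv _; apply: gen_le hv => u [[/hZ //|->]|->].
  have -> : a = (B / d - al o0 / d) / (A / d - al o0 / d).
    by rewrite -!mulrBl hB_hal0; field; rewrite d0 n0.
  by apply: gen_div; apply: gen_sub.
have -> : b = (B / d - al o1 / d) / (A / d - al o1 / d).
  by rewrite -!mulrBl hB_hal1; field; rewrite d0 n1.
by apply: gen_div; apply: gen_sub.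
Qed.

Lemma hal_sum_neq c : gen Kb c -> al o0 + al o1 + al o2 + c != 0.
Proof.
move=> hc; apply/eqP; rewrite -[al o0]mul1r -[al o1]mul1r -[al o2]mul1r => e.
have h1 := gen_one Kb; have [/eqP + _ _] := hal_free h1 h1 h1 hc e.
by rewrite oner_eq0.
Qed.

Lemma hal_neq i j : i != j -> al i != al j.
Proof.
move=> ij; rewrite -subr_eq0; apply/eqP => e.
have h1 := gen_one Kb; have hN := genN h1; have h0 := gen0 Kb.
have c i' : gen Kb ((i' == i)%:R - (i' == j)%:R) by apply: gen_sub; apply: gen_nat.
have [||] := @hal_free _ _ _ 0 (c o0) (c o1) (c o2).
- exact: h0.
- by rewrite addr0 -[RHS]e; move: i j ij {e c}; elim/ord3P; elim/ord3P => //= _; ring.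
by move: i j ij {e c}; elim/ord3P; elim/ord3P => //= _ /eqP + /eqP + /eqP;
  rewrite ?subr0 ?sub0r ?oppr_eq0 oner_eq0.
Qed.

Lemma hal_neq0 i : al i != 0.
Proof.
have h0 := hx_neq0 i; have -> : al i = (h i - 1) ^+ 2 / h i by rewrite /hal; field.
by rewrite mulf_neq0 ?invr_neq0 // expf_neq0 // subr_eq0 hx_neq1.
Qed.

Lemma to_hal s p e i : s \in G -> hact a b s p e -> to (al i) s = al (p i).
Proof.
move=> hs hp; have [f fE] := to_rmorph toB toMm hs.
rewrite /hal -fE rmorphB rmorphD fmorphV rmorph_nat fE hp.
by case: e {hp}; rewrite //= invrK; ring.
Qed.

Lemma to_hAB s p e : s \in G -> hact a b s p e ->
  to A s = (if e then B else A) /\ to B s = (if e then A else B).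
Proof.
move=> hs hp; have [f fE] := to_rmorph toB toMm hs.
have hpV i : to (h i)^-1 s = sg e (h (p i))^-1.
  by rewrite -fE fmorphV fE hp; case: (e).
split; rewrite /hA /hB -fE rmorphB rmorph_sum rmorph_nat.
  have -> : \sum_i f (h i) = \sum_i sg e (h (p i)) by apply: eq_bigr => i _; rewrite fE.
  rewrite -(reindex_inj (@perm_inj _ p) (P := xpredT) (F := fun i => sg e (h i))).
  by case: e {hp hpV}.
have -> : \sum_i f (h i)^-1 = \sum_i sg e (h (p i))^-1 by apply: eq_bigr => i _; rewrite fE.
rewrite -(reindex_inj (@perm_inj _ p) (P := xpredT) (F := fun i => sg e (h i)^-1)).
by case: e {hp hpV} => //=; congr (_ - _); apply: eq_bigr => i _; rewrite invrK.
Qed.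

End Hexagon.

Lemma perm3P (p : {perm 'I_3}) (P : 'I_3 -> 'I_3 -> 'I_3 -> Prop) :
  P o0 o1 o2 -> P o1 o2 o0 -> P o2 o0 o1 -> P o1 o0 o2 -> P o0 o2 o1 -> P o2 o1 o0 ->
  P (p o0) (p o1) (p o2).
Proof.
move=> h1 h2 h3 h4 h5 h6.
have n01 : p o0 != p o1 by rewrite (inj_eq perm_inj).
have n02 : p o0 != p o2 by rewrite (inj_eq perm_inj).
have n12 : p o1 != p o2 by rewrite (inj_eq perm_inj).
by move: (p o0) (p o1) (p o2) n01 n02 n12; elim/ord3P; elim/ord3P; elim/ord3P.
Qed.

Section HexagonAction.
Variables (k : fieldType) (K : fieldExtType k) (L : fieldType) (iK : {rmorphism K -> L}).
Variables (x y : L) (gT : finGroupType) (G : {group gT}) (to : action G L).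
Hypothesis sl : semilinear_action iK x y to.
Let toB := sl_add sl.
Let toMm := sl_mul sl.
Variable H : {group gT}.
Hypothesis sHG : H \subset G.
Hypothesis memH : forall s, s \in G -> (s \in H <-> forall c, gen (Kb iK) c -> to c s = c).
Local Notation Kb := (Kb iK).
Variables a b : L.
Hypothesis ab : hexagonal_basis iK to a b.
Local Notation h := (hx a b).
Local Notation al := (hal a b).
Local Notation A := (hA a b).
Local Notation B := (hB a b).
Variables (pi : gT -> {perm 'I_3}) (ep : gT -> bool).
Hypothesis piP : forall s, s \in G -> hact to a b s (pi s) (ep s).

Lemma hact_uniq s p e p' e' : hact to a b s p e -> hact to a b s p' e' -> p = p' /\ e = e'.
Proof.
move=> h1 h2; have pq i : p i = p' i /\ e = e'.
  by apply: (sg_hx_inj sl ab); rewrite -h1 -h2.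
by split; [apply/permP => i; case: (pq i) | case: (pq o0)].
Qed.

Lemma pi_mul s r : s \in G -> r \in G -> pi (s * r)%g = (pi s * pi r)%g /\ ep (s * r)%g = ep s (+) ep r.
Proof.
move=> hs hr; apply: hact_uniq (piP (groupM hs hr)) _ => i.
have [f fE] := to_rmorph toB toMm hr.
rewrite to_comp // (piP hs) permM -fE; case: (ep s); rewrite /sg /= ?fmorphV fE (piP hr) //.
by case: (ep r); rewrite /sg /= ?invrK.
Qed.

Let reprG C : C \in rcosets H G -> repr C \in G.
Proof.
by case/rcosetsP => s hs ->; case: repr_rcosetP => u hu; rewrite groupM // (subsetP sHG).
Qed.

Lemma coset_sum_act (F : gT -> L) c g : g \in G -> gen Kb c ->
    (forall u s, u \in H -> s \in G -> F (u * s)%g = F s) ->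
  forall F' : gT -> L, (forall s, s \in G -> to (F s) g = F' (s * g)%g) ->
    (forall u s, u \in H -> s \in G -> F' (u * s)%g = F' s) ->
  to (\sum_(C in rcosets H G) F (repr C) * to c (repr C)) g =
  \sum_(C in rcosets H G) F' (repr C) * to c (repr C).
Proof.
move=> hg hc FH F' FF' F'H; have [f fE] := to_rmorph toB toMm hg.
rewrite -(sum_rcosets_mulr (H := H) (F := fun s => F' s * to c s) hg).
  rewrite -fE rmorph_sum; apply: eq_bigr => C /reprG hC.
  by rewrite rmorphM !fE FF' // to_comp.
move=> u s hu hs; have uG := subsetP sHG u hu.
by rewrite F'H // to_comp // (proj1 (memH uG) hu).
Qed.

Lemma coset_sum_gen (F : gT -> L) c : gen Kb c -> (forall s, gen Kb (F s)) ->
  gen Kb (\sum_(C in rcosets H G) F (repr C) * to c (repr C)).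
Proof.
move=> hc hF; apply/genpP/rpred_sum => C /reprG hC; apply/genpP/genM => //.
exact: (Kb_stable sl).
Qed.

(** [th i] is a trace of some c in K with the weight [pi s o0 == i], a function on cosets because
    [pi] is trivial on H. That th0 and th1 differ is [dedekind] for the difference of two weights;
    s0 carries this to the other pairs. *)
Lemma permuted_triple s0 : s0 \in G -> pi s0 o0 = o1 -> pi s0 o1 = o2 ->
    (forall u, u \in H -> pi u = 1%g) ->
  exists th : 'I_3 -> L, [/\ forall i, gen Kb (th i),
    forall s, s \in G -> forall i, to (th i) s = th (pi s i)
    & [/\ th o0 != th o1, th o1 != th o2 & th o2 != th o0]].
Proof.
move=> hs0 p01 p12 H1.
have p20 : pi s0 o2 = o0.
  move: p01 p12.
  apply: (perm3P (pi s0) (P := fun u v w => u = o1 -> v = o2 -> w = o0)) => //.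
have piH u s : u \in H -> s \in G -> pi (u * s)%g = pi s.
  by move=> hu hs; rewrite (proj1 (pi_mul (subsetP sHG u hu) hs)) H1 // mul1g.
pose F i s : L := (pi s o0 == i)%:R.
have FH i u s : u \in H -> s \in G -> F i (u * s)%g = F i s by move=> hu hs; rewrite /F piH.
have [c [hc nz]] : exists c, gen Kb c /\
    \sum_(C in rcosets H G) (F o0 (repr C) - F o1 (repr C)) * to c (repr C) != 0.
  apply: (dedekind toB toMm sHG memH (psi := fun s => F o0 s - F o1 s)).
    by move=> u s hu hs; rewrite !FH.
  by rewrite /F H1 // perm1 subr0 oner_neq0.
pose th i := \sum_(C in rcosets H G) F i (repr C) * to c (repr C).
have thE s : s \in G -> forall i, to (th i) s = th (pi s i).
  move=> hs i; apply: coset_sum_act => // [u r|r hr|u r].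
  - exact: FH.
  - have [f fE] := to_rmorph toB toMm hs.
    by rewrite /F -fE rmorph_nat (proj1 (pi_mul hr hs)) permM (inj_eq perm_inj).
  - exact: FH.
have t01 : th o0 != th o1.
  rewrite -subr_eq0; suff -> : th o0 - th o1 =
    \sum_(C in rcosets H G) (F o0 (repr C) - F o1 (repr C)) * to c (repr C) by [].
  by rewrite /th -sumrB; apply: eq_bigr => C _; rewrite mulrBl.
have [f fE] := to_rmorph toB toMm hs0.
have t12 : th o1 != th o2 by rewrite -p12 -{1}p01 -!thE // -!fE fmorph_eq.
have t20 : th o2 != th o0 by rewrite -p20 -{1}p12 -!thE // -!fE fmorph_eq.
exists th; split=> // i; apply: coset_sum_gen => // s; exact: gen_nat.
Qed.

Lemma sign_eigenvector : (forall u, u \in H -> ep u = false) ->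
  exists de, [/\ gen Kb de, de != 0 & forall s, s \in G -> to de s = (-1) ^+ (ep s) * de].
Proof.
move=> H1; have epH u s : u \in H -> s \in G -> ep (u * s)%g = ep s.
  by move=> hu hs; rewrite (proj2 (pi_mul (subsetP sHG u hu) hs)) H1.
pose F s : L := (-1) ^+ (ep s).
have [c [hc nz]] : exists c, gen Kb c /\ \sum_(C in rcosets H G) F (repr C) * to c (repr C) != 0.
  apply: (dedekind toB toMm sHG memH (psi := F)).
    by move=> u s hu hs; rewrite /F epH.
  by rewrite /F H1 // oner_neq0.
exists (\sum_(C in rcosets H G) F (repr C) * to c (repr C)); split=> //.
  by apply: coset_sum_gen => // s; apply/genX/genN/gen_one.
move=> s hs; rewrite mulr_sumr.
rewrite (@coset_sum_act F c s hs hc _ (fun r => (-1) ^+ (ep s) * F r)).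
- by apply: eq_bigr => C _; rewrite mulrA.
- by move=> u r hu hr; rewrite /F epH.
- move=> r hr; have [f fE] := to_rmorph toB toMm hs.
  rewrite /F -fE rmorph_sign (proj2 (pi_mul hr hs)) signr_addb.
  by rewrite mulrCA -signr_addb addbb mulr1.
- by move=> u r hu hr; rewrite /F epH.
Qed.

Lemma sum_perm3 (F : 'I_3 -> L) (p : {perm 'I_3}) : \sum_i F (p i) = \sum_i F i.
Proof. by rewrite [RHS](reindex_inj (@perm_inj _ p)). Qed.

(** * Projection of the quadric from an invariant point *)

Section Projection.
Variable l : 'I_3 -> L.
Hypothesis lK : forall i, gen Kb (l i).
Hypothesis l0 : forall i, l i != 0.
Hypothesis lsum : l o0 + l o1 + l o2 = 0.
Hypothesis lact : forall s, s \in G -> forall i, to (l i) s = (-1) ^+ (ep s) * l (pi s i).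

(** Since the l i sum to 0, the point al_i = (l i)^2, A = B = m lies on the quadric. It is fixed by
    G, and [f0] = 0 is its tangent plane. Off this plane, projection from the point has the affine
    coordinates t and w, so G acts on them by affine maps. *)
Let e := l o0 * l o1 * l o2.
Let m := - e * \sum_i (l i)^-1.
Let f0 := \sum_i al i * (e / l i).
Let as_ i := al i * (e / l i) / f0.
Let t := l o1 * as_ o0 - l o0 * as_ o1.
Let w := A / f0 - m / (e * l o0) * as_ o0.

Let e0 : e != 0. Proof. by rewrite !mulf_neq0 ?l0. Qed.
Let eK : gen Kb e. Proof. by rewrite /e; apply: genM => //; apply: genM. Qed.
Let mK : gen Kb m.
Proof. by apply: genM; [apply: genN | apply: gen_sum => i; apply: genV]. Qed.

Let f00 : f0 != 0.
Proof.
apply/eqP; rewrite /f0 sum3 ![al _ * _]mulrC -[LHS]addr0 => h0.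
have g i : gen Kb (e / l i) by apply: gen_div.
have [h1 _ _] := hal_free sl ab (g _) (g _) (g _) (gen0 _) h0.
by move/eqP: h1; rewrite mulf_eq0 invr_eq0 (negPf e0) (negPf (l0 _)).
Qed.

Let as_sum : as_ o0 + as_ o1 + as_ o2 = 1.
Proof. by rewrite -sum3 -mulr_suml -/f0 divff ?f00. Qed.

Let e_act s : s \in G -> to e s = (-1) ^+ (ep s) * e.
Proof.
move=> hs; have [f fE] := to_rmorph toB toMm hs.
rewrite /e -prod3 -fE rmorph_prod.
under eq_bigr do rewrite fE lact //.
rewrite big_split /= -(reindex_inj (@perm_inj _ (pi s)) (P := xpredT) (F := l)).
congr (_ * _); rewrite prod3; case: (ep s) => /=; rewrite ?expr0 ?expr1; ring.
Qed.

Let el_act s i : s \in G -> to (e / l i) s = e / l (pi s i).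
Proof.
move=> hs; have [f fE] := to_rmorph toB toMm hs.
rewrite -fE fmorph_div !fE e_act // lact //.
by case: (ep s); rewrite ?expr0 ?expr1 ?mul1r // !mulN1r invrN mulrNN.
Qed.

Let f0_act s : s \in G -> to f0 s = f0.
Proof.
move=> hs; have [f fE] := to_rmorph toB toMm hs.
rewrite /f0 -fE rmorph_sum -[RHS](sum_perm3 _ (pi s)); apply: eq_bigr => i _.
by rewrite rmorphM !fE el_act // (to_hal sl _ hs (piP hs)).
Qed.

Let as_act s i : s \in G -> to (as_ i) s = as_ (pi s i).
Proof.
move=> hs; have [f fE] := to_rmorph toB toMm hs.
by rewrite /as_ -fE fmorph_div rmorphM !fE el_act // f0_act // (to_hal sl _ hs (piP hs)).
Qed.

Let m_act s : s \in G -> to m s = m.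
Proof.
move=> hs; have [f fE] := to_rmorph toB toMm hs.
rewrite /m -fE mulNr mulr_sumr rmorphN rmorph_sum -[in RHS](sum_perm3 _ (pi s)).
congr (- _); apply: eq_bigr => i _.
by rewrite fE el_act.
Qed.

Let mel_act s i : s \in G -> to (m / (e * l i)) s = m / (e * l (pi s i)).
Proof.
move=> hs; have [f fE] := to_rmorph toB toMm hs.
rewrite -fE fmorph_div rmorphM !fE m_act // e_act // lact //.
by rewrite mulrACA -signr_addb addbb mul1r.
Qed.

Let aff Z (v u : L) := exists c d, [/\ gen Z c, gen Z d & v = c * u + d].

Let asl i j : aff Kb (l j * as_ i - l i * as_ j) t.
Proof.
have a2 : as_ o2 = 1 - as_ o0 - as_ o1 by rewrite -as_sum; ring.
have l2 : l o2 = - l o0 - l o1 by apply/eqP; rewrite -subr_eq0 -lsum; apply/eqP; ring.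
have K1 := gen_one Kb; have KN1 := genN K1; have K0 := gen0 Kb.
move: i j; elim/ord3P; elim/ord3P.
- by exists 0, 0; split=> //; ring.
- by exists 1, 0; split=> //; rewrite /t; ring.
- by exists (-1), (- l o0); split=> //; [exact: genN | rewrite /t a2 l2; ring].
- by exists (-1), 0; split=> //; rewrite /t; ring.
- by exists 0, 0; split=> //; ring.
- by exists 1, (- l o1); split=> //; [exact: genN | rewrite /t a2 l2; ring].
- by exists 1, (l o0); split=> //; rewrite /t a2 l2; ring.
- by exists (-1), (l o1); split=> //; rewrite /t a2 l2; ring.
- by exists 0, 0; split=> //; ring.
Qed.

Let affD Z u v v' : aff Z v u -> aff Z v' u -> aff Z (v + v') u.
Proof.
move=> [c [d [hc hd ->]]] [c' [d' [hc' hd' ->]]]; exists (c + c'), (d + d').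
by split; [apply: genD | apply: genD | ring].
Qed.

Let affM Z u v c : gen Z c -> aff Z v u -> aff Z (c * v) u.
Proof.
move=> h0 [d [d' [hd hd' ->]]]; exists (c * d), (c * d').
by split; [apply: genM | apply: genM | ring].
Qed.

Let t_affine : affine_over to Kb t.
Proof.
move=> s hs; have [f fE] := to_rmorph toB toMm hs.
rewrite /t -fE rmorphB (rmorphM f (l o1)) (rmorphM f (l o0)) !fE !as_act // !lact //.
rewrite -!mulrA -mulrBr; apply: affM; last exact: asl.
by apply/genX/genN/gen_one.
Qed.

Let aff_gen Z v u : aff Z v u -> gen (ext Z u) v.
Proof.
case=> c [d [hc hd ->]]; apply: genD (gen_ext _ hd); apply: genM (gen_ext _ hc) (gen_extr _ _).
Qed.

Let mE : m = l o0 ^+ 2 + l o0 * l o1 + l o1 ^+ 2.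
Proof.
have l2 : l o2 = - l o0 - l o1 by apply/eqP; rewrite -subr_eq0 -lsum; apply/eqP; ring.
rewrite /m /e sum3 mulNr; transitivity (- (l o1 * l o2 + l o0 * l o2 + l o0 * l o1)).
  by field; rewrite !l0.
by rewrite l2; ring.
Qed.

Let sE : (al o0 + al o1 + al o2) / f0 = (as_ o0 * l o0 + as_ o1 * l o1 + as_ o2 * l o2) / e.
Proof. by rewrite /as_; field; rewrite !l0 f00 e0. Qed.

Let dl i : aff Kb (as_ o0 / l o0 - as_ i / l i) t.
Proof.
have -> : as_ o0 / l o0 - as_ i / l i = (l i * as_ o0 - l o0 * as_ i) / (l o0 * l i).
  by field; rewrite !l0.
by rewrite mulrC; apply: affM; [apply: genV; apply: genM | apply: asl].
Qed.

(** At the centre of projection al0 + al1 + al2 equals 2 m, so this combination vanishes there and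
    is affine in t. It handles the elements that exchange A and B. *)
Let base2 : aff Kb ((al o0 + al o1 + al o2) / f0 - m / (e * l o0) * (as_ o0 *+ 2)) t.
Proof.
have a2 : as_ o2 = 1 - as_ o0 - as_ o1 by rewrite -as_sum; ring.
have l2 : l o2 = - l o0 - l o1 by apply/eqP; rewrite -subr_eq0 -lsum; apply/eqP; ring.
exists (- (l o0 + l o1 *+ 2) / (l o0 * e)), (l o2 / e); split.
- apply: gen_div; last exact: genM.
  by apply: genN; apply: genD => //; rewrite mulr2n; apply: genD.
- exact: gen_div.
- by rewrite sE mE /t a2 l2; field; rewrite l0 e0.
Qed.

Let w_affine : affine_over to (ext Kb t) w.
Proof.
move=> s hs; have [f fE] := to_rmorph toB toMm hs.
rewrite /w -fE rmorphB (rmorphM f (m / (e * l o0))) (fmorph_div f A) !fE f0_act // as_act // mel_act //.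
have [-> _] := to_hAB sl hs (piP hs); set i := pi s o0.
have meK : gen Kb (m / e) by apply: gen_div.
have e1 : m / (e * l o0) * as_ o0 - m / (e * l i) * as_ i = m / e * (as_ o0 / l o0 - as_ i / l i).
  by field; rewrite !l0 e0.
case: (ep s); last first.
  exists 1, (m / e * (as_ o0 / l o0 - as_ i / l i)); split; first exact: gen_one.
    by apply: aff_gen; apply: affM.
  by rewrite -e1; ring.
exists (-1), ((al o0 + al o1 + al o2) / f0 - m / (e * l o0) * (as_ o0 *+ 2)
   + m / e * (as_ o0 / l o0 - as_ i / l i)); split; first exact/genN/gen_one.
  by apply: aff_gen; apply: affD base2 _; apply: affM.
by rewrite -e1 -(hA_hB a b); ring.
Qed.

Let Z := ext (ext Kb t) w.

Let as0_gen : gen Z (as_ o0).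
Proof.
have a2 : as_ o2 = 1 - as_ o0 - as_ o1 by rewrite -as_sum; ring.
have l2 : l o2 = - l o0 - l o1 by apply/eqP; rewrite -subr_eq0 -lsum; apply/eqP; ring.
(* On a line through the centre the equation of the quadric is linear in [as_ o0], with the
   coefficient 1 / (l0 e) from K. Here b1 and b2 are the values of al1 / f0 and al2 / f0 at [as_ o0]
   = 0. *)
pose b1 := - t * l o1 / (l o0 * e); pose b2 := (1 + t / l o0) * l o2 / e.
have tZ : gen Z t by apply/gen_ext/gen_extr.
have wZ : gen Z w by apply: gen_extr.
have KZ v : gen Kb v -> gen Z v by move=> hv; apply: gen_ext; apply: gen_ext.
have -> : as_ o0 = - l o0 * e * (w * (b1 + b2 - w) - b1 * b2).
  apply/eqP; rewrite -subr_eq0; apply/eqP.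
  have q : A / f0 * ((al o0 + al o1 + al o2) / f0 - A / f0)
     - (al o0 / f0 * (al o1 / f0) + al o0 / f0 * (al o2 / f0) + al o1 / f0 * (al o2 / f0)) = 0.
    rewrite -(hA_hB a b); transitivity ((A * B - (al o0 * al o1 + al o0 * al o2 + al o1 * al o2)) / f0 ^+ 2).
      by field; rewrite f00.
    by rewrite (hA_mul_hB sl ab) subrr mul0r.
  have alE i : al i / f0 = as_ i * l i / e by rewrite /as_; field; rewrite !l0 f00 e0.
  have wE : A / f0 = w + m / (e * l o0) * as_ o0 by rewrite /w; ring.
  rewrite -[RHS](mulr0 (l o0 * e)) -q sE !alE wE mE /b1 /b2 /t a2 /e l2.
  by field; rewrite -l2 !l0.
have b1Z : gen Z b1.
  apply: gen_div; last by apply: KZ; apply: genM.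
  by apply: genM; [apply: genN | apply: KZ].
have b2Z : gen Z b2.
  apply: gen_div; last exact: KZ.
  apply: genM; last exact: KZ.
  by apply: genD; [apply: gen_one | apply: gen_div => //; apply: KZ].
apply: genM; first by apply: KZ; apply: genM => //; apply: genN.
by apply: gen_sub; apply: genM => //; apply: gen_sub => //; apply: genD.
Qed.

Lemma rational_hexagon_projection : rational (fun c : k => iK c%:A) (inv to).
Proof.
apply: (rational_tower sl t_affine w_affine) => v _.
have KZ u : gen Kb u -> gen Z u by move=> hu; apply: gen_ext; apply: gen_ext.
have as1Z : gen Z (as_ o1).
  have -> : as_ o1 = (l o1 * as_ o0 - t) / l o0 by rewrite /t; field; rewrite l0.
  apply: gen_div; last exact: KZ; apply: gen_sub; first by apply: genM => //; apply: KZ.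
  exact/gen_ext/gen_extr.
have as2Z : gen Z (as_ o2).
  have -> : as_ o2 = 1 - as_ o0 - as_ o1 by rewrite -as_sum; ring.
  by apply: gen_sub => //; apply: gen_sub => //; apply: gen_one.
have alZ i : gen Z (as_ i) -> gen Z (al i / f0).
  move=> hi; have -> : al i / f0 = as_ i * l i / e by rewrite /as_; field; rewrite !l0 f00 e0.
  by apply: gen_div; [apply: genM => // |]; apply: KZ.
have AZ : gen Z (A / f0).
  have -> : A / f0 = w + m / (e * l o0) * as_ o0 by rewrite /w; ring.
  apply: genD; first exact: gen_extr.
  by apply: genM => //; apply: KZ; apply: gen_div => //; apply: genM.
apply: (hex_recover sl ab f00); [|exact: alZ|exact: alZ|exact: AZ|].
  by move=> u hu; apply: KZ; apply: gen_in.
have -> : B / f0 = al o0 / f0 + al o1 / f0 + al o2 / f0 - A / f0.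
  by rewrite -!mulrDl -(hA_hB a b); ring.
by apply: gen_sub => //; apply: genD; [apply: genD|]; apply: alZ.
Qed.

End Projection.

Lemma rational_hexagon_split s0 : s0 \in G -> pi s0 o0 = o1 -> pi s0 o1 = o2 ->
    (forall u, u \in H -> pi u = 1%g /\ ep u = false) ->
  rational (fun c : k => iK c%:A) (inv to).
Proof.
move=> hs0 p01 p12 H1.
have [th [thK thE [t01 t12 t20]]] := permuted_triple hs0 p01 p12 (fun u hu => proj1 (H1 u hu)).
have [de [deK de0 deE]] := sign_eigenvector (fun u hu => proj2 (H1 u hu)).
pose V := (th o0 - th o1) * (th o1 - th o2) * (th o2 - th o0).
have V0 : V != 0 by rewrite !mulf_neq0 ?subr_eq0.
(* The differences of the th i sum to 0. An odd permutation gives them an extra sign, which the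
   Vandermonde product V compensates; [de] brings in the sign of [ep]. *)
pose l (i : 'I_3) := de * V * [:: th o1 - th o2; th o2 - th o0; th o0 - th o1]`_i.
apply: (@rational_hexagon_projection l).
- elim/ord3P; rewrite /l /V /=; do ![apply: genM | apply: gen_sub]; exact: thK || exact: deK.
- by elim/ord3P; rewrite /l /= !mulf_neq0 ?subr_eq0.
- by rewrite /l /=; ring.
move=> s hs i; have [f fE] := to_rmorph toB toMm hs; have tE := thE s hs.
move: i; elim/ord3P; rewrite /l /V /= -fE !rmorphM !rmorphB !fE !tE deE //;
by pattern (pi s o0), (pi s o1), (pi s o2); apply: perm3P; rewrite /=; ring.
Qed.

End HexagonAction.

Lemma poly3E (R : comNzRingType) (u v w : R) :
  ('X - u%:P) * ('X - v%:P) * ('X - w%:P) = 'X^3 - (u + v + w)%:P * 'X^2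
    + (u * v + u * w + v * w)%:P * 'X - (u * v * w)%:P.
Proof. by rewrite !(polyCD, polyCM); ring. Qed.

(* Masuda's generators of the field of invariants of a cyclic permutation of
   t0, t1, t2 have denominator [form_D] and numerators of the form [form_N]. *)
Section MasudaForms.
Variable R : comPzRingType.

Definition form_D (t0 t1 t2 : R) := (t0 + t1 + t2) ^+ 2 - 3%:R * (t0 * t1 + t0 * t2 + t1 * t2).
Definition form_N (t0 t1 t2 : R) :=
  t0 * t1 ^+ 2 + t1 * t2 ^+ 2 + t2 * t0 ^+ 2 - 3%:R * (t0 * t1 * t2).

End MasudaForms.

Lemma rmorph_form_D (R S : comPzRingType) (f : {rmorphism R -> S}) t0 t1 t2 :
  f (form_D t0 t1 t2) = form_D (f t0) (f t1) (f t2).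
Proof. by rewrite /form_D rmorphB rmorphXn rmorphM rmorph_nat !rmorphD !rmorphM. Qed.

Lemma rmorph_form_N (R S : comPzRingType) (f : {rmorphism R -> S}) t0 t1 t2 :
  f (form_N t0 t1 t2) = form_N (f t0) (f t1) (f t2).
Proof.
by rewrite /form_N rmorphB 2!rmorphD !(rmorphXn, rmorphM) rmorph_nat.
Qed.

(** * Hexagonal actions in which H inverts or contains a 3-cycle *)

Section HexagonCases.
Variables (k : fieldType) (K : fieldExtType k) (L : fieldType) (iK : {rmorphism K -> L}).
Variables (x y : L) (gT : finGroupType) (G : {group gT}) (to : action G L).
Hypothesis sl : semilinear_action iK x y to.
Let toB := sl_add sl.
Let toMm := sl_mul sl.
Variable H : {group gT}.
Hypothesis sHG : H \subset G.
Hypothesis memH : forall s, s \in G -> (s \in H <-> forall c, gen (Kb iK) c -> to c s = c).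
Local Notation Kb := (Kb iK).
Variables a b : L.
Hypothesis ab : hexagonal_basis iK to a b.
Local Notation h := (hx a b).
Local Notation al := (hal a b).
Local Notation A := (hA a b).
Local Notation B := (hB a b).
Variables (pi : gT -> {perm 'I_3}) (ep : gT -> bool).
Hypothesis piP : forall s, s \in G -> hact to a b s (pi s) (ep s).

Let s1 := al o0 + al o1 + al o2.
Let e2 := al o0 * al o1 + al o0 * al o2 + al o1 * al o2.
Let e3 := al o0 * al o1 * al o2.

Let s10 : s1 != 0. Proof. by have := hal_sum_neq sl ab (gen0 _); rewrite addr0. Qed.

Let al_act s i : s \in G -> to (al i) s = al (pi s i).
Proof. by move=> hs; apply: (to_hal sl _ hs (piP hs)). Qed.

Let s1_act s : s \in G -> to s1 s = s1.
Proof.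
move=> hs; have [f fE] := to_rmorph toB toMm hs.
by rewrite /s1 -!sum3 -fE rmorph_sum -[RHS](sum_perm3 _ (pi s)); apply: eq_bigr => i _; rewrite fE al_act.
Qed.

(** The ratios [v i] are permuted by G and sum to 1, so the invariant z and t = [v o0] are affine
    coordinates on them. Over K(z, t) the element A / s1 is quadratic with conjugate B / s1, and u
    in H exchanges the two: the invariants descend to K(z, t). *)
Lemma rational_hexagon_inversion s0 u : s0 \in G -> pi s0 o0 = o1 -> pi s0 o1 = o2 ->
    (forall v, v \in H -> pi v = 1%g) -> u \in H -> ep u = true ->
  rational (fun c : k => iK c%:A) (inv to).
Proof.
move=> hs0 p01 p12 H1 hu eu; have uG := subsetP sHG u hu.
have [th [thK thE [t01 t12 t20]]] := permuted_triple sl sHG memH ab piP hs0 p01 p12 H1.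
pose v i := al i / s1; pose t := v o0; pose z := \sum_i th i * v i.
have v_act s i : s \in G -> to (v i) s = v (pi s i).
  by move=> hs; have [f fE] := to_rmorph toB toMm hs; rewrite /v -fE fmorph_div !fE s1_act // al_act.
have z_act s : s \in G -> to z s = z.
  move=> hs; have [f fE] := to_rmorph toB toMm hs.
  rewrite /z -fE rmorph_sum -[RHS](sum_perm3 _ (pi s)); apply: eq_bigr => i _.
  by rewrite (rmorphM f) !fE thE // v_act.
have vs : v o0 + v o1 + v o2 = 1 by rewrite /v -!mulrDl divff.
have zE : z = th o0 * v o0 + th o1 * v o1 + th o2 * v o2 by rewrite /z sum3.
have d12 : th o1 - th o2 != 0 by rewrite subr_eq0.
have v2E : v o2 = 1 - v o0 - v o1 by rewrite -vs; ring.
have v1E : v o1 = (z - th o2 - (th o0 - th o2) * t) / (th o1 - th o2).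
  by rewrite zE /t v2E; field.
have zaff i : exists c d, [/\ gen (ext Kb z) c, gen (ext Kb z) d & v i = c * t + d].
  have K1 := gen_one (ext Kb z); have K0 := gen0 (ext Kb z).
  have zg : gen (ext Kb z) z by apply: gen_extr.
  have tg j : gen (ext Kb z) (th j) by apply: gen_ext.
  have dg j j' : gen (ext Kb z) (th j - th j') by apply: gen_sub.
  have [c1 [d1 [hc1 hd1 e1]]] : exists c d, [/\ gen (ext Kb z) c, gen (ext Kb z) d & v o1 = c * t + d].
    exists (- (th o0 - th o2) / (th o1 - th o2)), ((z - th o2) / (th o1 - th o2)); split.
    - by apply: gen_div => //; apply: genN.
    - by apply: gen_div => //; apply: gen_sub.
    - by rewrite v1E; ring.
  move: i; elim/ord3P; [by exists 1, 0; split=> //; rewrite /t; ring|by exists c1, d1|].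
  exists (- 1 - c1), (1 - d1); split.
  - by apply: gen_sub => //; apply: genN.
  - by apply: gen_sub.
  - by rewrite v2E e1 /t; ring.
have zK : affine_over to Kb z.
  by move=> s hs; exists 1, 0; split; [apply: gen_one|apply: gen0|rewrite z_act //; ring].
have tK : affine_over to (ext Kb z) t by move=> s hs; rewrite /t v_act //; apply: zaff.
apply: (rational_tower sl zK tK) => w wI.
set X := ext (ext Kb z) t.
have vX i : gen X (v i).
  have [c [d [hc hd ->]]] := zaff i.
  by apply: genD (gen_ext _ hd); apply: genM (gen_ext _ hc) (gen_extr _ _).
pose E2 := v o0 * v o1 + v o0 * v o2 + v o1 * v o2.
have E2X : gen X E2 by rewrite /E2; apply: genD; [apply: genD|]; apply: genM.
pose P : {poly L} := ('X - (A / s1)%:P) * ('X - (B / s1)%:P).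
have PE : P = 'X^2 - 'X + E2%:P.
  rewrite /P mulrBl !mulrBr -polyCM.
  have -> : A / s1 * (B / s1) = E2.
    transitivity (A * B / s1 ^+ 2); first by field.
    by rewrite (hA_mul_hB sl ab) /E2 /v; field.
  have -> : (B / s1)%:P = 1 - (A / s1)%:P.
    by rewrite -polyC1 -polyCB; congr (_%:P); rewrite -(divff s10) /s1 -(hA_hB a b); ring.
  by ring.
have sP : size P = 3 by rewrite /P size_mul ?polyXsubC_eq0 // !size_XsubC.
have [tA tB] := to_hAB sl uG (piP uG); rewrite eu in tA tB.
have uv i : to (v i) u = v i by rewrite v_act // H1 // perm1.
apply: (fixed_in_base toB toMm (X := X) (p := P) (t := A / s1) (ss := [:: 1%g; u])) => //=.
- by rewrite PE rpredD ?rpredB ?polyOverXn ?polyOverX ?polyOverC //; apply/genpP.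
- by rewrite -size_poly_gt0 sP.
- by rewrite /P rootM root_XsubC eqxx.
- by rewrite sP.
- by move=> s; rewrite !inE => /orP [] /eqP ->.
- move=> s r; rewrite !inE => /orP [] /eqP ->; first by rewrite to_id.
  by case=> [[[c ->]|->]|->]; [apply: (proj1 (memH uG) hu); apply: gen_in; exists c| exact: z_act |exact: uv].
- rewrite to_id inE andbT; have [f fE] := to_rmorph toB toMm uG.
  rewrite -fE fmorph_div !fE tA s1_act //; apply: contra (hA_neq_hB sl ab) => /eqP eAB.
  by apply/eqP/(mulIf (invr_neq0 s10)).
- have XY r : gen X r -> gen (ext X (A / s1)) r by apply: gen_ext.
  have AX : gen (ext X (A / s1)) (A / s1) by apply: gen_extr.
  apply: (hex_recover sl ab s10) => [r hr|||//|].
  + by apply/XY/gen_ext/gen_ext/gen_in.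
  + exact: XY (vX _).
  + exact: XY (vX _).
  + have -> : B / s1 = 1 - A / s1 by rewrite -(divff s10) {2}/s1 -(hA_hB a b); ring.
    by apply: gen_sub => //; apply: gen_one.
- by move=> s; rewrite !inE => /orP [] /eqP -> //; apply: wI.
Qed.

(** With U = Nu / D and V = Nv / D, the elementary symmetric functions satisfy e2 = s1 (U + V) - 3
    (U^2 - U V + V^2) and e3 = s1 U V - (U^3 + V^3); so s1, U, V generate the C_3-invariants. *)
Let D := s1 ^+ 2 - 3%:R * e2.
Let Nu := al o0 * al o1 ^+ 2 + al o1 * al o2 ^+ 2 + al o2 * al o0 ^+ 2 - 3%:R * e3.
Let Nv := al o0 ^+ 2 * al o1 + al o1 ^+ 2 * al o2 + al o2 ^+ 2 * al o0 - 3%:R * e3.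
Let De := Nv - Nu.

Let D0 : D != 0.
Proof.
apply/eqP => e; have [a0 b0] := hex_neq0 sl ab.
(* The coefficients of a^2 b^2 D in a, b. The constant one is 1, so D is nonzero in every
   characteristic. *)
pose q : seq (int * (nat * nat)) := [::
    (1, (0, 0)%N); (-1, (0, 1)%N); (1, (0, 2)%N); (-1, (1, 0)%N); (-1, (1, 1)%N); (-1, (1,
    2)%N); (-1, (1, 3)%N); (1, (2, 0)%N); (-1, (2, 1)%N); (6, (2, 2)%N); (-1, (2, 3)%N); (1, (2,
    4)%N); (-1, (3, 1)%N); (-1, (3, 2)%N); (-1, (3, 3)%N); (-1, (3, 4)%N); (1, (4, 2)%N); (-1,
    (4, 3)%N); (1, (4, 4)%N)].
pose r : seq (L * (nat * nat)) := [seq (p.1%:~R, p.2) | p <- q].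
have rX p : p \in r -> gen Kb p.1.
  by case/mapP => p' _ ->; apply/genpP/rpred_int.
have r0 : \sum_(p <- r) p.1 * a ^+ p.2.1 * b ^+ p.2.2 = 0.
  transitivity (a ^+ 2 * b ^+ 2 * D); last by rewrite e mulr0.
  rewrite /r big_map /q !big_cons big_nil /D /s1 /e2 /hal /hx /= ?invrK.
  by field; rewrite a0 b0.
have /eqP := hex_poly_eq0 sl ab rX isT r0 (mem_head _ _).
by rewrite /= oner_eq0.
Qed.

Let DeE : De = - ((al o0 - al o1) * (al o1 - al o2) * (al o2 - al o0)).
Proof. by rewrite /De /Nu /Nv; ring. Qed.

Let De0 : De != 0.
Proof. by rewrite DeE oppr_eq0 !mulf_neq0 // subr_eq0 (hal_neq sl ab). Qed.

(** Both sides are (A - B)^2: each al_i is (h_i - 1)^2 / h_i with the product of the h_i equal to 1,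
    and A + B, A B are s1, e2. *)
Let ABe3 : e3 = s1 ^+ 2 - 4%:R * e2.
Proof.
transitivity ((A - B) ^+ 2); last first.
  by rewrite /s1 -(hA_hB a b) /e2 -(hA_mul_hB sl ab); ring.
have [a0 b0] := hex_neq0 sl ab.
by rewrite (hA_sub_hB sl ab) /e3 /hal /hx /= ?invrK; field; rewrite a0 b0.
Qed.

Let E0 : s1 * D - Nu - Nv != 0.
Proof.
have -> : s1 * D - Nu - Nv = e3 * (s1 + 9%:R).
  transitivity (s1 * (s1 ^+ 2 - 4%:R * e2) + 9%:R * e3); last by rewrite -ABe3; ring.
  by rewrite /D /Nu /Nv /s1 /e2 /e3; ring.
by rewrite mulf_neq0 ?(hal_sum_neq sl ab (gen_nat _ _)) // /e3 !mulf_neq0 // (hal_neq0 sl ab).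
Qed.

(* [X = (A - Nu / D) / (Nv / D - Nu / D)], likewise for [Y]; the group acts by
   affine maps on these coordinates. *)
Let X := (A * D - Nu) / De.
Let Y := (B * D - Nu) / De.
Let u := Nu / De.

(** Scaled by D / De, the generators U, V become u, u + 1, and A, B become X + u, Y + u. In A B =
    e2, with e2 written in s1 = A + B, U and V, the terms in u^2 cancel: u is rational in X, Y. *)
Let XYu : (X + Y - 1) * u = X * Y - X - Y + 3%:R.
Proof.
have -> : X * Y = (e2 * D ^+ 2 - s1 * D * Nu + Nu ^+ 2) / De ^+ 2.
  transitivity ((A * B * D ^+ 2 - (A + B) * D * Nu + Nu ^+ 2) / De ^+ 2).
    by rewrite /X /Y; field.
  by rewrite (hA_hB a b) (hA_mul_hB sl ab).
have -> : X + Y - 1 = (s1 * D - 2%:R * Nu - De) / De.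
  by rewrite /s1 -(hA_hB a b) /X /Y; field.
have -> : forall w, w - X - Y + 3%:R = w - (s1 * D - 2%:R * Nu) / De + 3%:R.
  by move=> w; rewrite /s1 -(hA_hB a b) /X /Y; field.
rewrite /u; apply: (mulIf (expf_neq0 2 De0)).
transitivity ((s1 * D - 2%:R * Nu - De) * Nu); first by field.
transitivity (e2 * D ^+ 2 - s1 * D * Nu + Nu ^+ 2 - (s1 * D - 2%:R * Nu) * De + 3%:R * De ^+ 2);
  last by field.
by rewrite /De /D /Nu /Nv /s1 /e2 /e3; ring.
Qed.

Let XY1 : X + Y - 1 != 0.
Proof.
have -> : X + Y - 1 = (s1 * D - Nu - Nv) / De.
  by rewrite /s1 -(hA_hB a b) /X /Y /De; field.
by rewrite mulf_neq0 ?invr_neq0.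
Qed.

Let D_act s : s \in G -> to D s = D.
Proof.
move=> hs; have [f fE] := to_rmorph toB toMm hs.
rewrite -fE (rmorph_form_D f (al o0)) !fE !al_act //.
by pattern (pi s o0), (pi s o1), (pi s o2); apply: perm3P; rewrite /form_D /D /s1 /e2; ring.
Qed.

Let N_act s : s \in G -> (to Nu s = Nu /\ to Nv s = Nv) \/ (to Nu s = Nv /\ to Nv s = Nu).
Proof.
move=> hs; have [f fE] := to_rmorph toB toMm hs.
rewrite -!fE (rmorph_form_N f (al o0)).
have -> : Nv = form_N (al o1) (al o0) (al o2) by rewrite /form_N /Nv /e3; ring.
rewrite (rmorph_form_N f (al o1)) !fE !al_act //.
by pattern (pi s o0), (pi s o1), (pi s o2); apply: perm3P;
  rewrite /Nu /e3 /form_N; by [left; split; ring | right; split; ring].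
Qed.

Let XY_act s : s \in G ->
  [\/ to X s = X /\ to Y s = Y, to X s = Y /\ to Y s = X,
      to X s = 1 - X /\ to Y s = 1 - Y | to X s = 1 - Y /\ to Y s = 1 - X].
Proof.
move=> hs; have [f fE] := to_rmorph toB toMm hs.
have [tA tB] := to_hAB sl hs (piP hs).
have tX : to X s = (to A s * D - to Nu s) / (to Nv s - to Nu s).
  by rewrite -fE /X (fmorph_div f) (rmorphB f (A * D)) (rmorphM f A) (rmorphB f Nv) !fE D_act.
have tY : to Y s = (to B s * D - to Nu s) / (to Nv s - to Nu s).
  by rewrite -fE /Y (fmorph_div f) (rmorphB f (B * D)) (rmorphM f B) (rmorphB f Nv) !fE D_act.
have De0' : Nu - Nv != 0 by rewrite -opprB oppr_eq0.
rewrite tX tY tA tB; case: (N_act hs) => -[-> ->]; case: (ep s).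
- by constructor 2.
- by constructor 1.
- by constructor 4; rewrite /X /Y /De; split; field; rewrite De0' De0.
- by constructor 3; rewrite /X /Y /De; split; field; rewrite De0' De0.
Qed.

(** K(X, Y) is the fixed field of r: [g o0] is a root of a cubic over it with conjugates [g o1],
    [g o2], and generates L. On X - Y and X the whole group acts affinely. *)
Lemma rational_hexagon_rotation r : r \in H -> pi r o0 = o1 -> pi r o1 = o2 -> ep r = false ->
  rational (fun c : k => iK c%:A) (inv to).
Proof.
move=> hr p01 p12 er; have rG := subsetP sHG r hr; pose z := X - Y.
have p20 : pi r o2 = o0.
  by move: p01 p12; apply: (perm3P (pi r) (P := fun u v w => u = o1 -> v = o2 -> w = o0)).
have K1 := gen_one (ext Kb z); have KN1 := genN K1; have K0 := gen0 (ext Kb z).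
have zg : gen (ext Kb z) z by apply: gen_extr.
have zK : affine_over to Kb z.
  move=> s hs; have [f fE] := to_rmorph toB toMm hs.
  have k1 := gen_one Kb; have kN1 := genN k1; have k0 := gen0 Kb.
  rewrite /z -fE rmorphB !fE; case: (XY_act hs) => -[-> ->];
    [exists 1, 0|exists (-1), 0|exists (-1), 0|exists 1, 0]; by split=> //; ring.
have XK : affine_over to (ext Kb z) X.
  move=> s hs; case: (XY_act hs) => -[-> _].
  - by exists 1, 0; split=> //; ring.
  - by exists 1, (- z); split=> //; [apply: genN | rewrite /z; ring].
  - by exists (-1), 1; split=> //; ring.
  - by exists (-1), (1 + z); split=> //; [apply: genD | rewrite /z; ring].
apply: (rational_tower sl zK XK) => w wI.
set Z := ext (ext Kb z) X.
have XZ : gen Z X by apply: gen_extr.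
have YZ : gen Z Y.
  have -> : Y = X - z by rewrite /z; ring.
  by apply: gen_sub => //; apply: gen_ext.
have Z1 := gen_one Z.
have uZ : gen Z u.
  have -> : u = (X * Y - X - Y + 3%:R) / (X + Y - 1) by rewrite -XYu; field.
  apply: gen_div; last by apply: gen_sub => //; apply: genD.
  by apply: genD (gen_nat _ _); do 2!apply: gen_sub => //; apply: genM.
pose g i := al i * D / De.
pose S := X + Y + u + u.
have SZ : gen Z S by rewrite /S; do 3!apply: genD => //.
have SE : S = g o0 + g o1 + g o2.
  transitivity (s1 * D / De); last by rewrite /g /s1; field.
  by rewrite /S /s1 -(hA_hB a b) /X /Y /u; field.
pose E2 := S * (u + u + 1) - 3%:R * (u ^+ 2 + u + 1).
pose E3 := S * u * (u + 1) - (u ^+ 3 + (u + 1) ^+ 3).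
have uX n : gen Z (u ^+ n) by apply: genX.
have u1 : gen Z (u + 1) by apply: genD.
have E2Z : gen Z E2.
  apply: gen_sub; first by apply: genM => //; apply: genD => //; apply: genD.
  by apply: genM (gen_nat _ _) _; apply: genD => //; apply: genD.
have E3Z : gen Z E3.
  apply: gen_sub; first by apply: genM => //; apply: genM.
  by apply: genD => //; apply: genX.
have uE : u + 1 = Nv / De by rewrite /u /De; field.
have E2E : E2 = g o0 * g o1 + g o0 * g o2 + g o1 * g o2.
  transitivity (e2 * D ^+ 2 / De ^+ 2); last by rewrite /g /e2; field.
  have -> : E2 = S * (u + (u + 1)) - 3%:R * (u ^+ 2 - u * (u + 1) + (u + 1) ^+ 2) by rewrite /E2; ring.
  transitivity ((s1 * D * (Nu + Nv) - 3%:R * (Nu ^+ 2 - Nu * Nv + Nv ^+ 2)) / De ^+ 2).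
    by rewrite SE uE /u /g /s1; field.
  by congr (_ / _); rewrite /D /Nu /Nv /s1 /e2 /e3; ring.
have E3E : E3 = g o0 * g o1 * g o2.
  transitivity (e3 * D ^+ 3 / De ^+ 3); last by rewrite /g /e3; field.
  transitivity ((s1 * D * Nu * Nv - (Nu ^+ 3 + Nv ^+ 3)) / De ^+ 3).
    by rewrite /E3 SE uE /u /g /s1; field.
  by congr (_ / _); rewrite /D /Nu /Nv /s1 /e2 /e3; ring.
pose P : {poly L} := ('X - (g o0)%:P) * ('X - (g o1)%:P) * ('X - (g o2)%:P).
have PE : P = 'X^3 - S%:P * 'X^2 + E2%:P * 'X - E3%:P.
  by rewrite SE E2E E3E /P poly3E.
have sP : size P = 4.
  by rewrite /P !size_mul ?mulf_neq0 ?polyXsubC_eq0 // !size_XsubC.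
have g_inj i j : i != j -> g i != g j.
  move=> ij; rewrite /g; apply: contra (hal_neq sl ab ij) => /eqP e; apply/eqP.
  by apply: (mulIf D0); apply: (mulIf (invr_neq0 De0)).
have g_act s i : s \in G -> to D s = D -> to De s = De -> to (g i) s = g (pi s i).
  move=> hs hD hDe; have [f fE] := to_rmorph toB toMm hs.
  by rewrite /g -fE (fmorph_div f) (rmorphM f) !fE al_act // hD hDe.
have [Nur Nvr] : to Nu r = Nu /\ to Nv r = Nv.
  have [f fE] := to_rmorph toB toMm rG.
  split; rewrite -fE; first by rewrite (rmorph_form_N f (al o0)) !fE !al_act // p01 p12 p20 /form_N /Nu /e3; ring.
  have -> : Nv = form_N (al o1) (al o0) (al o2) by rewrite /form_N /Nv /e3; ring.
  by rewrite (rmorph_form_N f (al o1)) !fE !al_act // p01 p12 p20 /form_N; ring.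
have Der : to De r = De.
  by have [f fE] := to_rmorph toB toMm rG; rewrite -fE /De (rmorphB f Nv) !fE Nur Nvr.
have [tA tB] := to_hAB sl rG (piP rG); rewrite er in tA tB.
have Xr : to X r = X.
  have [f fE] := to_rmorph toB toMm rG.
  by rewrite -fE /X (fmorph_div f) (rmorphB f (A * D)) (rmorphM f A) !fE D_act // tA Nur Der.
have Yr : to Y r = Y.
  have [f fE] := to_rmorph toB toMm rG.
  by rewrite -fE /Y (fmorph_div f) (rmorphB f (B * D)) (rmorphM f B) !fE D_act // tB Nur Der.
have gr i : to (g i) r = g (pi r i) by apply: g_act => //; apply: D_act.
have Zr v : Z v -> to v r = v.
  case=> [[[c ->]|->]|->] //; first by apply: (proj1 (memH rG) hr); apply: gen_in; exists c.
  by have [f fE] := to_rmorph toB toMm rG; rewrite /z -fE rmorphB !fE Xr Yr.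
apply: (fixed_in_base toB toMm (X := Z) (p := P) (t := g o0) (ss := [:: 1%g; r; (r * r)%g])) => //=.
- have [SZ' E2Z' E3Z'] := And3 (introT (genpP _ _) SZ) (introT (genpP _ _) E2Z) (introT (genpP _ _) E3Z).
  rewrite PE; apply: rpredB; last by rewrite polyOverC.
  apply: rpredD; last by apply: rpredM; rewrite ?polyOverC ?polyOverX.
  by apply: rpredB; [|apply: rpredM]; rewrite ?polyOverC ?polyOverXn.
- by rewrite -size_poly_gt0 sP.
- by rewrite /P !rootM root_XsubC eqxx.
- by rewrite sP.
- by move=> s; rewrite !inE => /or3P [] /eqP -> //; rewrite groupM.
- move=> s v; rewrite !inE => /or3P [] /eqP -> hv; rewrite ?to_id //; first exact: Zr.
  by rewrite to_comp // !Zr.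
- rewrite to_id to_comp // !gr p01 p12 !inE negb_or andbT.
  by rewrite !g_inj.
- set W := ext Z (g o0).
  have ZW v : gen Z v -> gen W v by apply: gen_ext.
  have g0W : gen W (g o0) by apply: gen_extr.
  pose D' := S ^+ 2 - 3%:R * E2; pose R1 := u * D' + 3%:R * E3.
  pose s' := S - g o0; pose p' := E2 - g o0 * s'.
  (* The relation g0 g1^2 + g1 g2^2 + g2 g0^2 = R1 becomes linear in g1 when g1 + g2 = s' and g1 g2
     = p' are inserted. *)
  have g1E : g o1 = (R1 + g o0 * p' - (p' + g o0 ^+ 2) * s') / (g o0 * s' - p' - g o0 ^+ 2).
    have nz : g o0 * s' - p' - g o0 ^+ 2 != 0.
      have -> : g o0 * s' - p' - g o0 ^+ 2 = - ((g o0 - g o1) * (g o0 - g o2)).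
        by rewrite /p' /s' E2E SE; ring.
      by rewrite oppr_eq0 mulf_neq0 // subr_eq0 g_inj.
    have R1E : R1 = g o0 * g o1 ^+ 2 + g o1 * g o2 ^+ 2 + g o2 * g o0 ^+ 2.
      transitivity ((Nu + 3%:R * e3) * D ^+ 3 / De ^+ 3); last by rewrite /g /Nu; field.
      rewrite /R1 /D' SE E2E E3E /u /g.
      transitivity ((Nu * (s1 ^+ 2 - 3%:R * e2) + 3%:R * e3 * D) * D ^+ 2 / De ^+ 3).
        by rewrite /s1 /e2 /e3; field.
      by rewrite -/D; field.
    apply: (mulIf nz); rewrite mulfVK // R1E /p' /s' E2E SE; ring.
  have s'W : gen W s' by apply: gen_sub => //; apply: ZW.
  have p'W : gen W p' by apply: gen_sub; [apply: ZW | apply: genM].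
  have R1W : gen W R1.
    apply: ZW; apply: genD; apply: genM => //; try exact: gen_nat.
    by apply: gen_sub; [apply: genX | apply: genM => //; apply: gen_nat].
  have g02W : gen W (g o0 ^+ 2) by apply: genX.
  have g1W : gen W (g o1).
    rewrite g1E; apply: gen_div; last by do 2!apply: gen_sub => //; apply: genM.
    by apply: gen_sub; [apply: genD => //|]; apply: genM => //; apply: genD.
  have d0 : De / D != 0 by rewrite mulf_neq0 ?invr_neq0.
  have dE v : v / (De / D) = v * D / De by rewrite invf_div mulrA.
  apply: (hex_recover sl ab d0); rewrite ?dE //.
  + by move=> v hv; apply/ZW/gen_ext/gen_ext/gen_in.
  + have -> : A * D / De = X + u by rewrite /X /u; field.
    by apply: ZW; apply: genD.
  + have -> : B * D / De = Y + u by rewrite /Y /u; field.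
    by apply: ZW; apply: genD.
- by move=> s; rewrite !inE => /or3P [] /eqP -> //; apply: wI => //; rewrite groupM.
Qed.

End HexagonCases.

(** * Reduced bases of plane lattices *)

Import Order.TTheory Num.Theory.

Section Reduction.
Local Open Scope int_scope.
Implicit Types a b c p q r t : int.

Lemma sqr_le1 p : p * p <= 1 -> [\/ p = -1, p = 0 | p = 1].
Proof.
move=> h; have [h1|h1] := lerP p (-2); first by nia.
have [h2|h2] := lerP 2 p; first by nia.
have : p = -1 \/ p = 0 \/ p = 1 by lia.
by case=> [|[]]; [constructor 1|constructor 2|constructor 3].
Qed.

(** 4 a times the form is (2 a p + b q)^2 + (4 a c - b^2) q^2, and 4 a c - b^2 >= 3 a c. So q^2 >= 4
    would give 12 a c <= 4 a c. *)
Lemma reduced_coef a b c p q : 0 < a -> 0 <= b -> b <= a -> a <= c ->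
  a * (p * p) + b * (p * q) + c * (q * q) <= c -> q * q <= 1.
Proof.
move=> a0 b0 ba ac h; rewrite leNgt; apply/negP => hq.
have q2 : 4 <= q * q.
  have [h1|h1] := lerP q (-2); first by nia.
  have [h2|h2] := lerP 2 q; first by nia.
  have : q = -1 \/ q = 0 \/ q = 1 by lia.
  by case=> [|[]] e; rewrite e in hq.
have h1 : 4 * a * (a * (p * p) + b * (p * q) + c * (q * q)) =
  (2 * a * p + b * q) * (2 * a * p + b * q) + (4 * a * c - b * b) * (q * q) by ring.
have bb : b * b <= b * a by apply: ler_wpM2l.
have ba' : b * a <= a * a by apply: ler_wpM2r => //; apply: ltW.
have aa : a * a <= a * c by apply: ler_wpM2l => //; apply: ltW.
have ac0 : 0 < a * a by apply: mulr_gt0.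
have h2 : 3 * (a * c) <= 4 * a * c - b * b by lia.
have h3 : 3 * (a * c) * 4 <= (4 * a * c - b * b) * (q * q).
  by apply: ler_pM => //; lia.
have h4 : 0 <= (2 * a * p + b * q) * (2 * a * p + b * q) by rewrite -expr2 sqr_ge0.
have h5 : 4 * a * (a * (p * p) + b * (p * q) + c * (q * q)) <= 4 * a * c.
  by apply: ler_wpM2l => //; lia.
lia.
Qed.

(* The quadruples (p, q, r, t) encode the isometries e |-> p e + q f,
   f |-> r e + t f of a lattice with reduced basis e, f: rectangular (or square),
   rhombic and hexagonal lattices. *)
Definition rect_mats : seq (int * int * int * int) :=
  [seq (u.1, 0, 0, u.2) | u <- [:: (1, 1); (1, -1); (-1, 1); (-1, -1)]] ++
  [seq (0, u.1, u.2, 0) | u <- [:: (1, 1); (1, -1); (-1, 1); (-1, -1)]].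
Definition rhombic_mats : seq (int * int * int * int) :=
  [:: (1, 0, 0, 1); (-1, 0, 0, -1); (1, 0, 1, -1); (-1, 0, -1, 1)].
Definition hex_mats : seq (int * int * int * int) :=
  [:: (-1, 0, -1, 1); (-1, 0, 0, -1); (-1, 1, -1, 0); (-1, 1, 0, 1); (0, -1, -1, 0); (0, -1, 1, -1); (0, 1, -1, 1); (0, 1, 1, 0); (1, -1, 0, -1); (1, -1, 1, 0); (1, 0, 0, 1); (1, 0, 1, -1)].

(** The length conditions force coordinates -1, 0, 1. For each of the 81 matrices left, the
    equations are linear in a, b, c. *)
Lemma isometry_cases a b c p q r t : 0 < a -> 0 <= b -> b <= a -> a <= c ->
    a * (p * p) + b * (p * q) + c * (q * q) = a ->
    a * (r * r) + b * (r * t) + c * (t * t) = c ->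
    2 * a * (p * r) + b * (p * t + q * r) + 2 * c * (q * t) = b ->
    p * t - q * r = 1 \/ p * t - q * r = -1 ->
  (p, q, r, t) \in if b < a then rect_mats else if a < c then rhombic_mats else hex_mats.
Proof.
move=> a0 b0 ba ac n1 n2 n3 det.
have q1 : q * q <= 1 by apply: (reduced_coef a0 b0 ba ac (p := p)); rewrite n1.
have t1 : t * t <= 1 by apply: (reduced_coef a0 b0 ba ac (p := r)); rewrite n2.
have bound u v : v = 1 \/ v = -1 -> a * (u * u) + b * (u * v) <= 0 -> u * u <= 1.
  move=> hv h; rewrite leNgt; apply/negP => hu.
  have u2 : 2 <= u \/ u <= -2.
    have [h1|h1] := lerP u (-2); first by right.
    have [h2|h2] := lerP 2 u; first by left.
    have : u = -1 \/ u = 0 \/ u = 1 by lia.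
    by case=> [|[]] e; rewrite e in hu.
  by case: hv h => ->; case: u2; nia.
have p1 : p * p <= 1.
  case: (sqr_le1 q1) => e; rewrite e in n1.
  - by apply: (bound p (-1)); [right | lia].
  - rewrite !mulr0 !addr0 in n1; have h : a * (p * p) = a * 1 by rewrite n1 mulr1.
    by rewrite (mulfI _ h) // gt_eqF.
  - by apply: (bound p 1); [left | lia].
have r1 : r * r <= 1.
  case: (sqr_le1 t1) => e; rewrite e in n2 det.
  - by apply: (bound r (-1)); [right | lia].
  - by case: (sqr_le1 q1) => eq; rewrite eq in det; nia.
  - by apply: (bound r 1); [left | lia].
have [p0|p0|p0] := sqr_le1 p1; have [q0|q0|q0] := sqr_le1 q1;
have [r0|r0|r0] := sqr_le1 r1; have [t0|t0|t0] := sqr_le1 t1;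
  rewrite {}p0 {}q0 {}r0 {}t0 in n1 n2 n3 det * => {q1 t1 p1 r1 bound};
  try (exfalso; lia);
  case: ifP => h1; try (exfalso; lia); try (case: ifP => h2; try (exfalso; lia)); by [].
Qed.

Definition mv (M : 'M[int]_2) (v : int * int) : int * int :=
  (M 0%R 0%R * v.1 + M 0%R 1%R * v.2, M 1%R 0%R * v.1 + M 1%R 1%R * v.2).
Definition comb (p q : int) (e f : int * int) : int * int :=
  (p * e.1 + q * f.1, p * e.2 + q * f.2).
Definition vdet (e f : int * int) := e.1 * f.2 - e.2 * f.1.

Section FiniteMatrixGroup.
Variables (gT : finGroupType) (G : {group gT}) (M : gT -> 'M[int]_2).
Hypothesis MM : forall s r : gT, s \in G -> r \in G -> forall v, mv (M r) (mv (M s) v) = mv (M (s * r)%g) v.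
Hypothesis M1 : forall v, mv (M 1%g) v = v.

Let dot (v w : int * int) := v.1 * w.1 + v.2 * w.2.
(** The standard form summed over G. As the mixed term of the quadratic form occurs twice, the
    coefficient b of the reduction lemmas is [P e f *+ 2]. *)
Let P v w := \sum_(s in G) dot (mv (M s) v) (mv (M s) w).

Let P_act s v w : s \in G -> P (mv (M s) v) (mv (M s) w) = P v w.
Proof.
move=> hs; rewrite /P [RHS](reindex_inj (mulgI s)) /=; apply: eq_big => r.
  by rewrite groupMl.
by move=> hr; rewrite !MM.
Qed.

Let P_comb p q r t e f : P (comb p q e f) (comb r t e f) =
  P e e * (p * r) + P e f * (p * t + q * r) + P f f * (q * t).
Proof.
rewrite /P !mulr_suml -!big_split /=; apply: eq_bigr => s _.
by rewrite /dot /mv /comb /=; ring.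
Qed.

Let P_gt0 e : e != (0, 0) -> 0 < P e e.
Proof.
move=> e0; rewrite /P (bigD1 1%g) //= M1 ltr_wpDr //.
  by apply: sumr_ge0 => s _; rewrite /dot -!expr2 addr_ge0 ?sqr_ge0.
case: e e0 => u v; rewrite xpair_eqE negb_and /dot /= => h.
by rewrite -!expr2; case/orP: h => h; [rewrite ltr_wpDr | rewrite ltr_wpDl];
  rewrite ?sqr_ge0 // exprn_even_gt0.
Qed.

Let unimod e f := vdet e f = 1 \/ vdet e f = -1.

Let unimod_neq0 e f : unimod e f -> e != (0, 0) /\ f != (0, 0).
Proof.
by rewrite /unimod /vdet => h; split; apply: contraPneq h => ->; rewrite /= ?mul0r ?mulr0 subrr; case.
Qed.

Let reduced_basis : exists e f, [/\ unimod e f, 0 <= P e f *+ 2, P e f *+ 2 <= P e e & P e e <= P f f].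
Proof.
(* A unimodular basis with least P(e, e) + P(f, f). Comparison with the bases in which one vector is
   changed by plus or minus the other bounds |2 P(e, f)| by P(e, e) and P(f, f). *)
have ex : exists n, `[< exists e f, unimod e f /\ P e e + P f f = Posz n >].
  pose i : int * int := (1, 0); pose j : int * int := (0, 1).
  exists (absz (P i i + P j j)); apply/asboolP; exists i, j; split; first by left.
  by rewrite gez0_abs // addr_ge0 // ltW // P_gt0.
case: (ex_minnP ex) => n /asboolP [e [f [ef en]]] nmin.
have lb e' f' : unimod e' f' -> P e e + P f f <= P e' e' + P f' f'.
  move=> ef'; have [e0 f0] := unimod_neq0 ef'.
  have h : 0 <= P e' e' + P f' f' by rewrite addr_ge0 // ltW // P_gt0.
  rewrite en -(gez0_abs h) lez_nat; apply: nmin; apply/asboolP.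
  by exists e', f'; rewrite gez0_abs.
have cE u v : comb 1 0 u v = u by rewrite /comb !mul1r !mul0r !addr0; case: (u).
have cF u v : comb 0 1 u v = v by rewrite /comb !mul1r !mul0r !add0r; case: (v).
have um p q r t u v : p * t - q * r = 1 \/ p * t - q * r = -1 -> unimod u v ->
    unimod (comb p q u v) (comb r t u v).
  rewrite /unimod; have -> : vdet (comb p q u v) (comb r t u v) = (p * t - q * r) * vdet u v.
    by rewrite /vdet /comb /=; ring.
  by move=> [] -> [] ->; [left|right|right|left].
have b1 : P e f *+ 2 <= P e e.
  by have := lb _ _ (um 1 0 (-1) 1 e f (or_introl erefl) ef); rewrite !P_comb; lia.
have b2 : - (P e f *+ 2) <= P e e.
  by have := lb _ _ (um 1 0 1 1 e f (or_introl erefl) ef); rewrite !P_comb; lia.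
have b3 : P e f *+ 2 <= P f f.
  by have := lb _ _ (um 1 (-1) 0 1 e f (or_introl erefl) ef); rewrite !P_comb; lia.
have b4 : - (P e f *+ 2) <= P f f.
  by have := lb _ _ (um 1 1 0 1 e f (or_introl erefl) ef); rewrite !P_comb; lia.
have [ef0|ef0] := lerP 0 (P e f); have [ac|ac] := lerP (P e e) (P f f).
- by exists e, f; split=> //; lia.
- exists (comb 0 1 e f), (comb 1 0 e f); split; rewrite ?P_comb; try lia.
  by apply: um => //; right.
- exists (comb 1 0 e f), (comb 0 (-1) e f); split; rewrite ?P_comb; try lia.
  by apply: um => //; right.
- exists (comb 0 1 e f), (comb (-1) 0 e f); split; rewrite ?P_comb; try lia.
  by apply: um => //; left.
Qed.

(* [e, f] is a basis reduced for an invariant positive definite form. *)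
Lemma lattice_cases : exists e f S, [/\ unimod e f,
  S = rect_mats \/ S = rhombic_mats \/ S = hex_mats
  & forall s, s \in G -> exists p q r t, [/\ mv (M s) e = comb p q e f,
      mv (M s) f = comb r t e f & (p, q, r, t) \in S]].
Proof.
have [e [f [ef b0 ba ac]]] := reduced_basis.
have [e0 f0] := unimod_neq0 ef; have a0 := P_gt0 e0.
exists e, f, (if P e f *+ 2 < P e e then rect_mats else if P e e < P f f then rhombic_mats else hex_mats).
split=> //; first by case: ifP => _; [left | case: ifP => _; right; [left|right]].
move=> s hs.
have d2 : vdet e f * vdet e f = 1 by case: ef => ->.
have coord v : v = comb (vdet e f * vdet v f) (vdet e f * vdet e v) e f.
  rewrite [LHS]surjective_pairing /comb; congr (_, _).
    by transitivity ((vdet e f * vdet e f) * v.1); [rewrite d2 mul1r | rewrite /vdet; ring].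
  by transitivity ((vdet e f * vdet e f) * v.2); [rewrite d2 mul1r | rewrite /vdet; ring].
set p := vdet e f * vdet (mv (M s) e) f; set q := vdet e f * vdet e (mv (M s) e).
set r := vdet e f * vdet (mv (M s) f) f; set t := vdet e f * vdet e (mv (M s) f).
exists p, q, r, t; split; [exact: coord|exact: coord|].
have eE : mv (M s) e = comb p q e f by apply: coord.
have fE : mv (M s) f = comb r t e f by apply: coord.
have n1 := P_act e e hs; rewrite eE P_comb in n1.
have n2 := P_act f f hs; rewrite fE P_comb in n2.
have n3 := P_act e f hs; rewrite eE fE P_comb in n3.
clearbody p q r t; apply: isometry_cases => //; try lia.
(* The Gram determinant is preserved by s and multiplied by (p t - q r)^2. *)
have g : (4 * P e e * P f f - (P e f *+ 2) * (P e f *+ 2)) * ((p * t - q * r) * (p * t - q * r)) =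
    (4 * P e e * P f f - (P e f *+ 2) * (P e f *+ 2)) * 1.
  rewrite mulr1; pose l u v u' v' := P e e * (u * u') + P e f * (u * v' + v * u') + P f f * (v * v').
  transitivity (4 * l p q p q * l r t r t - (l p q r t *+ 2) * (l p q r t *+ 2)).
    by rewrite /l; ring.
  by rewrite /l n1 n2 n3.
have pos : 0 < 4 * P e e * P f f - (P e f *+ 2) * (P e f *+ 2).
  have h1 : (P e f *+ 2) * (P e f *+ 2) <= P e e * P f f by apply: ler_pM => //; lia.
  have h2 : 0 < P e e * P f f by apply: mulr_gt0 => //; lia.
  lia.
have /eqP := mulfI (lt0r_neq0 pos) g.
by rewrite -expr2 sqrf_eq1 => /orP [] /eqP ->; [left|right].
Qed.

End FiniteMatrixGroup.
End Reduction.

Lemma perm3_exists (i0 i1 i2 : 'I_3) : uniq [:: i0; i1; i2] ->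
  exists p : {perm 'I_3}, [/\ p o0 = i0, p o1 = i1 & p o2 = i2].
Proof.
move=> u; have Fi : injective (fun i : 'I_3 => nth o0 [:: i0; i1; i2] i).
  move=> i j e; apply/val_inj/eqP; rewrite -(nth_uniq o0 _ _ u) ?ltn_ord //.
  by apply/eqP.
by exists (perm Fi); rewrite !permE.
Qed.

(** * From lattice bases to monomial coordinates *)

Section Monomials.
Variables (k : fieldType) (K : fieldExtType k) (L : fieldType) (iK : {rmorphism K -> L}).
Variables (x y : L) (gT : finGroupType) (G : {group gT}) (to : action G L).
Hypothesis sl : semilinear_action iK x y to.
Let toB := sl_add sl.
Let toMm := sl_mul sl.
Local Notation Kb := (Kb iK).

Definition mon (v : int * int) : L := x ^ v.1 * y ^ v.2.

Let xy0 : x != 0 /\ y != 0.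
Proof.
split; rewrite -[X in X != 0]subr0.
  exact: transc_neq (sl_x sl) (gen0 _).
exact: transc_neq (sl_y sl) (gen0 _).
Qed.

Lemma mon_comb p q e f : mon (comb p q e f) = mon e ^ p * mon f ^ q.
Proof.
have [x0 y0] := xy0.
rewrite /mon /comb /= !expfzMl !expfzDr // !(mulrC p) !(mulrC q) !exprz_exp mulrACA //.
Qed.

Lemma mon_neq0 v : mon v != 0.
Proof. by have [x0 y0] := xy0; rewrite mulf_neq0 // expfz_neq0. Qed.

Lemma mon_inj : injective mon.
Proof.
have [x0 y0] := xy0.
have key v : mon v = 1 -> v = (0, 0).
  case: v => m n; rewrite /mon /= => e.
  suff : (absz m, absz n) = (0, 0)%N by case=> /eqP + /eqP; rewrite !absz_eq0 => /eqP -> /eqP ->.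
  have inj := monomial_inj (sl_x sl) (sl_y sl).
  case: m n e => m [] n e.
  - by apply: inj; rewrite mulr1.
  - have : x ^+ m * y ^+ 0 = x ^+ 0 * y ^+ n.+1.
      rewrite expr0 mulr1 mul1r -[RHS]mul1r -e NegzE -exprnN mulfVK // expf_neq0 //.
    by move=> /(inj (_, _) (_, _)) [_] /=.
  - have : x ^+ 0 * y ^+ n = x ^+ m.+1 * y ^+ 0.
      rewrite expr0 mulr1 mul1r -[RHS]mul1r -e NegzE -exprnN mulrAC mulVf ?mul1r // expf_neq0 //.
    by move=> /(inj (_, _) (_, _)) [].
  - have : x ^+ m.+1 * y ^+ n.+1 = x ^+ 0 * y ^+ 0.
      by apply: invr_inj; rewrite !expr0 mulr1 invr1 invfM -e !NegzE -!exprnN.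
    by move=> /(inj (_, _) (_, _)) [].
move=> v w e; have : mon (comb 1 (-1) v w) = 1.
  by rewrite mon_comb e expr1z; apply: mulfV (mon_neq0 w).
by move/key => [] /eqP + /eqP; rewrite !mul1r !mulN1r !subr_eq0;
  case: v w {e} => v1 v2 [w1 w2] /= /eqP -> /eqP ->.
Qed.

Lemma gen_expz (Z : L -> Prop) z (n : int) : gen Z z -> gen Z (z ^ n).
Proof. by move=> hz; case: n => n; [apply: genX | apply/genV/genX]. Qed.

Hypothesis monomial : forall s, s \in G -> exists M : 'M[int]_2,
  to x s = mon (M 0 0, M 1 0) /\ to y s = mon (M 0 1, M 1 1).

(** Quantified over all subfields, it gives equality of the generated fields over k and over K at
    once. *)
Definition same_gen (u v u' v' : L) :=
  forall Z : L -> Prop, gen Z u /\ gen Z v <-> gen Z u' /\ gen Z v'.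

Lemma monomial_basis :
  (exists X Y, signed_basis iK to X Y /\ same_gen x y X Y) \/
  (exists a b, hexagonal_basis iK to a b /\ same_gen x y a b).
Proof.
have /choice [M hM] : forall s, exists M : 'M[int]_2, s \in G ->
    to x s = mon (M 0 0, M 1 0) /\ to y s = mon (M 0 1, M 1 1).
  move=> s; have [/monomial [M hM]|_] := boolP (s \in G); first by exists M.
  by exists 0.
have act s v : s \in G -> to (mon v) s = mon (mv (M s) v).
  move=> hs; have [f fE] := to_rmorph toB toMm hs; have [hx hy] := hM s hs.
  rewrite {1}/mon -fE rmorphM !fmorphXz !fE hx hy -mon_comb; congr mon.
  by rewrite /comb /mv /=; congr (_, _); ring.
have MM s r : s \in G -> r \in G -> forall v, mv (M r) (mv (M s) v) = mv (M (s * r)%g) v.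
  by move=> hs hr v; apply: mon_inj; rewrite -!act ?groupM // to_comp.
have M1 v : mv (M 1%g) v = v by apply: mon_inj; rewrite -act // to_id.
have [e [f [S [ef hS hM']]]] := lattice_cases MM M1.
have xyE : x = mon (1, 0) /\ y = mon (0, 1).
  by rewrite /mon /= !expr1z !expr0z mulr1 mul1r.
have genXY (Z : L -> Prop) X Y : (forall p q, exists p' q', comb p q e f = comb p' q' X Y) ->
    gen Z (mon X) -> gen Z (mon Y) -> gen Z x /\ gen Z y.
  move=> hXY gX gY; have d2 : vdet e f * vdet e f = 1 by case: ef => ->.
  have gm w : gen Z (mon w).
    have -> : w = comb (vdet e f * vdet w f) (vdet e f * vdet e w) e f.
      rewrite [LHS]surjective_pairing /comb; congr (_, _).
        by transitivity ((vdet e f * vdet e f) * w.1); [rewrite d2 mul1r | rewrite /vdet; ring].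
      by transitivity ((vdet e f * vdet e f) * w.2); [rewrite d2 mul1r | rewrite /vdet; ring].
    have [p' [q' ->]] := hXY (vdet e f * vdet w f) (vdet e f * vdet e w).
    by rewrite mon_comb; apply: genM; apply: gen_expz.
  by rewrite (proj1 xyE) (proj2 xyE).
have genS X Y : (forall p q, exists p' q', comb p q e f = comb p' q' X Y) ->
    same_gen x y (mon X) (mon Y).
  move=> hXY Z; split=> -[g1 g2]; last exact: genXY hXY g1 g2.
  by split; apply: genM; apply: gen_expz.
have genX (Z : L -> Prop) X Y v : (forall p q, exists p' q', comb p q e f = comb p' q' X Y) ->
    (forall u, Kb u -> gen Z u) -> gen Z (mon X) -> gen Z (mon Y) -> gen Z v.
  move=> hXY hZ gX gY; have [gx gy] := genXY Z X Y hXY gX gY.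
  by apply: gen_le (sl_gen sl v) => u [[/hZ //|->]|->].
have toE p q X s : s \in G -> mv (M s) X = comb p q e f -> to (mon X) s = mon e ^ p * mon f ^ q.
  by move=> hs h; rewrite act // h mon_comb.
have N1 (z : L) : z ^ (-1 : int) = z^-1 by [].
case: hS => [|[]] SE.
- left; exists (mon e), (mon f).
  split; last first.
    by apply: genS => // p q; exists p, q.
  split=> [z|s hs].
    apply: (genX _ e f); [by move=> p q; exists p, q| | |].
    + by move=> u hu; apply/gen_ext/gen_ext/gen_in.
    + exact/gen_ext/gen_extr.
    + exact: gen_extr.
  have [p [q [r [t [h1 h2 hin]]]]] := hM' s hs.
  rewrite /sact (toE _ _ _ s hs h1) (toE _ _ _ s hs h2).
  move: hin; rewrite SE /rect_mats /= !inE => /orP [|/orP [|/orP [|/orP [|/orP [|/orP [|/orP []]]]]]] /eqP [-> -> -> ->];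
    rewrite ?expr0z ?mulr1 ?mul1r ?expr1z ?N1.
  + by exists false, false, false.
  + by exists false, false, true.
  + by exists false, true, false.
  + by exists false, true, true.
  + by exists true, false, false.
  + by exists true, false, true.
  + by exists true, true, false.
  + by exists true, true, true.
(* The rhombic matrices keep or exchange f and e - f, up to a common sign. *)
- left; exists (mon f), (mon (comb 1 (-1) e f)).
  split; last first.
    by apply: genS => // p q; exists (p + q), p; rewrite /comb /=; congr (_, _); ring.
  split=> [z|s hs].
    apply: (genX _ f (comb 1 (-1) e f)).
    + by move=> p q; exists (p + q), p; rewrite /comb /=; congr (_, _); ring.
    + by move=> u hu; apply/gen_ext/gen_ext/gen_in.
    + exact/gen_ext/gen_extr.
    + exact: gen_extr.
  have [p [q [r [t [h1 h2 hin]]]]] := hM' s hs.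
  have h3 : mv (M s) (comb 1 (-1) e f) = comb (p - r) (q - t) e f.
    transitivity (comb 1 (-1) (mv (M s) e) (mv (M s) f)).
      by rewrite /mv /comb /=; congr (_, _); ring.
    by rewrite h1 h2 /comb /=; congr (_, _); ring.
  rewrite /sact (toE _ _ _ s hs h2) (toE _ _ _ s hs h3) mon_comb.
  move: hin; rewrite SE /rhombic_mats !inE => /orP [|/orP [|/orP []]] /eqP [-> -> -> ->].
  + by exists false, false, false; split; rewrite /= ?expr0z ?mul1r ?expr1z.
  + exists false, true, true; split; rewrite /= ?expr0z ?mul1r ?expr1z //.
    by rewrite invfM ?N1 invrK.
  + exists true, false, false; split; rewrite /= ?expr0z ?mul1r ?expr1z //.
  + exists true, true, true; split; rewrite /= ?expr0z ?mul1r ?expr1z //.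
    by rewrite invfM ?N1 invrK.
(* In the hexagonal lattice e and f enclose 60 degrees. The vectors e, - f, f - e sum to 0 and are
   permuted up to a common sign; they are the exponents of a, b and 1 / (a b). *)
right; exists (mon e), (mon f)^-1; split; last first.
  move=> Z; rewrite (genS e f) => [|p q]; last by exists p, q.
  by split=> -[g1 g2]; split=> //; [|rewrite -[mon f]invrK]; apply: genV.
split=> [z|s hs].
  apply: (genX _ e f); [by move=> p q; exists p, q| | |].
  + by move=> u hu; apply/gen_ext/gen_ext/gen_in.
  + exact/gen_ext/gen_extr.
  + by have := genV (gen_extr (ext Kb (mon e)) (mon f)^-1); rewrite invrK.
have [p [q [r [t [h1 h2 hin]]]]] := hM' s hs.
have [e0 f0] := (mon_neq0 e, mon_neq0 f).
have [g gE] := to_rmorph toB toMm hs.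
have t0 : to (mon e) s = mon e ^ p * mon f ^ q by rewrite (toE _ _ _ s hs h1).
have t1 : to (mon f) s = mon e ^ r * mon f ^ t by rewrite (toE _ _ _ s hs h2).
suff [i0 [i1 [i2 [ep [iu H0 H1 H2]]]]] : exists i0 i1 i2 ep, [/\ uniq [:: i0; i1; i2],
    mon e ^ p * mon f ^ q = sg ep (hx (mon e) (mon f)^-1 i0),
    (mon e ^ r * mon f ^ t)^-1 = sg ep (hx (mon e) (mon f)^-1 i1) &
    ((mon e ^ p * mon f ^ q) / (mon e ^ r * mon f ^ t))^-1 = sg ep (hx (mon e) (mon f)^-1 i2)].
  have [pp [p0 p1 p2]] := perm3_exists iu; exists pp, ep.
  elim/ord3P.
  - by rewrite p0 -H0 -t0.
  - by rewrite p1 -H1 -t1 /hx /= -!gE fmorphV.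
  - by rewrite p2 -H2 -t1 -t0 /hx /= -!gE fmorphV fmorph_div.
move: hin; rewrite SE /hex_mats !inE.
clear t0 t1 toE genX; move: (mon e) (mon f) e0 f0 => E F e0 f0.
do 11?[case/orP]; move=> /eqP [-> -> -> ->]; rewrite /hx /= ?expr0z ?expr1z ?N1 ?mul1r ?mulr1.
- by exists o0, o2, o1, true; split; rewrite /sg /= ?invfM ?invrK //; field; rewrite ?e0 ?f0.
- by exists o0, o1, o2, true; split; rewrite /sg /= ?invfM ?invrK //; field; rewrite ?e0 ?f0.
- by exists o2, o0, o1, false; split; rewrite /sg /= ?invfM ?invrK //; field; rewrite ?e0 ?f0.
- by exists o2, o1, o0, false; split; rewrite /sg /= ?invfM ?invrK //; field; rewrite ?e0 ?f0.
- by exists o1, o0, o2, false; split; rewrite /sg /= ?invfM ?invrK //; field; rewrite ?e0 ?f0.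
- by exists o1, o2, o0, false; split; rewrite /sg /= ?invfM ?invrK //; field; rewrite ?e0 ?f0.
- by exists o1, o2, o0, true; split; rewrite /sg /= ?invfM ?invrK //; field; rewrite ?e0 ?f0.
- by exists o1, o0, o2, true; split; rewrite /sg /= ?invfM ?invrK //; field; rewrite ?e0 ?f0.
- by exists o2, o1, o0, true; split; rewrite /sg /= ?invfM ?invrK //; field; rewrite ?e0 ?f0.
- by exists o2, o0, o1, true; split; rewrite /sg /= ?invfM ?invrK //; field; rewrite ?e0 ?f0.
- by exists o0, o1, o2, false; split; rewrite /sg /= ?invfM ?invrK //; field; rewrite ?e0 ?f0.
- by exists o0, o2, o1, false; split; rewrite /sg /= ?invfM ?invrK //; field; rewrite ?e0 ?f0.
Qed.

End Monomials.

(** * Reduction to the exceptional case *)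

Variant perm3_spec (p : {perm 'I_3}) : Prop :=
| Perm3id of p o0 = o0 & p o1 = o1 & p o2 = o2
| Perm3c of p o0 = o1 & p o1 = o2 & p o2 = o0
| Perm3d of p o0 = o2 & p o1 = o0 & p o2 = o1
| Perm3t2 of p o0 = o1 & p o1 = o0 & p o2 = o2
| Perm3t0 of p o0 = o0 & p o1 = o2 & p o2 = o1
| Perm3t1 of p o0 = o2 & p o1 = o1 & p o2 = o0.

Lemma perm3_cases p : perm3_spec p.
Proof.
have [i e0] : exists i, p o0 = i by exists (p o0).
have [j e1] : exists j, p o1 = j by exists (p o1).
have [l e2] : exists l, p o2 = l by exists (p o2).
have n01 : p o0 != p o1 by rewrite (inj_eq perm_inj).
have n02 : p o0 != p o2 by rewrite (inj_eq perm_inj).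
have n12 : p o1 != p o2 by rewrite (inj_eq perm_inj).
move: i j l e0 e1 e2 n01 n02 n12.
by elim/ord3P; elim/ord3P; elim/ord3P => e0 e1 e2; rewrite e0 e1 e2 // => _ _ _;
  [apply: Perm3id|apply: Perm3t0|apply: Perm3t2|apply: Perm3c|apply: Perm3d|apply: Perm3t1].
Qed.

Section Main.
Variables (k : fieldType) (K : fieldExtType k) (L : fieldType) (iK : {rmorphism K -> L}).
Variables (x y : L) (gT : finGroupType) (G : {group gT}) (to : action G L).
Hypothesis sl : semilinear_action iK x y to.
Let toB := sl_add sl.
Let toMm := sl_mul sl.
Variable H : {group gT}.
Hypothesis sHG : H \subset G.
Hypothesis memH : forall s, s \in G -> (s \in H <-> forall c, gen (Kb iK) c -> to c s = c).
Local Notation Kb := (Kb iK).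

Lemma memHJ h s : h \in H -> s \in G -> (s^-1 * h * s)%g \in H.
Proof.
move=> hh hs; have hG := subsetP sHG h hh.
apply/memH; first by rewrite !groupM ?groupV.
move=> c hc; rewrite !to_comp ?groupM ?groupV //.
rewrite (proj1 (memH hG) hh) ?toVK //.
by apply: (Kb_stable sl) => //; rewrite groupV.
Qed.

Section Hexagonal.
Variables a b : L.
Hypothesis ab : hexagonal_basis iK to a b.
Variables (pi : gT -> {perm 'I_3}) (ep : gT -> bool).
Hypothesis piP : forall s, s \in G -> hact to a b s (pi s) (ep s).

Let piM s r i : s \in G -> r \in G -> pi (s * r)%g i = pi r (pi s i).
Proof. by move=> hs hr; rewrite (proj1 (pi_mul sl ab piP hs hr)) permM. Qed.
Let epM s r : s \in G -> r \in G -> ep (s * r)%g = ep s (+) ep r.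
Proof. by move=> hs hr; rewrite (proj2 (pi_mul sl ab piP hs hr)). Qed.

Let fwd s := pi s o0 = o1 /\ pi s o1 = o2.
Let bwd s := pi s o0 = o2 /\ pi s o1 = o0.

Let third s : fwd s \/ bwd s -> pi s o2 = if pi s o0 == o1 then o0 else o1.
Proof.
by rewrite /fwd /bwd; case: (perm3_cases (pi s)) => p0 p1 p2; rewrite p0 p1 p2; case=> -[].
Qed.

Let fwd_sq s : s \in G -> fwd s -> bwd (s * s)%g.
Proof.
move=> hs hf; have h2 := third (or_introl hf); case: hf => h0 h1.
by rewrite h0 eqxx in h2; split; rewrite piM ?h0 ?h1.
Qed.

Let bwd_sq s : s \in G -> bwd s -> fwd (s * s)%g.
Proof.
move=> hs hf; have h2 := third (or_intror hf); case: hf => h0 h1.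
by rewrite h0 /= in h2; split; rewrite piM ?h0 ?h1.
Qed.

Lemma rational_three_cycle s0 : s0 \in G -> fwd s0 \/ bwd s0 ->
  rational (fun c : k => iK c%:A) (inv to).
Proof.
move=> hs0 cyc0.
have [[h [hh hcyc]]|nocyc] := pselect (exists h, h \in H /\ (fwd h \/ bwd h)).
  have hG := subsetP sHG h hh.
  have hhG : (h * h)%g \in G by rewrite groupM.
  (* An even power has trivial sign: the fourth if h is a forward cycle, the second if backward. *)
  have [r [hr fr er]] : exists r, [/\ r \in H, fwd r & ep r = false].
    case: hcyc => hc.
      exists (h * h * (h * h))%g; rewrite !groupM //; split=> //.
        by apply: bwd_sq => //; apply: fwd_sq.
      by rewrite !epM // addbb.
    by exists (h * h)%g; rewrite groupM // epM // addbb; split=> //; apply: bwd_sq.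
  by case: fr => f0 f1; apply: (rational_hexagon_rotation sl sHG memH ab piP hr).
have H1 h : h \in H -> pi h = 1%g.
  move=> hh; have hG := subsetP sHG h hh; apply: contrapT => h1; apply: (nocyc).
  have hJ := memHJ hh hs0; set h' := (s0^-1 * h * s0)%g in hJ; have h'G := subsetP sHG h' hJ.
  have e i : pi h' (pi s0 i) = pi s0 (pi h i).
    by rewrite -!piM // /h' !mulgA mulgV mul1g.
  (* If h acts as a transposition, its conjugate by the 3-cycle s0 acts as another one, and their
     product is a 3-cycle in H. *)
  exists (h * h')%g; rewrite groupM //; split=> //; rewrite /fwd /bwd !(piM _ hG h'G).
  have := e o0; have := e o1; have := e o2; have s2 := third cyc0.
  case: (perm3_cases (pi h)) => p0 p1 p2.
  - by case: h1; apply/permP; elim/ord3P; rewrite perm1 ?p0 ?p1 ?p2.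
  - by case: nocyc; exists h; split=> //; left.
  - by case: nocyc; exists h; split=> //; right.
  - by move: s2; rewrite p0 p1 p2; case: cyc0 => -[-> ->] /= -> E2 E1 E0; rewrite ?E2 ?E1 ?E0; by [left|right].
  - by move: s2; rewrite p0 p1 p2; case: cyc0 => -[-> ->] /= -> E2 E1 E0; rewrite ?E2 ?E1 ?E0; by [left|right].
  - by move: s2; rewrite p0 p1 p2; case: cyc0 => -[-> ->] /= -> E2 E1 E0; rewrite ?E2 ?E1 ?E0; by [left|right].
have [s1 [hs1 [f0 f1]]] : exists s1, s1 \in G /\ fwd s1.
  case: cyc0 => hc; first by exists s0.
  by exists (s0 * s0)%g; rewrite groupM //; split=> //; apply: bwd_sq.
have [[h [hh eh]]|neps] := pselect (exists h, h \in H /\ ep h = true).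
  exact: (rational_hexagon_inversion sl sHG memH ab piP hs1 f0 f1 H1 hh eh).
apply: (rational_hexagon_split sl sHG memH ab piP hs1 f0 f1) => h hh; split; first exact: H1.
by apply/negP => eh; apply: neps; exists h.
Qed.

Lemma signed_of_hexagonal : (forall s, s \in G -> ~ (fwd s \/ bwd s)) ->
  exists X Y, signed_basis iK to X Y /\ same_gen a b X Y.
Proof.
move=> nocyc.
(* Two different transpositions have a 3-cycle as product; so at most one transposition occurs, and
   an index j is fixed by all. *)
have [j hj] : exists j, forall s, s \in G -> pi s j = j.
  have [[s [hs [j [sj s1]]]]|no] := pselect (exists s, s \in G /\ exists j, pi s j = j /\ pi s != 1%g).
    exists j => r hr; have := nocyc _ (groupM hs hr); have := nocyc _ hs; have := nocyc _ hr.
    rewrite /fwd /bwd !piM //; move: j sj s1; elim/ord3P => sj s1;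
    case: (perm3_cases (pi s)) sj => p0 p1 p2; rewrite ?p0 ?p1 ?p2 // => _;
    try (by move/eqP: s1; case; apply/permP; elim/ord3P; rewrite perm1 ?p0 ?p1 ?p2);
    case: (perm3_cases (pi r)) => q0 q1 q2; rewrite ?q0 ?q1 ?q2 //;
    by [move=> /not_orP [h1 h2]; case: h1 | move=> /not_orP [h1 h2]; case: h2
       | move=> _ _ /not_orP [h1 h2]; case: h1 | move=> _ _ /not_orP [h1 h2]; case: h2].
  exists o2 => s hs; have [->|s1] := eqVneq (pi s) 1%g; first by rewrite perm1.
  case: (perm3_cases (pi s)) => p0 p1 p2 //.
  - by case: (nocyc s hs); left.
  - by case: (nocyc s hs); right.
  - by case: no; exists s; split=> //; exists o0.
  - by case: no; exists s; split=> //; exists o1.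
have [a0 b0] := hex_neq0 sl ab.
have genh (Z : L -> Prop) i i' : i != j -> i' != j -> i != i' ->
    gen Z (hx a b i) -> gen Z (hx a b i') -> gen Z a /\ gen Z b.
  have ca : (a * b)^-1^-1 / b = a by rewrite invrK; field.
  have cb : (a * b)^-1^-1 / a = b by rewrite invrK; field.
  move: i i'; elim/ord3P; elim/ord3P => // _ _ _; rewrite /hx /= => g1 g2; split=> //.
  - by rewrite -cb; apply: gen_div => //; apply: genV.
  - by rewrite -ca; apply: gen_div => //; apply: genV.
  - by rewrite -cb; apply: gen_div => //; apply: genV.
  - by rewrite -ca; apply: gen_div => //; apply: genV.
have [i [i' [ij i'j ii']]] : exists i i', [/\ i != j, i' != j & i != i'].
  by move: (j); elim/ord3P; [exists o1, o2|exists o0, o2|exists o0, o1].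
exists (hx a b i), (hx a b i'); split; last first.
  move=> Z; split=> [[ga gb]|[]]; last exact: genh.
  have gh l : gen Z (hx a b l) by move: l; elim/ord3P => //; apply/genV/genM.
  by split; apply: gh.
split=> [v|].
  have [ga gb] : gen (ext (ext Kb (hx a b i)) (hx a b i')) a /\ gen (ext (ext Kb (hx a b i)) (hx a b i')) b.
    by apply: (genh _ i i') => //; [apply/gen_ext/gen_extr | apply: gen_extr].
  by apply: gen_le (proj1 ab v) => u [[hu|->]|->] //; apply/gen_ext/gen_ext/gen_in.
move=> s hs; exists (pi s i == i'), (ep s), (ep s).
have sj := hj s hs; have pi_ne l : l != j -> pi s l != j by rewrite -{2}sj (inj_eq perm_inj).
have two l : l != j -> l != i -> l = i'.
  move: ij i'j ii'; move: (i) (i') (j) l; by do 4!elim/ord3P; move=> // ? // ? // ? // ? // ? //.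
have two' l : l != j -> l != i' -> l = i.
  move: ij i'j ii'; move: (i) (i') (j) l; by do 4!elim/ord3P; move=> // ? // ? // ? // ? // ? //.
rewrite /sact !(piP hs); have [e|e] := eqVneq (pi s i) i'.
  suff -> : pi s i' = i by rewrite e.
  by apply: two'; [apply: pi_ne | rewrite -{2}e (inj_eq perm_inj) eq_sym].
have e1 : pi s i = i by apply: two' => //; apply: pi_ne.
by rewrite e1 (two (pi s i')) // ?pi_ne // -e1 (inj_eq perm_inj) eq_sym.
Qed.

End Hexagonal.

Hypothesis monomial : forall s, s \in G -> exists M : 'M[int]_2,
  to x s = mon x y (M 0 0, M 1 0) /\ to y s = mon x y (M 0 1, M 1 1).

Lemma hex_choice a b : hexagonal_basis iK to a b ->
  exists (pi : gT -> {perm 'I_3}) (ep : gT -> bool), forall s, s \in G -> hact to a b s (pi s) (ep s).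
Proof.
move=> ab; have /choice [c hc] : forall s, exists q : {perm 'I_3} * bool,
    s \in G -> hact to a b s q.1 q.2.
  move=> s; have [hs|_] := boolP (s \in G); last by exists (1%g, false).
  by have [p [e he]] := (proj2 ab) s hs; exists (p, e).
by exists (fun s => (c s).1), (fun s => (c s).2).
Qed.

Lemma rational_or_exceptional : rational (fun c : k => iK c%:A) (inv to) \/
  2%:R != 0 :> L /\
  exists X Y, [/\ signed_basis iK to X Y, same_gen x y X Y & exceptional to H X Y].
Proof.
have sgn X Y : signed_basis iK to X Y -> same_gen x y X Y ->
    rational (fun c : k => iK c%:A) (inv to) \/ 2%:R != 0 :> L /\
    exists X Y, [/\ signed_basis iK to X Y, same_gen x y X Y & exceptional to H X Y].
  move=> XY XYxy; have [[h1 h2]|h] := pselect (2%:R != 0 :> L /\ exceptional to H X Y).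
    by right; split=> //; exists X, Y; split.
  by left; apply: (rational_signed sl sHG memH XY).
have [[X [Y [XY XYxy]]]|[a [b [ab abxy]]]] := monomial_basis sl monomial; first exact: sgn XY XYxy.
have [pi [ep piP]] := hex_choice ab.
have [[s [hs hc]]|no] := pselect (exists s, s \in G /\
    (pi s o0 = o1 /\ pi s o1 = o2 \/ pi s o0 = o2 /\ pi s o1 = o0)).
  by left; apply: (rational_three_cycle ab piP hs hc).
have [X [Y [XY XYab]]] : exists X Y, signed_basis iK to X Y /\ same_gen a b X Y.
  by apply: (signed_of_hexagonal ab piP) => s hs hc; apply: no; exists s.
by apply: sgn XY _ => Z; split=> [/abxy/XYab|/XYab/abxy].
Qed.

(** S_3 x {1, -1} has exponent 6. On a hexagonal basis s^6 would act trivially, and with s^4 also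
    s^2. *)
Lemma signed_of_order4 s : s \in G -> to x (s ^+ 4)%g = x -> to y (s ^+ 4)%g = y ->
    ~ (to x (s ^+ 2)%g = x /\ to y (s ^+ 2)%g = y) ->
  exists X Y, signed_basis iK to X Y /\ same_gen x y X Y.
Proof.
move=> hs x4 y4 n2; case: (monomial_basis sl monomial) => [//|[a [b [ab abxy]]]].
have [pi [ep piP]] := hex_choice ab; case: n2.
have piM r t i : r \in G -> t \in G -> pi (r * t)%g i = pi t (pi r i).
  by move=> hr ht; rewrite (proj1 (pi_mul sl ab piP hr ht)) permM.
have epM r t : r \in G -> t \in G -> ep (r * t)%g = ep r (+) ep t.
  by move=> hr ht; rewrite (proj2 (pi_mul sl ab piP hr ht)).
have s2G : (s * s)%g \in G by rewrite groupM.
have s3G : (s * s * s)%g \in G by rewrite groupM.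
have s6 i : to (hx a b i) (s * s * s * (s * s * s))%g = hx a b i.
  rewrite piP ?groupM // !(epM, piM, groupM) // addbb /=.
  by congr hx; case: (perm3_cases (pi s)) => p0 p1 p2; move: i; elim/ord3P; rewrite ?(p0, p1, p2).
have fixab t : t \in G -> to a t = a -> to b t = b -> to x t = x /\ to y t = y.
  move=> ht ha hb; have [hx hy] : gen (fun w => w = a \/ w = b) x /\ gen (fun w => w = a \/ w = b) y.
    by apply/abxy; split; apply: gen_in; [left|right].
  by split; [apply: (gen_fix toB toMm ht _ hx) | apply: (gen_fix toB toMm ht _ hy)] => w [] ->.
have fixxy t : t \in G -> to x t = x -> to y t = y -> to a t = a /\ to b t = b.
  move=> ht hx hy; have [ha hb] : gen (fun w => w = x \/ w = y) a /\ gen (fun w => w = x \/ w = y) b.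
    by apply/abxy; split; apply: gen_in; [left|right].
  by split; [apply: (gen_fix toB toMm ht _ ha) | apply: (gen_fix toB toMm ht _ hb)] => w [] ->.
have [a4 b4] := fixxy _ (groupX 4 hs) x4 y4.
have e6 : (s * s * s * (s * s * s) = s ^+ 4 * s ^+ 2)%g by rewrite !expgS expg0 mulg1 !mulgA.
apply: fixab; first exact: groupX.
  by have := s6 o0; rewrite e6 to_comp ?groupX // a4.
by have := s6 o1; rewrite e6 to_comp ?groupX // b4.
Qed.

End Main.

(** * Quaternion algebras and norms *)

Lemma ord2P (P : 'I_2 -> Prop) : P 0 -> P 1 -> forall i, P i.
Proof.
move=> h0 h1 [[|[|//]] hi].
- by rewrite (_ : Ordinal hi = 0) //; apply: val_inj.
- by rewrite (_ : Ordinal hi = 1) //; apply: val_inj.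
Qed.

Section QuaternionNorm.
Variables (k : fieldType) (a b : k).
Hypothesis two : 2%:R != 0 :> k.
Hypothesis a_ns : nonsquare a.
Local Notation Q := (quaternion a b).

Let qnth (z : Q) n := quat_coord z (inord n).

Lemma quat_ext (z w : Q) : qnth z 0%N = qnth w 0%N -> qnth z 1%N = qnth w 1%N ->
  qnth z 2%N = qnth w 2%N -> qnth z 3%N = qnth w 3%N -> z = w.
Proof. by move=> h0 h1 h2 h3; apply: quatP => -[|[|[|[|//]]]]. Qed.

Lemma quat_scalarE (c : k) : c%:A = mkquat a b c 0 0 0 :> Q.
Proof.
by apply: quat_ext; rewrite /qnth quat_coordZ quat_oneE !quat_coordE //= ?mulr1 ?mulr0.
Qed.

(** N(z0 + z1 sqrt a) - b N(z2 + z3 sqrt a), where N is the norm of k(sqrt a). *)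
Definition quat_norm (z : Q) : k :=
  qnth z 0%N ^+ 2 - a * qnth z 1%N ^+ 2 - b * (qnth z 2%N ^+ 2 - a * qnth z 3%N ^+ 2).

Definition quat_conj (z : Q) : Q := mkquat a b (qnth z 0%N) (- qnth z 1%N) (- qnth z 2%N) (- qnth z 3%N).

Lemma quat_mul_conj z : z * quat_conj z = (quat_norm z)%:A /\ quat_conj z * z = (quat_norm z)%:A.
Proof.
split; rewrite quat_scalarE quat_mulE; apply: quat_ext;
  rewrite /quat_mul /quat_conj /qnth ?quat_coordE //= ?quat_coordE //= /quat_norm /qnth; ring.
Qed.

Definition is_norm := exists p q, b = p ^+ 2 - a * q ^+ 2.

Lemma quat_norm_aniso : ~ is_norm -> forall z, quat_norm z = 0 -> z = 0.
Proof.
move=> nn z; rewrite /quat_norm; set z0 := qnth z 0%N; set z1 := qnth z 1%N.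
set z2 := qnth z 2%N; set z3 := qnth z 3%N.
have aniso u v : u ^+ 2 - a * v ^+ 2 = 0 -> u = 0 /\ v = 0.
  move=> h; have [v0|v0] := eqVneq v 0.
    by move: h; rewrite v0 expr0n mulr0 subr0 => /eqP; rewrite expf_eq0 => /eqP.
  case/eqP: (a_ns (u / v)); rewrite expr_div_n; apply: (mulIf (expf_neq0 2 v0)).
  by rewrite divfK ?expf_neq0 //; apply/eqP; rewrite -subr_eq0 h.
move=> h; have [d0|d0] := eqVneq (z2 ^+ 2 - a * z3 ^+ 2) 0.
  have [e2 e3] := aniso _ _ d0; move: h; rewrite d0 mulr0 subr0 => /aniso [e0 e1].
  have c0 n : (n < 4)%N -> qnth (0 : Q) n = 0 by move=> _; rewrite /qnth /quat_coord mxE.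
  by apply: quat_ext; rewrite c0.
(* The coordinates of (z0 + z1 sqrt a) / (z2 + z3 sqrt a), whose norm is b. *)
case: nn; exists ((z0 * z2 - a * z1 * z3) / (z2 ^+ 2 - a * z3 ^+ 2)).
exists ((z1 * z2 - z0 * z3) / (z2 ^+ 2 - a * z3 ^+ 2)).
have -> : b = (z0 ^+ 2 - a * z1 ^+ 2) / (z2 ^+ 2 - a * z3 ^+ 2).
  by apply: (mulIf d0); rewrite divfK //; apply/eqP; rewrite eq_sym -subr_eq0 h.
by field.
Qed.

Section Division.
Hypothesis nn : ~ is_norm.

Lemma quat_inverse (z : Q) : z != 0 -> exists w, w * z = 1 /\ z * w = 1.
Proof.
move=> z0; have n0 : quat_norm z != 0.
  by apply: contra z0 => /eqP h; apply/eqP/(quat_norm_aniso nn).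
have [h1 h2] := quat_mul_conj z.
exists ((quat_norm z)^-1 *: quat_conj z).
by rewrite -scalerAl -scalerAr h1 h2 scalerA mulVf // scale1r.
Qed.

Lemma quat_simple : simple_alg Q.
Proof.
move=> I hI; have [->|I0] := eqVneq I 0%VS; first by left.
have z0 : vpick I != 0 by rewrite vpick0.
right; have [w [wz _]] := quat_inverse z0.
have I1 : 1 \in I by rewrite -wz; case/andP: (hI _ w (memv_pick I)).
apply/vspaceP => v; rewrite memvf; apply/idP.
by have /andP [] := hI _ v I1; rewrite mul1r.
Qed.

Lemma quat_central : b != 0 -> central Q.
Proof.
move=> b0 z hz; exists (qnth z 0%N); rewrite quat_scalarE.
have := hz (mkquat a b 0 1 0 0); have := hz (mkquat a b 0 0 1 0); rewrite !quat_mulE => hv hu.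
have a0 : a != 0 by apply: contraNneq (a_ns 0) => ->; rewrite expr0n.
have ev n := congr1 (qnth^~ n) hv; have eu n := congr1 (qnth^~ n) hu.
have half (u : k) : u = - u -> u = 0.
  move=> h; apply: (mulfI two); rewrite mulr0 mulr_natl mulr2n {1}h addNr //.
have := ev 1%N; have := ev 3%N; have := eu 3%N.
rewrite /quat_mul /qnth !quat_coordE //= !(mul0r, mulr0, mul1r, mulr1, subr0, sub0r, add0r, addr0).
move=> /esym/half h2 /half h1 /half /eqP; rewrite mulf_eq0 (negPf b0) /= => /eqP h3.
by apply: quat_ext; rewrite /qnth quat_coordE.
Qed.

(** A dimension count, with m, n the matrix sizes: as Q is a division algebra, a suitable vector
    embeds Q^m in k^n, so 4 m <= n, whereas comparing the algebras gives n^2 <= 4 m^2. *)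
Lemma quat_mx_aniso m n (f : {rmorphism 'M[Q]_m.+1 -> 'M[k]_n.+1}) :
  bijective f -> (forall c : k, f (c%:A)%:M = c%:M) -> False.
Proof.
move=> [g fK gK] fc.
have fI : injective f := can_inj fK.
have fZ c X : f ((c%:A)%:M *m X) = c *: f X.
  by rewrite -[_ *m X]/(_ * X) rmorphM fc -mul_scalar_mx.
pose mq (A : 'M[k]_(m.+1, 4)) (i : 'I_m.+1) : Q := row i A.
have mqP c A B i : mq (c *: A + B) i = c *: mq A i + mq B i by rewrite /mq linearP.
(* The first column of ['M_m.+1(Q)] acts faithfully on a suitable vector. *)
have n4 : (m.+1 * 4 <= n.+1)%N.
  have f00 : f (delta_mx 0 0) != 0.
    rewrite -(rmorph0 f) (inj_eq fI); apply/eqP => /matrixP/(_ 0 0).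
    by rewrite !mxE eqxx /=; apply/eqP/oner_neq0.
  have [w hw] : exists w : 'cV[k]_n.+1, f (delta_mx 0 0) *m w != 0.
    apply: contrapT => nw; move/eqP: f00; apply; apply/matrixP => i j.
    have /matrixP /(_ i 0) : f (delta_mx 0 0) *m delta_mx j 0 = 0 :> 'cV_n.+1.
      by apply/eqP/negPn/negP => h; apply: nw; exists (delta_mx j 0).
    by rewrite -colE !mxE.
  pose F (A : 'M[k]_(m.+1, 4)) : 'M[k]_(n.+1, 1) :=
    f (\matrix_(i, j) (mq A i *+ (j == 0))) *m w.
  have Flin : linear F.
    move=> c A B; rewrite /F scalemxAl -mulmxDl; congr (_ *m _).
    rewrite -fZ -rmorphD; congr (f _); apply/matrixP => i j.
    rewrite mul_scalar_mx !mxE mqP mulrnDl; congr (_ + _).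
    by rewrite -scalerAl mul1r scalerMnr.
  pose FA := GRing.isLinear.Build k _ _ _ F Flin.
  pose Fl : {linear 'M[k]_(m.+1, 4) -> 'M[k]_(n.+1, 1)} := HB.pack F FA.
  have : row_free (lin_mx Fl).
    apply: inj_row_free => v; rewrite -[v]vec_mxK; move: (vec_mx v) => A.
    rewrite mul_vec_lin => /(congr1 vec_mx); rewrite mxvecK linear0 => hF.
    suff -> : A = 0 by rewrite linear0.
    apply/row_matrixP => i.
    rewrite row0; apply/eqP/negPn/negP => Ai.
    have [q [qA _]] := @quat_inverse (mq A i) Ai.
    move/eqP: hw; apply; rewrite -[LHS]/(_ *m w).
    have -> : delta_mx 0 0 = (q *: delta_mx 0 i : 'M_m.+1) * (\matrix_(i, j) (mq A i *+ (j == 0))).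
      apply/matrixP => u v'; rewrite !mxE (bigD1 i) //= big1 => [|j ji].
        rewrite !mxE eqxx andbT addr0; case: (u == 0); last by rewrite /= mulr0 mul0r.
        by rewrite mulr1 mulrnAr qA.
      by rewrite !mxE (negPf ji) andbF mulr0 mul0r.
    by rewrite rmorphM -mulmxA [X in _ *m X]hF mulmx0.
  by rewrite /row_free => /eqP <-; apply: leq_trans (rank_leq_col _) _; rewrite muln1.
have n2 : (n.+1 * n.+1 <= m.+1 * m.+1 * 4)%N.
  pose F (X : 'M[k]_n.+1) : 'M[k]_(m.+1 * m.+1, 4) :=
    \matrix_(i, j) qnth (mxvec (g X) 0 i : Q) j.
  have Flin : linear F.
    move=> c A B; apply/matrixP => i j; rewrite !mxE.
    have -> : g (c *: A + B) = (c%:A)%:M *m g A + g B.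
      by apply: fI; rewrite gK rmorphD fZ !gK.
    by rewrite linearD /= mul_scalar_mx !mxE linearZ !mxE -scalerAl mul1r /qnth quat_coordD quat_coordZ.
  pose FA := GRing.isLinear.Build k _ _ _ F Flin.
  pose Fl : {linear 'M[k]_n.+1 -> 'M[k]_(m.+1 * m.+1, 4)} := HB.pack F FA.
  have : row_free (lin_mx Fl).
    apply: inj_row_free => v; rewrite -[v]vec_mxK; move: (vec_mx v) => A.
    rewrite mul_vec_lin => /(congr1 vec_mx); rewrite mxvecK linear0 => hF.
    suff -> : A = 0 by rewrite linear0.
    rewrite -[A]gK -[RHS](rmorph0 f); congr (f _); apply: (can_inj mxvecK).
    apply/rowP => i; rewrite linear0 mxE; have /matrixP/(_ i) h := hF.
    have q0 j : (j < 4)%N -> qnth (mxvec (g A) 0 i) j = 0.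
      by move=> hj; have := h (Ordinal hj); rewrite !mxE.
    have z0 j : (j < 4)%N -> qnth (0 : Q) j = 0 by move=> _; rewrite /qnth /quat_coord mxE.
    by apply: quat_ext; rewrite q0 ?z0.
  by rewrite /row_free => /eqP <-; apply: leq_trans (rank_leq_col _) _.
nia.
Qed.

End Division.
Definition mx2 (c d e f : k) : 'M[k^o]_2 :=
  \matrix_(i < 2, j < 2) nth 0 (nth [::] [:: [:: c; d]; [:: e; f]] i) j.

Lemma mx2_ext (A B : 'M[k^o]_2) : A 0 0 = B 0 0 -> A 0 1 = B 0 1 -> A 1 0 = B 1 0 ->
  A 1 1 = B 1 1 -> A = B.
Proof.
move=> h00 h01 h10 h11; apply/matrixP.
by apply: ord2P; apply: ord2P.
Qed.

(** The algebra acts on k(sqrt a) with basis 1, sqrt a: u by multiplication with sqrt a, and v by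
    conjugation followed by multiplication with p + q sqrt a. The map [phi] is the matrix of this
    action. *)
Lemma norm_split : b != 0 -> is_norm -> norm_residue_zero a b.
Proof.
move=> b0 [p [q bE]]; have a0 : a != 0.
  by apply: contraNneq (a_ns 0) => ->; rewrite expr0n.
pose phi (z : Q) := let z0 := qnth z 0%N in let z1 := qnth z 1%N in
  let z2 := qnth z 2%N in let z3 := qnth z 3%N in
  mx2 (z0 + z2 * p + z3 * a * q) (a * z1 - a * q * z2 - a * p * z3)
      (z1 + q * z2 + p * z3) (z0 - z2 * p - z3 * a * q).
pose f (M : 'M[Q]_1) : 'M[k^o]_2 := phi (M 0 0).
have fB : zmod_morphism f.
  move=> M N; rewrite /f /phi /qnth !mxE -scaleN1r !quat_coordD !quat_coordZ.
  by apply: mx2_ext; rewrite !mxE /=; ring.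
have fM : monoid_morphism f.
  split; first by rewrite /f /phi /qnth !mxE /= quat_oneE !quat_coordE //=; apply: mx2_ext; rewrite !mxE /=; ring.
  move=> M N; rewrite /f mxE big_ord1 quat_mulE.
  move: (M 0 0) (N 0 0) => z w; rewrite /phi /qnth /quat_mul !quat_coordE //=.
  by apply: mx2_ext; rewrite !mxE !big_ord_recl big_ord0 !mxE /= bE; ring.
pose fA := GRing.isZmodMorphism.Build _ _ f fB.
pose fMu := GRing.isMonoidMorphism.Build _ _ f fM.
pose g : {rmorphism 'M[Q]_1 -> 'M[k^o]_2} := HB.pack f fA fMu.
exists 0%N, 1%N, g; split; last first.
  move=> c; have cA : c%:A = c :> k^o by apply: mulr1.
  rewrite /= /f /phi mxE eqxx mulr1n quat_scalarE /qnth !quat_coordE //=.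
  by apply: mx2_ext; rewrite !mxE /= ?mulr1n ?mulr0n ?cA; ring.
(* S = p z2 + a q z3 and T = q z2 + p z3 form a linear system with determinant b. *)
pose h (M : 'M[k^o]_2) : 'M[Q]_1 :=
  let S := (M 0 0 - M 1 1) / 2%:R in let T := (M 1 0 - M 0 1 / a) / 2%:R in
  const_mx (mkquat a b ((M 0 0 + M 1 1) / 2%:R) ((M 1 0 + M 0 1 / a) / 2%:R)
    ((p * S - a * q * T) / b) ((p * T - q * S) / b)).
exists h => M.
  apply/matrixP => i j; rewrite !ord1 mxE /g /= /f /phi !mxE /=.
  apply: quat_ext; rewrite /qnth quat_coordE //=.
  - by field; rewrite two.
  - by field; rewrite two a0.
  - transitivity ((p ^+ 2 - a * q ^+ 2) * quat_coord (M 0 0) (inord 2) / b); last by rewrite -bE; field.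
    by field; rewrite two a0 b0.
  - transitivity ((p ^+ 2 - a * q ^+ 2) * quat_coord (M 0 0) (inord 3) / b); last by rewrite -bE; field.
    by field; rewrite two a0 b0.
rewrite /= /f /h /phi mxE /qnth !quat_coordE //=; have bE' := esym bE.
apply: mx2_ext; rewrite !mxE /=.
- transitivity ((M 0 0 + M 1 1) / 2%:R + (p ^+ 2 - a * q ^+ 2) / b * ((M 0 0 - M 1 1) / 2%:R)).
    by field; rewrite two a0 b0.
  by rewrite bE'; field; rewrite two b0.
- transitivity (a * ((M 1 0 + M 0 1 / a) / 2%:R) - (p ^+ 2 - a * q ^+ 2) / b * (a * ((M 1 0 - M 0 1 / a) / 2%:R))).
    by field; rewrite two a0 b0.
  by rewrite bE'; field; rewrite two a0 b0.
- transitivity ((M 1 0 + M 0 1 / a) / 2%:R + (p ^+ 2 - a * q ^+ 2) / b * ((M 1 0 - M 0 1 / a) / 2%:R)).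
    by field; rewrite two a0 b0.
  by rewrite bE'; field; rewrite two a0 b0.
- transitivity ((M 0 0 + M 1 1) / 2%:R - (p ^+ 2 - a * q ^+ 2) / b * ((M 0 0 - M 1 1) / 2%:R)).
    by field; rewrite two a0 b0.
  by rewrite bE'; field; rewrite two b0.
Qed.

Lemma norm_residueP : b != 0 -> norm_residue_zero a b <-> is_norm.
Proof.
move=> b0; split=> [[m [n [f [fb fc]]]]|]; last exact: norm_split.
apply: contrapT => nn; apply: (@quat_mx_aniso nn m n f fb) => c; rewrite fc.
by congr (_%:M); apply: mulr1.
Qed.

Lemma scalar_central_simple : central_simple (k^o : falgType k).
Proof.
split=> [z _|I hI]; first by exists z; rewrite /GRing.scale /= mulr1.
have [->|I0] := eqVneq I 0%VS; first by left.
have z0 : vpick I != 0 by rewrite vpick0.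
right; apply/vspaceP => v; rewrite memvf; apply/idP.
have /andP [] := hI (vpick I) (v / vpick I) (memv_pick I).
by rewrite -[_ * (_ / _)]/((vpick I : k) * ((v : k) / vpick I)) mulrC divfK.
Qed.

Lemma not_norm_brauer : b != 0 -> ~ is_norm -> brauer_nontrivial k.
Proof.
move=> b0 nn; exists (quaternion a b), (k^o : falgType k); split.
- by split; [apply: quat_central | apply: quat_simple].
- exact: scalar_central_simple.
- by move/(norm_residueP b0).
Qed.

Lemma not_norm_infinite : ~ is_norm -> infinite_field k.
Proof.
move=> nn; apply: contrapT => /existsNP [s0 hs0].
have a0 : a != 0 by apply: contraNneq (a_ns 0) => ->; rewrite expr0n.
pose s := undup s0.
have sall c : c \in s.
  by rewrite mem_undup; apply/negPn/negP => h; apply: hs0; exists c.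
pose S := undup [seq c ^+ 2 | c <- s].
have su : uniq s by apply: undup_uniq.
have Su : uniq S by apply: undup_uniq.
have memS c : c ^+ 2 \in S by rewrite mem_undup; apply/mapP; exists c.
have inS t : t \in S -> exists c, t = c ^+ 2.
  by rewrite mem_undup => /mapP [c _ ->]; exists c.
(* Both squares and [b + a * squares] take more than half of the values. *)
have sS : (size s < size S + size S)%N.
  have /choice [r hr] : forall t, exists c : k, t \in S -> t = c ^+ 2.
    move=> t; have [/inS [c ->]|_] := boolP (t \in S); first by exists c.
    by exists 0.
  (* Every c is [r t] or [- r t] with t = c^2, and 0 has one root only: at most 2 |S| - 1
     elements. *)
  have : (size s <= size ([seq r t | t <- S] ++ [seq - r t | t <- rem (0 : k)%R S]))%N.
    apply: uniq_leq_size su _ => c _; rewrite mem_cat; apply/orP.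
    have := hr _ (memS c) => /eqP; rewrite eqf_sqr => /orP [] /eqP cr.
      by left; apply/mapP; exists (c ^+ 2).
    have [c0|c0] := eqVneq c 0.
      by left; apply/mapP; exists (c ^+ 2) => //; rewrite -[RHS]opprK -cr c0 oppr0.
    by right; apply/mapP; exists (c ^+ 2) => //; rewrite mem_rem_uniq // inE expf_eq0 c0 memS.
  have h0 : 0 \in S by have := memS 0; rewrite expr0n.
  rewrite size_cat !size_map size_rem // => /leq_ltn_trans; apply.
  by rewrite ltn_add2l prednK // -has_predT; apply/hasP; exists 0.
pose S' := [seq b + a * t | t <- S].
have : (size (S ++ S') <= size s)%N.
  apply: uniq_leq_size; last by move=> c _; apply: sall.
  rewrite cat_uniq Su map_inj_uniq ?Su ?andbT /=; last first.
    by move=> t t' /addrI /(mulfI a0).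
  apply/hasPn => _ /mapP [t /inS [q ->] ->]; apply/negP => /inS [p hp].
  by apply: nn; exists p, q; rewrite -hp; ring.
by rewrite size_cat size_map leqNgt sS.
Qed.

End QuaternionNorm.

(** * Points of conics over rational fields *)

Lemma frac_ex (R : idomainType) (z : {fraction R}) :
  exists p q : R, q != 0 /\ z = tofrac p / tofrac q.
Proof.
elim/generic_quotient.quotW: z => x; exists (\n_x), (\d_x); split; first exact: denom_ratioP.
apply: (mulIf (x := tofrac \d_x)); first by rewrite tofrac_eq0 denom_ratioP.
rewrite divfK ?tofrac_eq0 ?denom_ratioP //.
rewrite !generic_quotient.piE /=; apply/eqP; rewrite generic_quotient.piE /FracField.equivf /FracField.mulf.
by rewrite !numden_Ratio ?mulr1 ?oner_neq0 ?denom_ratioP // mulrC.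
Qed.

Lemma clear_denominators (F : fieldType) (a p q r t : F) : r != 0 -> t != 0 ->
  (p * t) ^+ 2 - a * (q * r) ^+ 2 = ((p / r) ^+ 2 - a * (q / t) ^+ 2) * (r * t) ^+ 2.
Proof. by move=> r0 t0; field; rewrite r0 t0. Qed.

Section ConicPoint.
Variables (k : fieldType) (a b : k).
Hypothesis a_ns : nonsquare a.

(* The coefficients of [p], [q] and [r] at the largest of their leading
   monomials give the point over [k]. *)
Lemma norm_of_mpoly n (p q r : {mpoly k[n]}) : r != 0 ->
  p ^+ 2 - a *: q ^+ 2 = b *: r ^+ 2 -> is_norm a b.
Proof.
move=> r0 e; pose m := Order.max (mlead p) (Order.max (mlead q) (mlead r)).
have lp : (mlead p <= m)%O by rewrite /m le_max lexx.
have lq : (mlead q <= m)%O by rewrite /m !le_max lexx orbT.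
have lr : (mlead r <= m)%O by rewrite /m !le_max lexx !orbT.
have /(congr1 (fun t => t@_(m + m)%MM)) := e.
(* No leading monomial exceeds m, so the coefficient of a square at m + m is the square of the
   coefficient at m. *)
rewrite mcoeffB !mcoeffZ !expr2 !mleadcMW // -!expr2.
set p0 := p@_m; set q0 := q@_m; set r0' := r@_m => em.
have [rz|rn] := eqVneq r0' 0.
  have [qz|qn] := eqVneq q0 0.
    have pz : p0 = 0.
      by move: em; rewrite rz qz !expr0n !mulr0 subr0 => /eqP; rewrite expf_eq0 => /eqP.
    have nz (t : {mpoly k[n]}) : t != 0 -> mlead t = m -> t@_m = 0 -> False.
      by move=> t0 <- /eqP; rewrite mleadc_eq0 (negPf t0).
    have zero_lt (t : {mpoly k[n]}) : (mlead t <= m)%O -> t@_m = 0 -> t = 0 \/ (mlead t < m)%O.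
      move=> tm tz; have [->|t0] := eqVneq t 0; [by left|right].
      by rewrite lt_neqAle tm andbT; apply/negP => /eqP tm'; apply: nz t0 tm' tz.
    have [rE|rl] := zero_lt r lr rz; first by rewrite rE eqxx in r0.
    (* If all three coefficients at m vanish, the polynomial with leading monomial m is zero. Then m
       is the least monomial, contrary to [mlead r < m]. *)
    have m_pq : m = mlead p \/ m = mlead q \/ m = mlead r.
      by rewrite /m /Order.max; case: ifP => _; [case: ifP => _|]; auto.
    have l0 (t : {mpoly k[n]}) : t = 0 -> mlead t = m -> False.
      move=> -> ; rewrite mlead0 => m0; move: rl; rewrite -m0.
      by rewrite ltNge le0x.
    case: m_pq => [mp|[mq|mr]].
    - have [pE|pl] := zero_lt p lp pz; first by case: (l0 p pE).
      by rewrite -mp ltxx in pl.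
    - have [qE|ql] := zero_lt q lq qz; first by case: (l0 q qE).
      by rewrite -mq ltxx in ql.
    - by rewrite -mr ltxx in rl.
  case/eqP: (a_ns (p0 / q0)); rewrite expr_div_n; apply: (mulIf (expf_neq0 2 qn)).
  rewrite divfK ?expf_neq0 //; apply/eqP; rewrite -subr_eq0 em rz expr0n mulr0 //.
exists (p0 / r0'), (q0 / r0'); apply: (mulIf (expf_neq0 2 rn)); rewrite -em.
by field.
Qed.

Section Function.
Variables (L : fieldType) (i : {rmorphism k -> L}) (M : L -> Prop).
Hypothesis Mgen : forall z, gen M z -> M z.
Hypothesis Mi : forall c, M (i c).

Lemma norm_of_unirational z w : unirational i M -> M z -> M w ->
  z ^+ 2 - i a * w ^+ 2 = i b -> is_norm a b.
Proof.
move=> [n [f [fi fD fM]]] Mz Mw e.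
have MM u v : M u -> M v -> M (u * v) by move=> hu hv; apply/Mgen/genM; apply: gen_in.
have e' : f z ^+ 2 = ratconst n a * f w ^+ 2 + ratconst n b.
  have Mww := MM _ _ Mw Mw; have Maw := MM _ _ (Mi a) Mww.
  rewrite -!fi !expr2 -(fM z z Mz Mz) -(fM w w Mw Mw) -(fM _ _ (Mi a) Mww) -(fD _ _ Maw (Mi b)).
  by rewrite -e; congr f; ring.
have [p [r [r0 zE]]] := frac_ex (f z); have [q [t [t0 wE]]] := frac_ex (f w).
apply: (@norm_of_mpoly n (p * t) (q * r) (r * t)); first by rewrite mulf_neq0.
have F0 u : u != 0 -> tofrac u != 0 :> {fraction {mpoly k[n]}} by rewrite tofrac_eq0.
apply/eqP; rewrite -tofrac_eq -!mul_mpolyC; apply/eqP.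
rewrite !(tofracB, tofracXn, tofracM) clear_denominators ?F0 // -zE -wE e'.
by rewrite /ratconst [X in X - _]addrC addrK.
Qed.

(** The set B in [rational] may be infinite, whereas independence speaks of finite tuples. *)
Lemma adjoin_finite (B : L -> Prop) z : adjoin i B z -> exists s : seq L,
  (forall t, t \in s -> B t) /\ adjoin i (fun t => t \in s) z.
Proof.
have mono (s1 s2 : seq L) u : {subset s1 <= s2} -> adjoin i (fun t => t \in s1) u ->
    adjoin i (fun t => t \in s2) u.
  move=> h; elim=> {u} [c|u hu|u v _ hu _ hv|u v _ hu _ hv].
  - exact: adjoin_base.
  - exact/Defs.adjoin_gen/h.
  - exact: adjoin_sub.
  - exact: adjoin_div.
elim=> {z} [c|z hz|z w _ [s1 [B1 h1]] _ [s2 [B2 h2]]|z w _ [s1 [B1 h1]] _ [s2 [B2 h2]]].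
- by exists [::]; split=> //; apply: adjoin_base.
- exists [:: z]; split=> [t|]; first by rewrite inE => /eqP ->.
  by apply: Defs.adjoin_gen; rewrite inE.
- exists (s1 ++ s2); split=> [t|]; first by rewrite mem_cat => /orP [/B1|/B2].
  by apply: adjoin_sub; [apply: mono h1|apply: mono h2] => t; rewrite mem_cat => ->; rewrite ?orbT.
- exists (s1 ++ s2); split=> [t|]; first by rewrite mem_cat => /orP [/B1|/B2].
  by apply: adjoin_div; [apply: mono h1|apply: mono h2] => t; rewrite mem_cat => ->; rewrite ?orbT.
Qed.

Lemma adjoin_frac n (t : 'I_n -> L) (S : L -> Prop) z : (forall u, S u -> exists j, u = t j) ->
  adjoin i S z -> exists p q : {mpoly k[n]}, mmap i t q != 0 /\ z = mmap i t p / mmap i t q.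
Proof.
move=> St; elim=> {z} [c|z /St [j ->]|z w _ [p [q [q0 ->]]] _ [r [s [s0 ->]]]
  |z w _ [p [q [q0 ->]]] _ [r [s [s0 ->]]]].
- by exists c%:MP, 1; rewrite rmorph1 divr1 mmapC oner_neq0.
- by exists 'X_j, 1; rewrite rmorph1 divr1 mmapX mmap1U oner_neq0.
- exists (p * s - r * q), (q * s); rewrite rmorphB !rmorphM mulf_neq0 //; split=> //.
  by field; rewrite q0 s0.
- have [r0|r0] := eqVneq (mmap i t r) 0.
    by exists 0, 1; rewrite rmorph1 oner_neq0 rmorph0 r0 mul0r invr0 mulr0 mul0r.
  exists (p * s), (q * r); rewrite !rmorphM mulf_neq0 //; split=> //.
  by rewrite invf_div mulf_div.
Qed.

Lemma norm_of_rational z w : rational i M -> M z -> M w ->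
  z ^+ 2 - i a * w ^+ 2 = i b -> is_norm a b.
Proof.
move=> [B [Bind MB]] /MB /adjoin_finite [s1 [B1 h1]] /MB /adjoin_finite [s2 [B2 h2]] e.
pose s := undup (s1 ++ s2); pose t := tnth (in_tuple s).
have tI : injective t.
  move=> j j' ejj; apply: val_inj; apply/eqP.
  rewrite -(nth_uniq z _ _ (undup_uniq (s1 ++ s2))) ?ltn_ord //.
  by rewrite -!(tnth_nth z (in_tuple s)) -/(t j) ejj.
have tB j : B (t j).
  have := mem_tnth j (in_tuple s); rewrite -/(t j) [_ \in _](mem_undup (s1 ++ s2)).
  by rewrite mem_cat => /orP [/B1|/B2].
have St (s' : seq L) u : {subset s' <= s1 ++ s2} -> u \in s' -> exists j, u = t j.
  move=> h /h hu; have us : u \in s by rewrite mem_undup.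
  by have /tnthP [j ->] : u \in in_tuple s by []; exists j.
have sub1 : {subset s1 <= s1 ++ s2} by move=> u hu; rewrite mem_cat hu.
have sub2 : {subset s2 <= s1 ++ s2} by move=> u hu; rewrite mem_cat hu orbT.
have [p [r [r0 zE]]] := adjoin_frac (fun u => St s1 u sub1) h1.
have [q [v [v0 wE]]] := adjoin_frac (fun u => St s2 u sub2) h2.
have nz (u : {mpoly k[_]}) : mmap i t u != 0 -> u != 0 by apply: contraNneq => ->; rewrite rmorph0.
apply: (@norm_of_mpoly _ (p * v) (q * r) (r * v)); first by rewrite mulf_neq0 ?nz.
apply/eqP; rewrite -subr_eq0; apply/eqP/(Bind _ t tI tB).
rewrite -!mul_mpolyC !(rmorphB, rmorphXn, rmorphM) /= !mmapC clear_denominators //.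
by rewrite -zE -wE e subrr.
Qed.

End Function.
End ConicPoint.

(** * Groups of signed permutations *)

Lemma card_imset_same_kernel (A : finType) (B C : finType) (D : {set A}) (f : A -> B) (g : A -> C) :
  {in D &, forall u v, (f u == f v) = (g u == g v)} -> #|f @: D| = #|g @: D|.
Proof.
move=> fg; have [->|[d hd]] := set_0Vmem D; first by rewrite !imset0 !cards0.
pose r y := odflt d [pick u in D | f u == y].
have rP u : u \in D -> (r (f u) \in D) && (f (r (f u)) == f u).
  by move=> hu; rewrite /r; case: pickP => [v //|/(_ u)]; rewrite hu eqxx.
have -> : g @: D = (g \o r) @: (f @: D).
  rewrite -imset_comp; apply: eq_in_imset => u hu /=.
  by apply/eqP; have /andP [h1 h2] := rP u hu; rewrite eq_sym -fg // .
rewrite [RHS]card_in_imset // => _ _ /imsetP [u hu ->] /imsetP [v hv ->] /= /eqP.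
have /andP [u1 /eqP u2] := rP u hu; have /andP [v1 /eqP v2] := rP v hv.
by rewrite -fg // u2 v2 => /eqP.
Qed.

Section Triples.
Variables (k : fieldType) (K : fieldExtType k) (L : fieldType) (iK : {rmorphism K -> L}).
Variables (x y : L) (gT : finGroupType) (G : {group gT}) (to : action G L).
Hypothesis sl : semilinear_action iK x y to.
Let toB := sl_add sl.
Let toMm := sl_mul sl.
Variables H N : {group gT}.
Hypothesis sHG : H \subset G.
Hypothesis memH : forall s, s \in G -> (s \in H <-> forall c, gen (Kb iK) c -> to c s = c).
Hypothesis nNG : (N <| G)%g.
Hypothesis memN : forall s, s \in G -> (s \in N <-> to x s = x /\ to y s = y).
Local Notation Kb := (Kb iK).
Variables X Y : L.
Hypothesis XY : signed_basis iK to X Y.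
Hypothesis XYxy : same_gen x y X Y.

Lemma memN_basis s : s \in G -> (s \in N <-> to X s = X /\ to Y s = Y).
Proof.
move=> hs; rewrite memN //.
have tr u v u' v' : same_gen u v u' v' -> to u s = u /\ to v s = v -> to u' s = u' /\ to v' s = v'.
  move=> h [hu hv]; have [g1 g2] : gen (fun w => w = u \/ w = v) u' /\ gen (fun w => w = u \/ w = v) v'.
    by apply/h; split; apply: gen_in; [left|right].
  by split; [apply: (gen_fix toB toMm hs _ g1) | apply: (gen_fix toB toMm hs _ g2)] => w [] ->.
by split; apply: tr => // Z; split=> /XYxy.
Qed.

Lemma sgn_inj (e e' w w' : bool) :
  sg e (if w then Y else X) = sg e' (if w' then Y else X) -> e = e' /\ w = w'.
Proof.
have [XT YT] := signed_transc sl XY.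
have X0 : X != 0 by rewrite -[X]subr0; apply: transc_neq XT (gen0 _).
have Y0 : Y != 0 by rewrite -[Y]subr0; apply: transc_neq YT (gen0 _).
pose ex (e w : bool) : nat * nat := if w then (1, if e then 0 else 2)%N else (if e then 0 else 2, 1)%N.
have E (f v : bool) : sg f (if v then Y else X) * (X * Y) = X ^+ (ex f v).1 * Y ^+ (ex f v).2.
  by case: f v => [] []; rewrite /sg /ex /=; field; rewrite ?X0 ?Y0.
move=> eq_; have : ex e w = ex e' w' by apply: (monomial_inj XT YT); rewrite -!E eq_.
by case: e w e' w' {eq_} => [] [] [] [].
Qed.

(* [tr s = (w, e1, e2)] when [s] exchanges X and Y (for [w = true]) and inverts
   their images according to [e1], [e2]; [s] acts with order 4 if and only if
   [tr s = (true, e, ~~ e)]. *)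
Lemma triple_exists : exists tr : gT -> bool * bool * bool, [/\
  forall s, s \in G -> sact to X Y s (tr s).1.1 (tr s).1.2 (tr s).2,
  forall s r, s \in G -> r \in G -> tr (s * r)%g =
    ((tr s).1.1 (+) (tr r).1.1, (tr s).1.2 (+) (if (tr s).1.1 then (tr r).2 else (tr r).1.2),
     (tr s).2 (+) (if (tr s).1.1 then (tr r).1.2 else (tr r).2)),
  forall s, s \in G -> (s \in N) = (tr s == (false, false, false)) &
  forall s q, s \in G -> sact to X Y s q.1.1 q.1.2 q.2 -> tr s = q].
Proof.
have /choice [tr trP] : forall s, exists q : bool * bool * bool, s \in G -> sact to X Y s q.1.1 q.1.2 q.2.
  move=> s; have [hs|_] := boolP (s \in G); last by exists (false, false, false).
  by have [w [e1 [e2 h]]] := (proj2 XY) s hs; exists (w, e1, e2).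
have uniq_tr s q : s \in G -> sact to X Y s q.1.1 q.1.2 q.2 -> tr s = q.
  move=> hs [a1 a2]; have [b1 b2] := trP s hs.
  have [h1 h2] : (tr s).1.2 = q.1.2 /\ (tr s).1.1 = q.1.1 by apply: sgn_inj; rewrite -b1 -a1.
  have [h3 _] : (tr s).2 = q.2 /\ ~~ (tr s).1.1 = ~~ q.1.1.
    by apply: sgn_inj; move: b2 a2; case: ((tr s).1.1); case: (q.1.1) => /= <- <-.
  by move: h1 h2 h3; case: (tr s) => [[? ?] ?]; case: q {a1 a2} => [[? ?] ?] /= -> -> ->.
exists tr; split=> // [s r hs hr|s hs].
  apply: uniq_tr; first by rewrite groupM.
  have [f fE] := to_rmorph toB toMm hr; have [a1 a2] := trP s hs; have [b1 b2] := trP r hr.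
  have sgE (e : bool) z : to (sg e z) r = sg e (to z r) by rewrite -!fE; case: e; rewrite //= fmorphV.
  have sg2 (e e' : bool) z : sg e (sg e' z) = sg (e (+) e') z by case: e e' => [] [] //=; rewrite invrK.
  split; rewrite to_comp //= ?a1 ?a2 sgE.
    by case: ((tr s).1.1); rewrite ?b1 ?b2 sg2; case: ((tr r).1.1).
  by case: ((tr s).1.1); rewrite ?b1 ?b2 sg2; case: ((tr r).1.1).
apply/idP/eqP => [/(memN_basis hs) [h1 h2]|e]; first by apply: uniq_tr.
by apply/(memN_basis hs); have [] := trP s hs; rewrite e.
Qed.

End Triples.

Lemma order4_gen (gT : finGroupType) (Q : {group gT}) :
    Q \isog Zp 4 \/ Q \isog [set: 'D_8]%g ->
  exists q, [/\ q \in Q, (q ^+ 4 = 1)%g & (q ^+ 2 != 1)%g].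
Proof.
have order4 (q : gT) : #[q]%g = 4%N -> (q ^+ 4 = 1)%g /\ (q ^+ 2 != 1)%g.
  by move=> oq; rewrite -order_dvdn oq; split=> //; rewrite -oq expg_order.
case=> [iQ|iQ].
  have cQ : cyclic Q.
    by rewrite (isog_cyclic iQ) /= /Zp /=; apply/cyclicP; exists (Zp1 : 'I_4); rewrite Zp_cycle.
  case/cyclicP: cQ => q qE; exists q; rewrite qE cycle_id.
  have [] := order4 q; last by [].
  by rewrite orderE -qE (card_isog iQ) card_Zp.
have [[q r] [_ qQ oq _] _] := generators_2dihedral (isT : 1 < 3)%N iQ.
by exists q; have [] := order4 q oq.
Qed.

Section SignedTriples.
Variables (gT : finGroupType) (G N H : {group gT}) (tr : gT -> bool * bool * bool).
Hypothesis sHG : H \subset G.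
Hypothesis nNG : (N <| G)%g.
Hypothesis HJ : forall h s, h \in H -> s \in G -> (s^-1 * h * s)%g \in H.
Hypothesis trM : forall s r, s \in G -> r \in G -> tr (s * r)%g =
    ((tr s).1.1 (+) (tr r).1.1, (tr s).1.2 (+) (if (tr s).1.1 then (tr r).2 else (tr r).1.2),
     (tr s).2 (+) (if (tr s).1.1 then (tr r).1.2 else (tr r).2)).
Hypothesis trN : forall s, s \in G -> (s \in N) = (tr s == (false, false, false)).

Let tr1 : tr 1%g = (false, false, false).
Proof. by apply/eqP; rewrite -trN // group1. Qed.

Let nN s : s \in G -> s \in 'N(N)%g.
Proof. exact: (subsetP (normal_norm nNG)). Qed.

(** [tr] embeds G / N into the signed permutations of two letters, where orders and generators are
    computed. *)
Lemma coset_triple u v : u \in G -> v \in G -> (coset N u == coset N v) = (tr u == tr v).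
Proof.
move=> hu hv; have -> : (coset N u == coset N v) = ((u * v^-1)%g \in N).
  apply/eqP/idP => [/(rcoset_kercosetP (nN hu) (nN hv))|h]; first by rewrite mem_rcoset.
  by apply/(rcoset_kercosetP (nN hu) (nN hv)); rewrite mem_rcoset.
have trV : tr (v * v^-1)%g = (false, false, false) by rewrite mulgV.
rewrite trN ?groupM ?groupV // trM ?groupV //; move: trV; rewrite trM ?groupV //.
by case: (tr u) (tr v) (tr v^-1%g) => [[[] []] []] [[[] []] []] [[[] []] []].
Qed.

Lemma card_quotient_triple : #|(G / N)%g| = #|tr @: G|.
Proof.
by rewrite -imset_coset; apply: card_imset_same_kernel => u v hu hv; apply: coset_triple.
Qed.

Lemma card_quotient_triple_sub : #|(H * N / N)%g| = #|tr @: H|.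
Proof.
rewrite quotientMidr -imset_coset; apply: card_imset_same_kernel => u v hu hv.
by apply: coset_triple; apply: (subsetP sHG).
Qed.

Lemma rotation_normalize s e : s \in G -> tr s = (true, e, ~~ e) ->
  exists r, r \in G /\ tr r = (true, false, true).
Proof.
move=> hs; case: e => E; last by exists s.
by exists (s * (s * s))%g; rewrite !groupM // !(trM, groupM) // E.
Qed.

Lemma triple_rotation s : s \in G -> (s ^+ 4)%g \in N -> (s ^+ 2)%g \notin N ->
  exists r, r \in G /\ tr r = (true, false, true).
Proof.
move=> hs s4; have s2G := groupX 2 hs.
rewrite trN // expgS expg1 trM // => hr.
by case E : (tr s) hr => [[[] []] []] //= _; apply: rotation_normalize hs E.
Qed.

Section Rotation.
Variable s : gT.
Hypothesis hs : s \in G.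
Hypothesis trs : tr s = (true, false, true).

Lemma triple_rotX2 : tr (s ^+ 2)%g = (false, true, true).
Proof. by rewrite expgS expg1 trM // trs. Qed.
Lemma triple_rotX3 : tr (s ^+ 3)%g = (true, true, false).
Proof. by rewrite expgS trM ?groupX // triple_rotX2 trs. Qed.

Lemma order_rotation : #[coset N s]%g = 4%N.
Proof.
have h2 : (coset N s ^+ 2 != 1)%g.
  rewrite -morphX ?nN // -(morph1 (coset_morphism N)) coset_triple ?groupX //.
  by rewrite triple_rotX2 tr1.
have : (#[coset N s]%g %| 2 ^ 2)%N.
  rewrite order_dvdn -morphX ?nN // -(morph1 (coset_morphism N)) coset_triple ?groupX //.
  by rewrite (expgS s 3) trM ?groupX // triple_rotX3 trs tr1.
case/(dvdn_pfactor _ _ (isT : prime 2)) => -[|[|[|//]]] // _ o.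
  by rewrite -order_dvdn o in h2.
by rewrite -order_dvdn o in h2.
Qed.

(** Determinant 1: the signed permutation (w, e1, e2) has determinant (-1)^(w + e1 + e2). *)
Definition even_triple (q : bool * bool * bool) := ~~ (q.1.1 (+) q.1.2 (+) q.2).

Lemma rotation_cases g : g \in G -> even_triple (tr g) -> exists i, coset N g = (coset N s ^+ i)%g.
Proof.
move=> hg ev; suff [i hi] : exists i, tr g = tr (s ^+ i)%g.
  by exists i; rewrite -morphX ?nN //; apply/eqP; rewrite coset_triple ?groupX // hi.
case: (tr g) ev => [[[] []] []] // _; [by exists 3%N; rewrite triple_rotX3|by exists 1%N| |].
  by exists 2%N; rewrite triple_rotX2.
by exists 0%N; rewrite tr1.
Qed.

Lemma quotient_rotation : (forall g, g \in G -> even_triple (tr g)) -> (G / N)%g = <[coset N s]>%g.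
Proof.
move=> ev; apply/eqP; rewrite eqEsubset cycle_subG mem_quotient // andbT.
apply/subsetP => _ /morphimP [g gN hg ->] /=; have [i ->] := rotation_cases hg (ev _ hg).
exact: mem_cycle.
Qed.

Lemma odd_triple g : g \in G -> ~~ even_triple (tr g) -> exists t, t \in G /\ tr t = (true, false, false).
Proof.
move=> hg; have h2 := triple_rotX2; have h3 := triple_rotX3.
case E : (tr g) => [[[] []] []] // _; last 2 first.
- by exists (g * s ^+ 3)%g; rewrite groupM ?groupX // trM ?groupX // h3 E.
- by exists (g * s)%g; rewrite groupM ?groupX // trM ?groupX // trs E.
- by exists (g * s ^+ 2)%g; rewrite groupM ?groupX // trM ?groupX // h2 E.
- by exists g.
Qed.

Lemma triple_words t q : t \in G -> tr t = (true, false, false) ->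
  exists i j, tr (s ^+ i * t ^+ j)%g = q.
Proof.
move=> ht trt; have h2 := triple_rotX2; have h3 := triple_rotX3.
case: q => [[[] []] []]; [exists 2%N, 1%N|exists 3%N, 0%N|exists 1%N, 0%N|exists 0%N, 1%N|
  exists 2%N, 0%N|exists 3%N, 1%N|exists 1%N, 1%N|exists 0%N, 0%N];
  by rewrite trM ?groupX // ?expg1 ?expg0 ?h2 ?h3 ?trs ?trt ?tr1.
Qed.

Lemma quotient_dihedral t : t \in G -> tr t = (true, false, false) ->
  (G / N)%g = <<[set coset N s; coset N t]>>%g.
Proof.
move=> ht trt; apply/eqP; rewrite eqEsubset gen_subG subUset !sub1set !mem_quotient // !andbT.
apply/subsetP => _ /morphimP [g gN hg ->] /=.
have [i [j e]] := triple_words (tr g) ht trt.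
suff -> : coset N g = (coset N s ^+ i * coset N t ^+ j)%g.
  by rewrite groupM // groupX // mem_gen // !inE eqxx ?orbT.
rewrite -!morphX ?nN // -morphM ?nN ?groupX //; apply/eqP.
by rewrite coset_triple ?groupM ?groupX // e.
Qed.

Lemma card_dihedral_quotient t : t \in G -> tr t = (true, false, false) -> #|(G / N)%g| = 8%N.
Proof.
move=> ht trt; rewrite card_quotient_triple.
have -> : tr @: G = [set: bool * bool * bool].
  apply/setP => q; rewrite inE; have [i [j <-]] := triple_words q ht trt.
  by rewrite imset_f // groupM ?groupX.
by rewrite cardsT !card_prod card_bool.
Qed.

Lemma isog_C4 : (forall g, g \in G -> even_triple (tr g)) -> (G / N)%g \isog Zp 4.
Proof.
move=> /quotient_rotation ->; rewrite isog_sym; have := Zp_isog (coset N s).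
by rewrite order_rotation.
Qed.

Lemma isog_D4 t : t \in G -> tr t = (true, false, false) -> (G / N)%g \isog [set: 'D_8]%g.
Proof.
move=> ht trt; have c8 := card_dihedral_quotient ht trt.
have invol u : u \in G -> tr u != (false, false, false) -> tr (u * u)%g = (false, false, false) ->
    #[coset N u]%g = 2%N.
  move=> hu u1 u2; apply: nt_prime_order => //.
    rewrite -morphX ?nN // -(morph1 (coset_morphism N)); apply/eqP.
    by rewrite coset_triple ?groupX // expgS expg1 u2 tr1.
  by rewrite -(morph1 (coset_morphism N)) coset_triple // tr1.
have stG : (s * t)%g \in G by rewrite groupM.
have trst : tr (s * t)%g = (false, false, true) by rewrite trM // trs trt.
have o1 : #[coset N (s * t)%g]%g = 2%N by apply: invol => //; rewrite ?trst // trM // trst.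
have o2 : #[coset N t]%g = 2%N by apply: invol => //; rewrite ?trt // trM // trt.
have ne : coset N (s * t)%g != coset N t by rewrite coset_triple // trst trt.
have GE : (G / N)%g = <<[set coset N (s * t)%g; coset N t]>>%g.
  rewrite (quotient_dihedral ht trt); apply/eqP; rewrite eqEsubset !gen_subG !subUset !sub1set.
  have h1 (A : {set coset_of N}) : coset N t \in <<A>>%g ->
      (coset N (s * t)%g \in <<A>>%g) = (coset N s \in <<A>>%g).
    by move=> hA; rewrite morphM ?nN // groupMr.
  have tA : coset N t \in <<[set coset N s; coset N t]>>%g by rewrite mem_gen // !inE eqxx orbT.
  have tB : coset N t \in <<[set coset N (s * t)%g; coset N t]>>%g by rewrite mem_gen // !inE eqxx orbT.
  rewrite tB h1 // -(h1 _ tB) tA ![_ \in <<_>>%g]mem_gen // !inE eqxx ?orbT //=.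
by have := involutions_gen_dihedral o1 o2 ne; rewrite /= -GE c8.
Qed.

Lemma isog_exceptional : (G / N)%g \isog Zp 4 \/ (G / N)%g \isog [set: 'D_8]%g.
Proof.
have [h|/existsNP [g /not_implyP [hg /negP g1]]] := pselect (forall g, g \in G -> even_triple (tr g)).
  by left; apply: isog_C4.
by have [t [ht trt]] := odd_triple hg g1; right; apply: isog_D4 trt.
Qed.

Lemma card_sub_scalar h0 : h0 \in H -> tr h0 = (false, true, true) ->
  (forall h, h \in H -> exists e, tr h = (false, e, e)) -> #|(H * N / N)%g| = 2%N.
Proof.
move=> hh0 trh0 hH; rewrite card_quotient_triple_sub.
have -> : tr @: H = [set (false, false, false); (false, true, true)].
  apply/setP => q; rewrite !inE; apply/imsetP/orP => [[h /hH [e he] ->]|[]/eqP ->].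
  - by rewrite he; case: e {he}; [right|left].
  - by exists 1%g; rewrite ?group1 ?tr1.
  - by exists h0.
by rewrite cards2.
Qed.

(** The image of H has order 2 and is stable under conjugation by s. Its nontrivial element
    therefore commutes with the rotation and is an involution, so it is -1. *)
Lemma scalar_sub : #|(H * N / N)%g| = 2%N ->
  (exists2 h0, h0 \in H & tr h0 = (false, true, true)) /\
  (forall h, h \in H -> exists e, tr h = (false, e, e)).
Proof.
rewrite card_quotient_triple_sub => c2.
have H0 : (false, false, false) \in tr @: H by apply/imsetP; exists 1%g; rewrite ?group1 ?tr1.
have [h0 hh0 h0n] : exists2 h0, h0 \in H & tr h0 != (false, false, false).
  have : tr @: H != [set (false, false, false)].
    by apply/eqP => e; rewrite e cards1 in c2.
  rewrite eqEsubset sub1set H0 andbT => /subsetPn [_ /imsetP [h hh ->]].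
  by rewrite inE; exists h.
have HE : [set (false, false, false); tr h0] = tr @: H.
  apply/eqP; rewrite eqEcard c2 cards2 eq_sym h0n andbT subUset !sub1set H0.
  by apply/imsetP; exists h0.
have memE h : h \in H -> tr h = (false, false, false) \/ tr h = tr h0.
  move=> hh; have : tr h \in tr @: H by apply/imsetP; exists h.
  by rewrite -HE !inE => /orP [] /eqP; [left|right].
have h0G := subsetP sHG _ hh0; have jH := HJ hh0 hs; have jG := subsetP sHG _ jH.
have comm : tr (h0 * s)%g = tr (s * (s^-1 * h0 * s))%g by rewrite !mulgA mulgV mul1g.
have trh0 : tr h0 = (false, true, true).
  have h2 := memE _ (groupM hh0 hh0); have j2 := memE _ jH.
  move: h0n comm h2; rewrite (trM h0G hs) (trM hs jG) (trM h0G h0G) trs.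
  by case: j2 => ->; case: (tr h0) => [[[] []] []] //= _ _ [].
split; first by exists h0.
by move=> h /memE []; rewrite ?trh0 => ->; [exists false|exists true].
Qed.

End Rotation.
End SignedTriples.

(** * The conic of an exceptional action *)

Section TwistedAction.
Variables (k : fieldType) (K : fieldExtType k) (L : fieldType) (iK : {rmorphism K -> L}).
Variables (x y : L) (gT : finGroupType) (G : {group gT}) (to : action G L).
Hypothesis sl : semilinear_action iK x y to.
Let toB := sl_add sl.
Let toMm := sl_mul sl.
Hypothesis two : 2%:R != 0 :> k.
Local Notation Kb := (Kb iK).
Variables (a c : k) (d : K) (u w : L).
Hypothesis dd : d ^+ 2 = a%:A.
Hypothesis a_ns : nonsquare a.
Hypothesis c0 : c != 0.
Hypothesis uw_gen : forall z, inv to z -> gen (ext (ext Kb u) w) z.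
Hypothesis uw_act : forall g, g \in G -> exists e : bool,
  [/\ to (iK d) g = (-1) ^+ e * iK d, to u g = sg e u &
      to w g = if e then - iK c%:A / w else w].

Let ik : {rmorphism k -> L} := iK \o in_alg K.

Let ikE (q : k) : iK q%:A = ik q. Proof. by []. Qed.

Let two' : 2%:R != 0 :> L.
Proof. by rewrite -(rmorph_nat ik) fmorph_eq0. Qed.

Let ikc0 : ik c != 0. Proof. by rewrite fmorph_eq0. Qed.

Let transc : ~ cl Kb u /\ ~ cl (ext Kb u) w.
Proof. by apply: (trdeg_two (sl_x sl) (sl_y sl)); apply: (cl_inv sl). Qed.

Let w0 : w != 0.
Proof. by rewrite -[w]subr0; apply: transc_neq (proj2 transc) (gen0 _). Qed.

Let dd' : iK d ^+ 2 = ik a. Proof. by rewrite -ikE -dd rmorphXn. Qed.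

Let d0 : iK d != 0.
Proof.
apply/eqP => e; case/eqP: (a_ns 0); apply: (fmorph_inj ik).
by rewrite -dd' e rmorphXn rmorph0.
Qed.

(* The conic [z^2 - a t^2 = - c] has a point over the fixed field, namely the
   coordinates of [w] with respect to [1, sqrt a]. *)
Let conic_point : exists z t, [/\ inv to z, inv to t & z ^+ 2 - ik a * t ^+ 2 = ik (- c)].
Proof.
have key (C D W T : L) : W != 0 -> D != 0 -> T != 0 ->
    ((W - C / W) / T) ^+ 2 - D ^+ 2 * ((W + C / W) / (T * D)) ^+ 2 = - (2%:R * 2%:R / T ^+ 2) * C.
  by move=> W0 D0 T0; field; rewrite W0 D0 T0.
exists ((w - ik c / w) / 2%:R), ((w + ik c / w) / (2%:R * iK d)).
have cw0 : - ik c / w != 0 by rewrite mulf_neq0 ?oppr_eq0 ?invr_eq0.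
have inv_c (C W : L) : C != 0 -> W != 0 -> C / (- C / W) = - W.
  by move=> C0 W0; field; rewrite ?oppr_eq0 ?W0 ?C0.
split; last first.
  by rewrite -dd' key // -expr2 divff ?expf_neq0 // rmorphN mulN1r.
- move=> g hg; have [f fE] := to_rmorph toB toMm hg; have [e [de _]] := uw_act hg.
  rewrite ikE => we.
  have fw : f w + ik c / f w = (-1) ^+ e * (w + ik c / w).
    by rewrite fE we; case: (e) => //; rewrite ?mul1r // inv_c //; rewrite mulN1r opprD addrC mulNr.
  rewrite -fE (fmorph_div f) (rmorphM f) rmorph_nat (rmorphD f) fmorph_div (fE (ik c)) (sl_k sl) // -/ik.
  rewrite ikE fw fE de; case: (e); rewrite ?expr0 ?expr1 ?mul1r //.
  by rewrite !mulN1r mulrN invrN mulrNN.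
- move=> g hg; have [f fE] := to_rmorph toB toMm hg; have [e [_ _]] := uw_act hg.
  rewrite ikE => we.
  have fw : f w - ik c / f w = w - ik c / w.
    by rewrite fE we; case: (e) => //; rewrite inv_c //; rewrite opprK addrC mulNr.
  rewrite -fE (fmorph_div f)  (rmorph_nat f) (rmorphB f) (fmorph_div f) (fE (ik c)) -{1}ikE (sl_k sl) // -[in RHS]fw ikE //.
Qed.

Lemma norm_of_unirational_twisted :
  unirational (fun q : k => iK q%:A) (inv to) -> is_norm a (- c).
Proof.
have [z [t [zI tI e]]] := conic_point.
move=> h; apply: (@norm_of_unirational _ _ _ a_ns _ ik (inv to) _ _ z t h zI tI e).
  by move=> v hv s hs; apply: (gen_fix toB toMm hs _ hv) => r; apply.
by move=> q s hs; apply: (sl_k sl).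
Qed.

Lemma rational_twistedP : rational (fun q : k => iK q%:A) (inv to) <-> is_norm a (- c).
Proof.
split=> [h|[p [q pq]]].
  have [z [t [zI tI e]]] := conic_point.
  apply: (@norm_of_rational _ _ _ a_ns _ ik (inv to) z t h zI tI e).
have nE : (ik p + ik q * iK d) * (ik p - ik q * iK d) = - ik c.
  rewrite -(rmorphN ik) pq (rmorphB ik) (rmorphXn ik 2 p) (rmorphM ik a) (rmorphXn ik 2 q) -dd'; ring.
have n0 : ik p + ik q * iK d != 0.
  by apply/eqP => e; move/eqP: nE; rewrite e mul0r eq_sym oppr_eq0 (negPf ikc0).
have n0' : ik p - ik q * iK d != 0.
  by apply/eqP => e; move/eqP: nE; rewrite e mulr0 eq_sym oppr_eq0 (negPf ikc0).
pose n := ik p + ik q * iK d; pose w' := w / n.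
have Kn : Kb n by exists (p%:A + q%:A * d); rewrite rmorphD rmorphM.
have w'gen Z : gen (ext (ext Kb Z) w') w.
  rewrite -[w](mulfVK n0) mulrC; apply: genM (gen_extr _ _).
  exact/gen_ext/gen_ext/gen_in.
have w'act g : g \in G -> exists e, to u g = sg e u /\ to w' g = sg e w'.
  move=> hg; have [f fE] := to_rmorph toB toMm hg; have [e [de ue we]] := uw_act hg.
  exists e; split=> //; rewrite /w' -fE (fmorph_div f) /n (rmorphD f) (rmorphM f) !fE !(sl_k sl) // de we !ikE.
  case: (e); rewrite ?expr0 ?expr1 ?mul1r //= mulN1r mulrN invf_div -nE.
  by rewrite (mulrAC _ w^-1) mulfK.
have uw'gen z : gen (ext (ext Kb u) w) z -> gen (ext (ext Kb u) w') z.
  by apply: gen_ext_le (w'gen u) => v hv; apply/gen_ext/gen_in.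
have [uT wT] : ~ cl Kb u /\ ~ cl (ext Kb u) w'.
  by apply: (trdeg_two (sl_x sl) (sl_y sl)); apply: (cl_inv sl) => z /uw_gen /uw'gen.
have aff (Z : L -> Prop) (t : L) : ~ cl Z t -> (forall g, g \in G -> exists e, to t g = sg e t) ->
    affine_over to Z (1 - t)^-1.
  move=> tT ht g hg; have [f fE] := to_rmorph toB toMm hg; have [e te] := ht g hg.
  have t0 : t != 0 by rewrite -[t]subr0; apply: transc_neq tT (gen0 _).
  have t1 : 1 - t != 0 by rewrite -opprB oppr_eq0; apply: transc_neq tT (gen_one _).
  rewrite -fE fmorphV rmorphB rmorph1 fE te; case: e {te} => /=.
    exists (-1), 1; split; [exact/genN/gen_one|exact: gen_one|].
    by field; rewrite t0 t1 -opprB oppr_eq0 t1.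
  by exists 1, 0; split; [exact: gen_one|exact: gen0|ring].
have inv1 (Z : L -> Prop) t : gen (ext Z (1 - t)^-1) t.
  have tE : t = 1 - (1 - t)^-1^-1 by rewrite invrK; ring.
  rewrite [X in gen _ X]tE.
  by apply: gen_sub (gen_one _) (genV (gen_extr _ _)).
apply: (@rational_tower _ _ _ _ _ _ _ _ _ sl (1 - u)^-1 (1 - w')^-1).
- by apply: aff uT _ => g /w'act [e [h _]]; exists e.
- apply: aff => [h|g /w'act [e [_ h]]]; last by exists e.
  apply: wT; apply: cl_mono h => v [hv|->]; first exact/gen_ext/gen_in.
  by apply: genV; apply: gen_sub (gen_one _) (gen_extr _ _).
- move=> v /uw_gen /uw'gen; apply: gen_le => {}v [[hv|->]|->]; last exact: inv1.
    exact/gen_ext/gen_ext/gen_in.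
  exact/gen_ext/inv1.
Qed.

End TwistedAction.

(** * Generators in the exceptional case *)

Section QuadraticSubfields.
Variables (k : fieldType) (K : fieldExtType k) (L : fieldType) (iK : {rmorphism K -> L}).
Variables (x y : L) (gT : finGroupType) (G : {group gT}) (to : action G L).
Hypothesis sl : semilinear_action iK x y to.
Let toB := sl_add sl.
Let toMm := sl_mul sl.
Local Notation Kb := (Kb iK).

Section Kummer.
Variables (H : {group gT}) (chi : gT -> bool).
Hypothesis sHG : H \subset G.
Hypothesis memH : forall s, s \in G -> (s \in H <-> forall c, gen (Kb) c -> to c s = c).
Hypothesis chiM : forall s r, s \in G -> r \in G -> chi (s * r)%g = chi s (+) chi r.
Hypothesis chiH : forall h, h \in H -> chi h = false.

(* A Lagrange resolvent for the character [(-1) ^+ chi]. *)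
Lemma kummer_generator : exists d : K, d != 0 /\
  forall s, s \in G -> to (iK d) s = (-1) ^+ chi s * iK d.
Proof.
have HG h : h \in H -> h \in G by apply: subsetP.
have psiH h s : h \in H -> s \in G -> (-1) ^+ chi (h * s)%g = (-1) ^+ chi s :> L.
  by move=> hh hs; rewrite (chiM (HG _ hh) hs) chiH.
have psi1 : (-1) ^+ chi 1%g != 0 :> L by rewrite signr_eq0.
have [c [hc W0]] := dedekind toB toMm sHG memH psiH psi1.
set W := (\sum_(C in _) _) in W0.
have reprG C : C \in rcosets H G -> repr C \in G.
  case/rcosetsP => s hs ->; case: repr_rcosetP => h hh.
  by rewrite groupM ?(HG _ hh).
have WK : gen Kb W.
  rewrite /W; elim/big_ind: _ => [|a b|C hC]; [exact: gen0|exact: genD|].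
  apply: genM; first by apply/genX/genN/gen_one.
  by apply: (Kb_stable sl) => //; apply: reprG.
have [d dE] := (gen_base iK W).1 WK.
exists d; split; first by apply: contraNneq W0 => d0; rewrite dE d0 rmorph0.
move=> s hs; have [f fE] := to_rmorph toB toMm hs.
pose F r := (-1) ^+ chi r * to c r.
have FH h r : h \in H -> r \in G -> F (h * r)%g = F r.
  by move=> hh hr; rewrite /F psiH // to_comp ?(HG _ hh) // (proj1 (memH (HG _ hh)) hh).
have WE : W = \sum_(C in rcosets H G) F (repr C) by [].
rewrite -dE -fE {1}/W rmorph_sum /= WE -(sum_rcosets_mulr hs FH) mulr_sumr.
apply: eq_bigr => C hC; have hr := reprG C hC.
rewrite (rmorphM f) rmorphXn rmorphN rmorph1 fE /F to_comp // chiM //.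
by case: (chi s); case: (chi (repr C)) => /=; ring.
Qed.

Lemma kummer_square (d : K) : (forall s, s \in G -> to (iK d) s = (-1) ^+ chi s * iK d) ->
  exists a : k, d ^+ 2 = a%:A.
Proof.
move=> hd; apply: (sl_fix sl) => s hs; have [f fE] := to_rmorph toB toMm hs.
rewrite rmorphXn -fE rmorphXn fE hd // exprMn -exprM mulnC exprM sqrrN expr1n.
by rewrite expr1n mul1r.
Qed.

End Kummer.

Hypothesis two : 2%:R != 0 :> L.

Lemma sign_flip (z : L) : z != 0 -> - z != z.
Proof.
move=> z0; rewrite -subr_eq0 -opprD oppr_eq0 -mulr2n -mulr_natl mulf_neq0 //.
Qed.

Lemma kummer_nonsquare (d : K) (a : k) s : s \in G -> d != 0 -> d ^+ 2 = a%:A ->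
  to (iK d) s = - iK d -> nonsquare a.
Proof.
move=> hs d0 da ds c; apply/eqP => ca.
have : (d - c%:A) * (d + c%:A) == 0.
  by rewrite -subr_sqr da -ca -[X in X - _]/(in_alg K (c ^+ 2)) rmorphXn subrr.
have d0' : iK d != 0 by rewrite fmorph_eq0.
rewrite mulf_eq0 subr_eq0 addr_eq0 => /orP [] /eqP dE.
  by move: ds (sign_flip d0') => <-; rewrite dE (sl_k sl) // eqxx.
have [f fE] := to_rmorph toB toMm hs.
move: ds (sign_flip d0') => <-; rewrite dE rmorphN -fE rmorphN fE (sl_k sl) // eqxx //.
Qed.

Section Split.
Variables (chi psi : gT -> bool) (s : gT) (d : L) (B : L -> Prop).
Hypothesis chiM : forall s r, s \in G -> r \in G -> chi (s * r)%g = chi s (+) chi r.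
Hypothesis psiM : forall s r, s \in G -> r \in G -> psi (s * r)%g = psi s (+) psi r.
Hypothesis hs : s \in G.
Hypothesis chis : chi s = true.
Hypothesis psis : psi s = false.
Hypothesis d0 : d != 0.
Hypothesis hd : forall g, g \in G -> psi g = false -> to d g = (-1) ^+ chi g * d.
Hypothesis Bs : stable to B.
Hypothesis Bd : gen B d.

(* Half of Kummer theory: [z] is split into its parts symmetric and
   antisymmetric under [s]. *)
Lemma split_quadratic z : gen B z ->
    (forall g, g \in G -> psi g = false -> chi g = false -> to z g = z) ->
  exists p q, [/\ z = p + q * d, gen B p, gen B q &
    forall g, g \in G -> psi g = false -> to p g = p /\ to q g = q].
Proof.
move=> Bz hz.
have ds : to d s = - d by rewrite hd // chis expr1 mulN1r.
have c1 : chi 1%g = false by have := chiM (group1 G) (group1 G); rewrite mulg1; case: (chi _).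
have p1 : psi 1%g = false by have := psiM (group1 G) (group1 G); rewrite mulg1; case: (psi _).
have cs : chi s^-1%g = true.
  by have := chiM hs (groupVr hs); rewrite mulgV c1 chis; case: (chi _).
have ps : psi s^-1%g = false.
  by have := psiM hs (groupVr hs); rewrite mulgV p1 psis; case: (psi _).
have zs g : g \in G -> psi g = false ->
    to z g = (if chi g then to z s else z) /\ to (to z s) g = if chi g then z else to z s.
  move=> hg pg; rewrite -to_comp //; case E : (chi g).
    split; last by rewrite hz ?groupM // ?psiM ?chiM ?psis ?chis ?E.
    have gE : (g = g * s^-1 * s)%g by rewrite mulgKV.
    rewrite {1}gE to_comp ?groupM ?groupV // (hz (g * s^-1)%g) ?groupM ?groupV //.
      by rewrite psiM ?groupV // pg ps.
    by rewrite chiM ?groupV // E cs.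
  split; first exact: hz.
  have gE : (s * g = s * g * s^-1 * s)%g by rewrite mulgKV.
  rewrite gE to_comp ?groupM ?groupV // (hz (s * g * s^-1)%g) ?groupM ?groupV //.
    by rewrite !psiM ?groupM ?groupV // pg psis ps.
  by rewrite !chiM ?groupM ?groupV // E chis cs.
exists ((z + to z s) / 2%:R), ((z - to z s) / (2%:R * d)); split.
- by field; rewrite d0 two.
- by apply: gen_div (gen_nat _ _); apply: genD => //; apply: Bs.
- by apply: gen_div (genM (gen_nat _ _) Bd); apply: gen_sub => //; apply: Bs.
- move=> g hg pg; have [f fE] := to_rmorph toB toMm hg; have [h1 h2] := zs g hg pg.
  split; rewrite -fE (fmorph_div f).
    by rewrite (rmorph_nat f) (rmorphD f) !fE h1 h2; case: (chi g); rewrite // addrC.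
  rewrite (rmorphB f) (rmorphM f) (rmorph_nat f) !fE h1 h2 hd //; case: (chi g).
    by rewrite expr1 mulN1r mulrN invrN mulrN -mulNr opprB.
  by rewrite expr0 mul1r.
Qed.

End Split.

Lemma split_quadratic_K (chi psi : gT -> bool) s (d c : K) :
    (forall s r, s \in G -> r \in G -> chi (s * r)%g = chi s (+) chi r) ->
    (forall s r, s \in G -> r \in G -> psi (s * r)%g = psi s (+) psi r) ->
    s \in G -> chi s = true -> psi s = false -> d != 0 ->
    (forall g, g \in G -> to (iK d) g = (-1) ^+ chi g * iK d) ->
    (forall g, g \in G -> psi g = false -> chi g = false -> to (iK c) g = iK c) ->
  exists p q, c = p + q * d /\
    forall g, g \in G -> psi g = false -> to (iK p) g = iK p /\ to (iK q) g = iK q.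
Proof.
move=> chiM psiM hs cs ps d0 hd hc; have inK (e : K) : gen Kb (iK e) by apply: gen_in; exists e.
have d0' : iK d != 0 by rewrite fmorph_eq0.
have [p [q [E pK qK pq]]] := split_quadratic chiM psiM hs cs ps d0'
  (fun g hg _ => hd g hg) (Kb_stable sl) (inK d) (inK c) hc.
have [p' pE] := (gen_base iK p).1 pK; have [q' qE] := (gen_base iK q).1 qK.
exists p', q'; split; last by rewrite -pE -qE.
by apply: (fmorph_inj iK); rewrite E pE qE rmorphD rmorphM.
Qed.

Lemma gen_Fadjoin (E : {subfield K}) (B : L -> Prop) d :
  (forall c, c \in E -> gen B (iK c)) ->
  forall c, c \in <<E; d>>%VS -> gen (ext B (iK d)) (iK c).
Proof.
move=> hE c /Fadjoin_polyP [p pE ->]; rewrite horner_coef rmorph_sum.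
apply: gen_sum => i /=; rewrite rmorphM rmorphXn; apply: genM.
  by apply/gen_ext/hE/(polyOverP pE).
exact/genX/gen_extr.
Qed.

Lemma gen_Fadjoin1 d c : c \in <<1; d>>%VS -> gen (ext (kb iK) (iK d)) (iK c).
Proof.
apply: (gen_Fadjoin (E := 1%AS)) => e /vlineP [r ->]; apply: gen_in.
by exists r.
Qed.

Lemma adjoin_degree2 (E : {subfield K}) d : d \notin E -> d ^+ 2 \in E -> adjoin_degree E d = 2%N.
Proof.
move=> dE d2; apply/eqP; rewrite eqn_leq; apply/andP; split; last first.
  by move: (adjoin_deg_eq1 E d); rewrite (negPf dE) /adjoin_degree; case: (_.-1).
rewrite -ltnS -size_minPoly.
have n0 : 'X^2 - (d ^+ 2)%:P != 0 :> {poly K} by rewrite -size_poly_gt0 size_XnsubC.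
rewrite -(size_XnsubC (d ^+ 2) (isT : 0 < 2)%N); apply: dvdp_leq => //.
apply: minPoly_dvdp; first by rewrite rpredB ?rpredX ?polyOverX ?polyOverC.
by rewrite /root !hornerE subrr.
Qed.

End QuadraticSubfields.

(* If X = tanh p and Y = tanh q, then [u] and [v] are tanh (p + q) and
   tanh (p - q).  Inverting X and Y shifts p and q by i pi / 2, which leaves
   [u] and [v] unchanged. *)
Section TanhAddition.
Variables (F : fieldType) (X Y : F).
Hypotheses (h1 : 1 + X * Y != 0) (h2 : 1 - X * Y != 0).
Let u := (X + Y) / (1 + X * Y).
Let v := (X - Y) / (1 - X * Y).

(** (u + v) / (1 + u v) is tanh (2 p) = 2 X / (1 + X^2); so X + 1 / X is rational in u, v. *)
Lemma tanh_quadratic : 2%:R != 0 :> F -> X != 0 -> 1 - Y ^+ 2 != 0 ->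
  X ^+ 2 = 2%:R * (1 + u * v) / (u + v) * X + - 1.
Proof.
move=> two X0 Y1.
have -> : 1 + u * v = (1 + X ^+ 2) * (1 - Y ^+ 2) / ((1 + X * Y) * (1 - X * Y)).
  by rewrite /u /v; field; rewrite h1 h2.
have -> : u + v = 2%:R * X * (1 - Y ^+ 2) / ((1 + X * Y) * (1 - X * Y)).
  by rewrite /u /v; field; rewrite h1 h2.
by field; rewrite two X0 Y1 h1 h2.
Qed.

Lemma tanh_inverse : 1 - X ^+ 2 != 0 -> Y = (u - X) / (1 - u * X).
Proof.
move=> X1.
have -> : u - X = Y * (1 - X ^+ 2) / (1 + X * Y) by rewrite /u; field; rewrite h1.
have -> : 1 - u * X = (1 - X ^+ 2) / (1 + X * Y) by rewrite /u; field; rewrite h1.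
by field; rewrite X1 h1.
Qed.

End TanhAddition.

(** * The coordinates u, v and the square roots in K *)

Section ExceptionalData.
Variables (k : fieldType) (K : fieldExtType k) (L : fieldType) (iK : {rmorphism K -> L}).
Variables (x y : L) (gT : finGroupType) (G : {group gT}) (to : action G L).
Hypothesis sl : semilinear_action iK x y to.
Let toB := sl_add sl.
Let toMm := sl_mul sl.
Variables H N : {group gT}.
Hypothesis sHG : H \subset G.
Hypothesis memH : forall s, s \in G -> (s \in H <-> forall c, gen (Kb iK) c -> to c s = c).
Hypothesis nNG : (N <| G)%g.
Hypothesis two : 2%:R != 0 :> L.
Local Notation Kb := (Kb iK).
Local Notation kb := (kb iK).
Variables X Y : L.
Hypothesis XY : signed_basis iK to X Y.
Hypothesis XYxy : same_gen x y X Y.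
Variable tr : gT -> bool * bool * bool.
Hypothesis trP : forall s, s \in G -> sact to X Y s (tr s).1.1 (tr s).1.2 (tr s).2.
Hypothesis trM : forall s r, s \in G -> r \in G -> tr (s * r)%g =
    ((tr s).1.1 (+) (tr r).1.1, (tr s).1.2 (+) (if (tr s).1.1 then (tr r).2 else (tr r).1.2),
     (tr s).2 (+) (if (tr s).1.1 then (tr r).1.2 else (tr r).2)).
Hypothesis trN : forall s, s \in G -> (s \in N) = (tr s == (false, false, false)).
Variable h0 : gT.
Hypothesis hh0 : h0 \in H.
Hypothesis trh0 : tr h0 = (false, true, true).
Hypothesis scal : forall h, h \in H -> exists e, tr h = (false, e, e).

Definition coord_u := (X + Y) / (1 + X * Y).
Definition coord_v := (X - Y) / (1 - X * Y).
Local Notation u := coord_u.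
Local Notation v := coord_v.

Let HG h : h \in H -> h \in G. Proof. exact: subsetP. Qed.
Let NG n : n \in N -> n \in G. Proof. exact: (subsetP (normal_sub nNG)). Qed.

Let XT : ~ cl Kb X. Proof. by case: (signed_transc sl XY). Qed.
Let YT : ~ cl (ext Kb X) Y. Proof. by case: (signed_transc sl XY). Qed.

Let nzX c : gen Kb c -> X - c != 0. Proof. exact: transc_neq XT. Qed.
Let nzY c : gen (ext Kb X) c -> Y - c != 0. Proof. exact: transc_neq YT. Qed.

Let X0 : X != 0. Proof. by rewrite -[X]subr0; apply: nzX (gen0 _). Qed.
Let genXV : gen (ext Kb X) X^-1. Proof. exact/genV/gen_extr. Qed.
Let Xp : 1 + X * Y != 0.
Proof.
have -> : 1 + X * Y = X * (Y - - X^-1) by field.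
by rewrite mulf_neq0 //; apply: nzY (genN genXV).
Qed.
Let Xm : 1 - X * Y != 0.
Proof.
have -> : 1 - X * Y = - X * (Y - X^-1) by field.
by rewrite mulf_neq0 ?oppr_eq0 //; apply: nzY genXV.
Qed.
Let XpY : X + Y != 0.
Proof. by rewrite addrC -[X]opprK; apply: nzY (genN (gen_extr _ _)). Qed.
Let XmY : X - Y != 0.
Proof. by rewrite -opprB oppr_eq0; apply: nzY (gen_extr _ _). Qed.
Let X1 : 1 - X ^+ 2 != 0.
Proof.
have -> : 1 - X ^+ 2 = - ((X - 1) * (X - - 1)) by ring.
by rewrite oppr_eq0 mulf_neq0 //; apply: nzX; [apply: gen_one|apply/genN/gen_one].
Qed.
Let Y1 : 1 - Y ^+ 2 != 0.
Proof.
have -> : 1 - Y ^+ 2 = - ((Y - 1) * (Y - - 1)) by ring.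
by rewrite oppr_eq0 mulf_neq0 //; apply: nzY; [apply: gen_one|apply/genN/gen_one].
Qed.
Let Y0 : Y != 0. Proof. by rewrite -[Y]subr0; apply: nzY (gen0 _). Qed.

Lemma coord_rotation s : s \in G -> tr s = (true, false, true) -> to u s = u^-1 /\ to v s = - v^-1.
Proof.
move=> hs trs; have [f fE] := to_rmorph toB toMm hs; have := trP hs; rewrite trs => -[/= a1 a2].
rewrite -!fE /u /v !(fmorph_div f) (rmorphB f 1) !(rmorphD f) (rmorphN f) !(rmorphM f) rmorph1 !fE a1 a2.
by split; field; rewrite ?X0 ?Y0 ?Xp ?Xm ?XpY ?XmY.
Qed.

Lemma coord_reflection t : t \in G -> tr t = (true, false, false) -> to u t = u /\ to v t = - v.
Proof.
move=> ht trt; have [f fE] := to_rmorph toB toMm ht; have := trP ht; rewrite trt => -[/= a1 a2].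
rewrite -!fE /u /v !(fmorph_div f) (rmorphB f 1) !(rmorphD f) (rmorphN f) !(rmorphM f) rmorph1 !fE a1 a2.
have e : 1 + - (Y * X) != 0 by rewrite mulrC.
by split; field; rewrite ?[Y * X]mulrC ?Xp ?Xm.
Qed.

Lemma coord_scalar h e : h \in G -> tr h = (false, e, e) -> to u h = u /\ to v h = v.
Proof.
move=> hh trh; have [f fE] := to_rmorph toB toMm hh; have := trP hh; rewrite trh => -[/= a1 a2].
rewrite -!fE /u /v !(fmorph_div f) (rmorphB f 1) !(rmorphD f) (rmorphN f) !(rmorphM f) rmorph1 !fE a1 a2.
case: e {trh a1 a2} => //=.
have e1 : X * Y + 1 != 0 by rewrite addrC.
have e2 : X * Y - 1 != 0 by rewrite -opprB oppr_eq0.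
by split; field; rewrite ?X0 ?Y0 ?Xp ?Xm ?e1 ?e2.
Qed.

(** Over B(u, v) the element X is quadratic with conjugate 1 / X, its image under h0, and it
    generates Y. Both B = k and B = K are needed. *)
Lemma coord_fixed (B : L -> Prop) z : (forall w, B w -> to w h0 = w) ->
  gen (ext (ext B X) Y) z -> to z h0 = z -> gen (ext (ext B u) v) z.
Proof.
move=> hB hz zh; have h0G := HG hh0; have [uh vh] := coord_scalar h0G trh0.
have gu : gen (ext (ext B u) v) u by apply/gen_ext/gen_extr.
have gv : gen (ext (ext B u) v) v by apply: gen_extr.
apply: (fixed_in_quadratic toB toMm (t := X) h0G _ _ _ (tanh_quadratic Xp Xm two X0 Y1) _ _ zh).
- by move=> w [[/hB|->]|->].
- apply: gen_div; last exact: genD.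
  by apply: genM (gen_nat _ _) _; apply: genD (gen_one _) (genM gu gv).
- exact/genN/gen_one.
- have := trP h0G; rewrite trh0 => -[/= -> _]; rewrite -subr_eq0.
  have -> : X^-1 - X = (1 - X ^+ 2) / X by field.
  by rewrite mulf_neq0 ?invr_eq0.
- apply: gen_le hz => w [[hw|->]|->]; [exact/gen_ext/gen_ext/gen_ext/gen_in|exact: gen_extr|].
  rewrite [X in gen _ X](tanh_inverse Xp X1).
  have gX := gen_extr (ext (ext B u) v) X.
  have gu' := gen_ext X gu.
  by apply: gen_div; [apply: gen_sub gu' gX | apply: gen_sub (gen_one _) (genM gu' gX)].
Qed.

Lemma coord_gen_K z : gen (ext (ext Kb u) v) z <-> forall h, h \in H -> to z h = z.
Proof.
split=> [hz h hh|hz].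
  have hG := HG hh; have [e he] := scal hh; have [h1 h2] := coord_scalar hG he.
  apply: (gen_fix toB toMm hG _ hz) => w [[hw|->]|->] //.
  by apply: (proj1 (memH hG) hh); apply: gen_in.
apply: coord_fixed (proj1 XY z) (hz _ hh0) => w hw.
by apply: (proj1 (memH (HG hh0)) hh0); apply: gen_in.
Qed.

Let gen_same (B : L -> Prop) u1 v1 u2 v2 z : same_gen u1 v1 u2 v2 ->
  gen (ext (ext B u1) v1) z -> gen (ext (ext B u2) v2) z.
Proof.
move=> h; apply: gen_le => w; have [h1 h2] : gen (ext (ext B u2) v2) u1 /\ gen (ext (ext B u2) v2) v1.
  by apply/h; split; [apply/gen_ext/gen_extr|apply: gen_extr].
by move=> [[hw|->]|->] //; apply/gen_ext/gen_ext/gen_in.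
Qed.

Lemma coord_gen_k z : gen (ext (ext kb u) v) z <->
  gen (ext (ext kb x) y) z /\ forall s, s \in (H * N)%g -> to z s = z.
Proof.
have kbG w g : g \in G -> kb w -> to w g = w by move=> hg [c ->]; apply: (sl_k sl).
split=> [hz|[hz hzs]]; last first.
  apply: coord_fixed; first by move=> w; apply/kbG/HG.
    exact: gen_same XYxy hz.
  by apply: hzs; rewrite -[h0]mulg1 mem_mulg.
split.
  have YXxy : same_gen X Y x y by move=> Z; split=> /XYxy.
  have gX : gen (ext (ext kb X) Y) X by apply/gen_ext/gen_extr.
  have gY : gen (ext (ext kb X) Y) Y by apply: gen_extr.
  apply: (gen_same YXxy); apply: gen_le hz => w [[hw|->]|->]; first exact/gen_ext/gen_ext/gen_in.
    by apply: gen_div; [apply: genD gX gY|apply: genD (gen_one _) (genM gX gY)].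
  by apply: gen_div; [apply: gen_sub gX gY|apply: gen_sub (gen_one _) (genM gX gY)].
move=> s /mulsgP [h n hh hn ->]; have hG := HG hh; have nG := NG hn.
have [e he] := scal hh; have [h1 h2] := coord_scalar hG he.
have hn0 : tr n = (false, false, false) by apply/eqP; rewrite -trN.
have [n1 n2] := coord_scalar nG hn0.
rewrite to_comp //.
have -> : to z h = z by apply: (gen_fix toB toMm hG _ hz) => w [[hw|->]|->] //; apply: kbG.
by apply: (gen_fix toB toMm nG _ hz) => w [[hw|->]|->] //; apply: kbG.
Qed.

(** Two characters of the group of signed permutations, [chib] being the determinant. Their common
    kernel is {1, -1}, the image of H. Their Lagrange resolvents in K are sqrt a and sqrt b. *)
Let chia g := (tr g).1.2 (+) (tr g).2.
Let chib g := ~~ even_triple (tr g).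

Let chiaM s r : s \in G -> r \in G -> chia (s * r)%g = chia s (+) chia r.
Proof. by move=> hs hr; rewrite /chia trM //; case: (tr s) (tr r) => [[[] []] []] [[[] []] []]. Qed.
Let chibM s r : s \in G -> r \in G -> chib (s * r)%g = chib s (+) chib r.
Proof.
by move=> hs hr; rewrite /chib /even_triple trM //; case: (tr s) (tr r) => [[[] []] []] [[[] []] []].
Qed.
Let chiaH h : h \in H -> chia h = false.
Proof. by move=> hh; have [e] := scal hh; rewrite /chia => -> /=; rewrite addbb. Qed.
Let chibH h : h \in H -> chib h = false.
Proof. by move=> hh; have [e] := scal hh; rewrite /chib /even_triple => -> /=; rewrite addbb. Qed.

Let fixed_HN c g : g \in G -> (forall n, n \in N -> to (iK c) n = iK c) ->
  chia g = false -> chib g = false -> to (iK c) g = iK c.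
Proof.
move=> hg hc a b.
have same r : r \in H -> tr g = tr r -> to (iK c) g = iK c.
  move=> hr e; have rG := HG hr.
  have gE : (g = g * r^-1 * r)%g by rewrite mulgKV.
  have : coset N g == coset N r by rewrite (coset_triple nNG trM trN) // e.
  move/eqP/(rcoset_kercosetP (subsetP (normal_norm nNG) _ hg) (subsetP (normal_norm nNG) _ rG)).
  rewrite mem_rcoset => hn; rewrite gE to_comp ?groupM ?groupV // hc //.
  by apply: (proj1 (memH rG) hr); apply: gen_in; exists c.
move: a b; rewrite /chia /chib /even_triple; case E : (tr g) => [[[] []] []] // _ _.
  by apply: (same h0); rewrite ?E ?trh0.
by apply: (same 1%g); rewrite ?group1 // E; apply/esym/eqP; rewrite -trN ?group1.
Qed.

Let chiN n : n \in N -> chia n = false /\ chib n = false.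
Proof. by move=> hn; have := trN (NG hn); rewrite hn /chia /chib => /esym/eqP ->. Qed.

Variable s : gT.
Hypothesis hs : s \in G.
Hypothesis trs : tr s = (true, false, true).

Lemma C4_field : (forall g, g \in G -> even_triple (tr g)) ->
  exists (a : k) (sa : K), [/\ nonsquare a, sa ^+ 2 = a%:A, to (iK sa) s = - iK sa &
    forall c : K, (forall n, n \in N -> to (iK c) n = iK c) <-> c \in <<1; sa>>%VS].
Proof.
move=> ev; have [sa [sa0 saE]] := kummer_generator sl sHG memH chiaM chiaH.
have [a aE] := kummer_square sl saE.
have sas : to (iK sa) s = - iK sa by rewrite saE // /chia trs expr1 mulN1r.
exists a, sa; split=> //; first exact: (kummer_nonsquare sl two hs sa0 aE sas).
move=> c; split=> [hc|/(gen_Fadjoin1 iK) hc n hn].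
  have ca : chia s by rewrite /chia trs.
  have cb g : g \in G -> chib g = false by move=> hg; rewrite /chib ev.
  (* With [psi] constantly false both parts are fixed by all of G, hence lie in k. *)
  have [p [q [cE pq]]] := split_quadratic_K sl two (psi := fun=> false) chiaM (fun _ _ _ _ => erefl false) hs ca erefl
    sa0 saE (fun g hg _ a => fixed_HN hg hc a (cb g hg)).
  have inI : inv to (iK p) /\ inv to (iK q) by split=> g hg; have [] := pq g hg erefl.
  have [[p' pE] [q' qE]] : (exists p' : k, p = p'%:A) /\ exists q' : k, q = q'%:A.
    by case: inI => /(sl_fix sl) ? /(sl_fix sl) ?.
  by rewrite cE pE qE mulr_algl rpredD // memvZ ?mem1v ?memv_adjoin.
have nG := NG hn; apply: (gen_fix toB toMm nG _ hc) => w [[e ->]|->]; first exact: (sl_k sl).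
by rewrite saE // (proj1 (chiN hn)) mul1r.
Qed.

Lemma D4_field t : t \in G -> tr t = (true, false, false) ->
  exists (a b : k) (sa sb : K), [/\ nonsquare a /\ nonsquare b, sa ^+ 2 = a%:A /\ sb ^+ 2 = b%:A,
    [/\ to (iK sa) s = - iK sa, to (iK sb) s = iK sb, to (iK sa) t = iK sa & to (iK sb) t = - iK sb],
    \dim <<<<1; sa>>; sb>>%VS = 4%N &
    forall c : K, (forall n, n \in N -> to (iK c) n = iK c) <-> c \in <<<<1; sa>>; sb>>%VS].
Proof.
move=> ht trt; have [sa [sa0 saE]] := kummer_generator sl sHG memH chiaM chiaH.
have [sb [sb0 sbE]] := kummer_generator sl sHG memH chibM chibH.
have [a aE] := kummer_square sl saE; have [b bE] := kummer_square sl sbE.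
have cas : chia s = true by rewrite /chia trs.
have cbs : chib s = false by rewrite /chib /even_triple trs.
have cat : chia t = false by rewrite /chia trt.
have cbt : chib t = true by rewrite /chib /even_triple trt.
have sas : to (iK sa) s = - iK sa by rewrite saE // cas mulN1r.
have sbt : to (iK sb) t = - iK sb by rewrite sbE // cbt mulN1r.
have sat : to (iK sa) t = iK sa by rewrite saE // cat mul1r.
have sbs : to (iK sb) s = iK sb by rewrite sbE // cbs mul1r.
have a_ns := kummer_nonsquare sl two hs sa0 aE sas.
exists a, b, sa, sb; split=> //.
- by split=> //; apply: (kummer_nonsquare sl two ht sb0 bE sbt).
- have sa1 : sa \notin 1%VS.
    apply/negP => /vlineP [e saE']; move: (a_ns e); rewrite -(inj_eq (fmorph_inj (in_alg K))) /=.
    by rewrite -[in X in _ == X]/(in_alg K a) /= -aE saE' -[X in X == _]/(in_alg K (e ^+ 2)) rmorphXn eqxx.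
  have sbn : sb \notin <<1; sa>>%VS.
    apply/negP => /(gen_Fadjoin1 iK) h; have := sign_flip two (z := iK sb).
    rewrite fmorph_eq0 => /(_ sb0) /eqP; apply; rewrite -sbt.
    by apply: (gen_fix toB toMm ht _ h) => w [[e ->]|->] //; apply: (sl_k sl).
  have inE1 (E : {subfield K}) (e : k) : e%:A \in E by rewrite memvZ ?mem1v.
  rewrite dim_Fadjoin (adjoin_degree2 sbn) ?bE ?inE1 // dim_Fadjoin.
  by rewrite (adjoin_degree2 (E := 1%AS) sa1) ?aE ?inE1 // dimv1.
- move=> c; split=> [hc|hc n hn].
    (* First the splitting along sqrt b, with parts fixed by the kernel of [chia]; each part then
       splits along sqrt a over k. *)
    have [c1 [c2 [cE c12]]] := split_quadratic_K sl two chibM chiaM ht cbt cat sb0 sbE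
      (fun g hg ha hb => fixed_HN hg hc ha hb).
    have inE0 c' : (forall g, g \in G -> chia g = false -> to (iK c') g = iK c') -> c' \in <<1; sa>>%VS.
      move=> hc'; have [p [q [c'E pq]]] := split_quadratic_K sl two (psi := fun=> false) chiaM (fun _ _ _ _ => erefl false) hs cas
        erefl sa0 saE (fun g hg _ ha => hc' g hg ha).
      have inI : inv to (iK p) /\ inv to (iK q) by split=> g hg; have [] := pq g hg erefl.
      have [[p' pE] [q' qE]] : (exists p' : k, p = p'%:A) /\ exists q' : k, q = q'%:A.
        by case: inI => /(sl_fix sl) ? /(sl_fix sl) ?.
      rewrite c'E pE qE mulr_algl rpredD // memvZ ?mem1v ?memv_adjoin //.
    have i1 : c1 \in <<1; sa>>%VS by apply: inE0 => g hg ha; have [] := c12 g hg ha.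
    have i2 : c2 \in <<1; sa>>%VS by apply: inE0 => g hg ha; have [] := c12 g hg ha.
    have up : (<<1; sa>> <= <<<<1; sa>>; sb>>)%VS by apply: subv_adjoin.
    by rewrite cE rpredD ?rpredM ?memv_adjoin // (subvP up).
  have h : gen (ext (ext kb (iK sa)) (iK sb)) (iK c).
    by apply: (gen_Fadjoin _ hc) => e; apply: gen_Fadjoin1.
  have nG := NG hn; have [na nb] := chiN hn.
  apply: (gen_fix toB toMm nG _ h) => w [[[e ->]|->]|->]; first exact: (sl_k sl).
    by rewrite saE // na mul1r.
  by rewrite sbE // nb mul1r.
Qed.

End ExceptionalData.

(** A multiplicative property that holds on N need only be checked on generators of G / N; it serves
    to extend [twisted] to G. *)
Lemma quotient_ind (gT : finGroupType) (G N : {group gT}) (S : {set gT}) (P : gT -> Prop) :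
    (N <| G)%g -> S \subset G -> (G / N = <<coset N @: S>>)%g ->
    (forall n, n \in N -> P n) -> (forall s, s \in S -> P s) ->
    (forall g h, g \in G -> h \in G -> P g -> P h -> P (g * h)%g) ->
  forall g, g \in G -> P g.
Proof.
move=> nNG sSG GS PN PS PM; pose M := [set g in G | `[< P g >]].
have Mg : group_set M.
  apply/group_setP; split=> [|g h]; first by rewrite inE group1; apply/asboolP/PN/group1.
  by rewrite !inE => /andP [hg /asboolP Pg] /andP [hh /asboolP Ph]; rewrite groupM //; apply/asboolP/PM.
have NM : N \subset Group Mg.
  apply/subsetP => n hn; rewrite /= inE (subsetP (normal_sub nNG)) //; exact/asboolP/PN.
have : G \subset Group Mg.
  rewrite -(quotientSGK (normal_norm nNG) NM) GS gen_subG; apply/subsetP => _ /imsetP [s hs ->].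
  by apply: mem_quotient; rewrite inE (subsetP sSG) //; apply/asboolP/PS.
by move=> /subsetP GM g /GM; rewrite inE => /andP [_ /asboolP].
Qed.

Section Assembly.
Variables (k : fieldType) (K : fieldExtType k) (L : fieldType) (iK : {rmorphism K -> L}).
Variables (x y : L) (gT : finGroupType) (G : {group gT}) (to : action G L).
Hypothesis sl : semilinear_action iK x y to.
Let toB := sl_add sl.
Let toMm := sl_mul sl.
Local Notation Kb := (Kb iK).
Local Notation kb := (kb iK).

Section Twist.
Variables (c : k) (d : K) (u w : L).

Definition twisted g := exists e : bool,
  [/\ to (iK d) g = (-1) ^+ e * iK d, to u g = sg e u &
      to w g = if e then - iK c%:A / w else w].

Lemma twistedM g h : c != 0 -> g \in G -> h \in G -> twisted g -> twisted h -> twisted (g * h)%g.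
Proof.
move=> c0 hg hh [e [a1 a2 a3]] [e' [b1 b2 b3]].
have [f fE] := to_rmorph toB toMm hh; exists (e (+) e').
have C0 : iK c%:A != 0 by rewrite fmorph_eq0 scaler_eq0 oner_eq0 orbF.
have fc : f (iK c%:A) = iK c%:A by rewrite fE (sl_k sl).
split; rewrite to_comp // ?a1 ?a2 ?a3.
- rewrite -fE rmorphM rmorphXn rmorphN rmorph1 fE b1.
  by case: e e' {a1 a2 a3 b1 b2 b3} => [] []; rewrite /= ?expr0 ?expr1; ring.
- by rewrite -fE; case: e {a1 a2 a3} => /=; rewrite ?fmorphV fE b2; case: (e') => //=; rewrite invrK.
- rewrite -fE; case: e {a1 a2 a3} => /=; last by rewrite fE b3.
  rewrite (fmorph_div f) (rmorphN f) fc fE b3; case: (e') => //=.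
  by rewrite invfM invrK mulrA divff ?oppr_eq0 ?mul1r.
Qed.

End Twist.

Variables H N : {group gT}.
Hypothesis sHG : H \subset G.
Hypothesis memH : forall s, s \in G -> (s \in H <-> forall c, gen (Kb) c -> to c s = c).
Hypothesis nNG : (N <| G)%g.
Hypothesis memN : forall s, s \in G -> (s \in N <-> to x s = x /\ to y s = y).
Hypothesis monomial : forall s, s \in G -> exists M : 'M[int]_2,
  to x s = mon x y (M 0 0, M 1 0) /\ to y s = mon x y (M 0 1, M 1 1).
Hypothesis two : 2%:R != 0 :> L.

Definition exceptional_triples X Y (tr : gT -> bool * bool * bool) s h0 :=
  [/\ signed_basis iK to X Y /\ same_gen x y X Y,
    [/\ forall s, s \in G -> sact to X Y s (tr s).1.1 (tr s).1.2 (tr s).2,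
        forall s r, s \in G -> r \in G -> tr (s * r)%g =
          ((tr s).1.1 (+) (tr r).1.1, (tr s).1.2 (+) (if (tr s).1.1 then (tr r).2 else (tr r).1.2),
           (tr s).2 (+) (if (tr s).1.1 then (tr r).1.2 else (tr r).2))
      & forall s, s \in G -> (s \in N) = (tr s == (false, false, false))],
    s \in G /\ tr s = (true, false, true), h0 \in H /\ tr h0 = (false, true, true)
  & forall h, h \in H -> exists e, tr h = (false, e, e)].

Lemma triples_of_exceptional X Y : signed_basis iK to X Y -> same_gen x y X Y ->
  exceptional to H X Y -> exists tr s h0, exceptional_triples X Y tr s h0.
Proof.
move=> XY XYxy [[s [e [hs se]]] [h0 [hh0 h0e]] scal].
have HG h : h \in H -> h \in G by apply: subsetP.
have [tr [trP trM trN trU]] := triple_exists sl memN XY XYxy.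
have [r [hr trr]] : exists r, r \in G /\ tr r = (true, false, true).
  by apply: (rotation_normalize trM hs (e := e)); apply: trU.
exists tr, r, h0; split=> //.
  by split=> //; apply: trU => //; apply: HG.
by move=> h hh; have [e' he] := scal h hh; exists e'; apply: trU => //; apply: HG.
Qed.

(** The group structure alone yields the data: an element of order 4 in G / N excludes a hexagonal
    basis, and order 2 forces the image of H to be {1, -1}. *)
Lemma triples_of_isog :
    (G / N)%g \isog Zp 4 \/ (G / N)%g \isog [set: 'D_8]%g -> #|(H * N / N)%g| = 2%N ->
  exists X Y tr s h0, exceptional_triples X Y tr s h0.
Proof.
move=> iso c2; have [q [hq q4 q2]] := order4_gen (Q := (G / N)%G) iso.
case/morphimP: hq q4 q2 => s sN hs -> /=; rewrite -!morphX // => q4 q2.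
have nN g : g \in G -> g \in 'N(N)%g by apply/subsetP/normal_norm.
have s4 : (s ^+ 4)%g \in N by apply: coset_idr q4; apply/nN/groupX.
have s2 : (s ^+ 2)%g \notin N by apply: contra q2 => h; rewrite /= coset_id.
have /(memN (groupX 4 hs)) [x4 y4] := s4.
have n2 : ~ (to x (s ^+ 2)%g = x /\ to y (s ^+ 2)%g = y).
  by move/(memN (groupX 2 hs)); apply/negP.
have [X [Y [XY XYxy]]] := signed_of_order4 sl monomial hs x4 y4 n2.
have [tr [trP trM trN trU]] := triple_exists sl memN XY XYxy.
have [r [hr trr]] := triple_rotation trM trN hs s4 s2.
have HJ h g : h \in H -> g \in G -> (g^-1 * h * g)%g \in H by apply: (memHJ sl sHG memH).
have [[h0 hh0 trh0] scal] := scalar_sub sHG nNG HJ trM trN hr trr c2.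
by exists X, Y, tr, r, h0; split.
Qed.

Section Exceptional.
Variables (X Y : L) (tr : gT -> bool * bool * bool) (s h0 : gT).
Hypothesis trs : exceptional_triples X Y tr s h0.

Lemma isog_of_triples :
  ((G / N)%g \isog Zp 4 \/ (G / N)%g \isog [set: 'D_8]%g) /\ #|(H * N / N)%g| = 2%N.
Proof.
case: trs => _ [_ trM trN] [hs ts] [hh0 th0] scal.
split; first exact: (isog_exceptional nNG trM trN hs ts).
exact: (card_sub_scalar sHG nNG trM trN hh0 th0 scal).
Qed.

Definition uv_gens u v :=
  (forall z, gen (ext (ext kb u) v) z <->
     gen (ext (ext kb x) y) z /\ forall g, g \in (H * N)%g -> to z g = z) /\
  (forall z, gen (ext (ext Kb u) v) z <-> forall h, h \in H -> to z h = z).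

Let uvP : uv_gens (coord_u X Y) (coord_v X Y).
Proof.
case: trs => -[XY XYxy] [trP trM trN] [hs ts] [hh0 th0] scal; split=> z.
  exact: (coord_gen_k sl sHG nNG two XY XYxy trP trN hh0 th0 scal).
exact: (coord_gen_K sl sHG memH two XY trP hh0 th0 scal).
Qed.

Lemma C4_exists : (G / N)%g \isog Zp 4 -> exists (a : k) (sa : K) u v,
  [/\ uv_gens u v, nonsquare a /\ sa ^+ 2 = a%:A,
      forall c : K, (forall n, n \in N -> to (iK c) n = iK c) <-> c \in <<1; sa>>%VS,
      s \in G /\ (G / N = <[coset N s]>)%g &
      [/\ to (iK sa) s = - iK sa, to u s = u^-1 & to v s = - v^-1]].
Proof.
move=> iso; case: trs => -[XY XYxy] [trP trM trN] [hs ts] [hh0 th0] scal.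
(* An element of determinant -1 would, together with s, make the quotient of order 8. *)
have ev g : g \in G -> even_triple (tr g).
  move=> hg; case: (boolP (even_triple (tr g))) => // odd; have [t [ht tt]] := odd_triple trM hs ts hg odd.
  by have := card_isog iso; rewrite (card_dihedral_quotient nNG trM trN hs ts ht tt) card_Zp.
have [a [sa [h1 h2 h3 h4]]] := C4_field sl sHG memH nNG two trM trN hh0 th0 scal hs ts ev.
have [h5 h6] := coord_rotation sl XY trP hs ts.
exists a, sa, (coord_u X Y), (coord_v X Y); split=> //; split=> //.
exact: (quotient_rotation nNG trM trN hs ts ev).
Qed.

Lemma D4_exists : (G / N)%g \isog [set: 'D_8]%g -> exists (a b : k) (sa sb : K) t u v,
  [/\ uv_gens u v,
      [/\ nonsquare a /\ nonsquare b, sa ^+ 2 = a%:A /\ sb ^+ 2 = b%:A, \dim <<<<1; sa>>; sb>>%VS = 4%N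
        & forall c : K, (forall n, n \in N -> to (iK c) n = iK c) <-> c \in <<<<1; sa>>; sb>>%VS],
      [/\ s \in G, t \in G & (G / N = <<[set coset N s; coset N t]>>)%g],
      [/\ to (iK sa) s = - iK sa, to (iK sb) s = iK sb, to u s = u^-1 & to v s = - v^-1] &
      [/\ to (iK sa) t = iK sa, to (iK sb) t = - iK sb, to u t = u & to v t = - v]].
Proof.
move=> iso; case: trs => -[XY XYxy] [trP trM trN] [hs ts] [hh0 th0] scal.
have [t [ht tt]] : exists t, t \in G /\ tr t = (true, false, false).
  have [ev|/existsNP [g /not_implyP [hg /negP odd]]] := pselect (forall g, g \in G -> even_triple (tr g)).
    have : #|(G / N)%g| = 8%N by rewrite (card_isog iso) (@card_2dihedral 3).
    by rewrite (quotient_rotation nNG trM trN hs ts ev) -orderE (order_rotation nNG trM trN hs ts).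
  exact: (odd_triple trM hs ts hg odd).
have [a [b [sa [sb [h1 h2 [h3 h4 h5 h6] h7 h8]]]]] :=
  D4_field sl sHG memH nNG two trM trN hh0 th0 scal hs ts ht tt.
have [h9 h10] := coord_rotation sl XY trP hs ts.
have [h11 h12] := coord_reflection sl XY trP ht tt.
exists a, b, sa, sb, t, (coord_u X Y), (coord_v X Y); split=> //; split=> //.
exact: (quotient_dihedral nNG trM trN hs ts ht tt).
Qed.

End Exceptional.
End Assembly.

(** * The field K(x, y) *)

Lemma subf_div (F : fieldType) (a b c d : F) : b != 0 -> d != 0 ->
  a / b - c / d = (a * d - c * b) / (b * d).
Proof. by move=> b0 d0; rewrite -mulNr addf_div // mulNr. Qed.

Section RatFun2.
Variables (k : fieldType) (K : fieldExtType k).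
Local Notation R := {mpoly K[2]}.
Local Notation L := (ratfun2 K).

Definition iKr : {rmorphism K -> L} := (@tofrac {mpoly K[2]}) \o @mpolyC 2 K.

Let x := @xvar k K.
Let y := @yvar k K.

(** Through [e] and [e2], polynomials in x and in x, y become iterated univariate ones. The left
    inverse [g] gives injectivity, from which the transcendence of x, and of y over K(x),
    follows. *)
Let e : {rmorphism {poly K} -> R} := horner_eval ('X_0 : R) \o map_poly (@mpolyC 2 K).
Let e2 : {rmorphism {poly {poly K}} -> R} := horner_eval ('X_1 : R) \o map_poly e.
Let g : {rmorphism R -> {poly {poly K}}} :=
  mmap ((polyC \o polyC) : {rmorphism K -> {poly {poly K}}}) (fun i : 'I_2 => if i == 0 then 'X%:P else 'X).

Let eX : e 'X = 'X_0. Proof. by rewrite /e /= /horner_eval map_polyX hornerX. Qed.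
Let eC c : e c%:P = c%:MP. Proof. by rewrite /e /= /horner_eval map_polyC hornerC. Qed.
Let e2X : e2 'X = 'X_1. Proof. by rewrite -[LHS]/((map_poly e 'X).['X_1]) map_polyX hornerX. Qed.
Let e2C c : e2 c%:P = e c. Proof. by rewrite -[LHS]/((map_poly e c%:P).['X_1]) map_polyC hornerC. Qed.

Let e2K : cancel e2 g.
Proof.
have gX i : g 'X_i = if i == 0 then 'X%:P else 'X by rewrite /g /= mmapX mmap1U.
have ge r : g (e r) = r%:P.
  elim/poly_ind: r => [|r c IH]; first by rewrite !rmorph0.
  by rewrite !rmorphD !rmorphM IH eX eC gX /= /g /= mmapC.
elim/poly_ind => [|B c IH]; first by rewrite !rmorph0.
by rewrite !rmorphD !rmorphM IH e2X e2C ge gX.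
Qed.

Let e_inj : injective e.
Proof. by move=> r r' h; apply: polyC_inj; rewrite -[LHS]e2K -[RHS]e2K !e2C h. Qed.

Let E : {rmorphism {poly K} -> L} := (@tofrac {mpoly K[2]}) \o e.
Let E0 r : (E r == 0) = (r == 0).
Proof. by rewrite /E /= tofrac_eq0 -(rmorph0 e) (inj_eq e_inj). Qed.

Let EC c : E c%:P = iKr c. Proof. by rewrite -[LHS]/(tofrac (e c%:P)) eC. Qed.
Let EX : E 'X = x. Proof. by rewrite -[LHS]/(tofrac (e 'X)) eX. Qed.

Let genx z : gen (ext (Kb iKr) x) z -> exists r q, q != 0 /\ z = E r / E q.
Proof.
elim=> {z} [|z [[c ->]| ->]|z w _ [r [q [q0 ->]]] _ [r' [q' [q0' ->]]]|z w _ [r [q [q0 ->]]] _ [r' [q' [q0' ->]]]].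
- by exists 1, 1; rewrite oner_eq0 rmorph1 divr1.
- by exists c%:P, 1; rewrite oner_eq0 rmorph1 divr1 EC.
- by exists 'X, 1; rewrite oner_eq0 rmorph1 divr1 EX.
- exists (r * q' - r' * q), (q * q'); rewrite mulf_neq0 // rmorphB !rmorphM; split=> //.
  by rewrite subf_div ?E0.
- have [r0|r0] := eqVneq r' 0.
    by exists 0, 1; rewrite oner_eq0 r0 rmorph0 mul0r invr0 mulr0 mul0r.
  by exists (r * q'), (q * r'); rewrite mulf_neq0 // !rmorphM invf_div mulf_div.
Qed.

Let common_denominator (s : seq L) : (forall z, z \in s -> gen (ext (Kb iKr) x) z) ->
  exists q, q != 0 /\ forall z, z \in s -> exists r, E q * z = E r.
Proof.
elim: s => [|z s IH] hs; first by exists 1; rewrite oner_eq0.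
have [|q [q0 hq]] := IH; first by move=> w hw; apply: hs; rewrite inE hw orbT.
have [r [q' [q0' zE]]] := genx (hs z (mem_head _ _)).
exists (q' * q); split=> [|w]; first by rewrite mulf_neq0.
rewrite inE => /orP [/eqP ->|/hq [r' hr']].
  exists (r * q); rewrite zE !rmorphM mulrAC mulrCA divff ?E0 // mulr1 //.
by exists (q' * r'); rewrite !rmorphM -mulrA hr'.
Qed.

Lemma xvar_transc : ~ cl (Kb iKr) x.
Proof.
move/cl_polyP => [P [P0 /polyOverP PK Px]].
have /choice [c hc] : forall i, exists c, P`_i = iKr c by move=> i; apply/gen_base/genpP.
have PE : P = map_poly iKr (\poly_(i < size P) c i).
  apply/polyP => i; rewrite coef_map coef_poly; case: ltnP => hi /=; first by rewrite hc.
  by rewrite rmorph0 nth_default.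
have key (p : {poly K}) : (map_poly iKr p).[x] = E p.
  elim/poly_ind: p => [|p d IH]; first by rewrite !rmorph0 horner0.
  have -> : (map_poly iKr (p * 'X + d%:P)).[x] = (map_poly iKr p).[x] * x + iKr d.
    by rewrite rmorphD rmorphM /= map_polyX map_polyC hornerD hornerMX hornerC.
  by rewrite IH (rmorphD E) (rmorphM E) EX EC.
by move: Px P0; rewrite PE /root key E0 => /eqP ->; rewrite rmorph0 eqxx.
Qed.

Lemma yvar_transc : ~ cl (ext (Kb iKr) x) y.
Proof.
move/cl_polyP => [P [P0 /polyOverP PK Py]].
have [|q [q0 hq]] := common_denominator (s := P).
  by move=> z /(nthP 0) [i _ <-]; apply/genpP.
have /choice [r hr] : forall i, exists r, E q * P`_i = E r.
  move=> i; have [hi|hi] := ltnP i (size P); first by apply: hq; apply: mem_nth.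
  by exists 0; rewrite nth_default // mulr0 rmorph0.
pose B : {poly {poly K}} := \poly_(i < size P) r i.
have PE : E q *: P = map_poly E B.
  apply/polyP => i; rewrite coefZ coef_map coef_poly; case: ltnP => hi; first exact: hr.
  by rewrite [RHS](rmorph0 E) nth_default // mulr0.
have key (p : {poly {poly K}}) : (map_poly E p).[y] = tofrac (e2 p).
  elim/poly_ind: p => [|p d IH]; first by rewrite !rmorph0 horner0.
  have -> : (map_poly E (p * 'X + d%:P)).[y] = (map_poly E p).[y] * y + E d.
    by rewrite rmorphD rmorphM /= map_polyX map_polyC hornerD hornerMX hornerC.
  by rewrite IH (rmorphD e2) (rmorphM e2) e2X e2C rmorphD rmorphM.
have By : (map_poly E B).[y] = 0.
  rewrite -PE hornerZ; move/eqP: Py => ->; exact: mulr0.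
have : tofrac (e2 B) == 0 by apply/eqP; apply: etrans (esym (key B)) By.
rewrite tofrac_eq0 -(rmorph0 e2) (inj_eq (can_inj e2K)) => /eqP B0.
by move/eqP: PE; rewrite B0 rmorph0 scaler_eq0 E0 (negPf q0) (negPf P0).
Qed.

Lemma ratfun2_gen z : gen (ext (ext (Kb iKr) x) y) z.
Proof.
have [p [q [q0 ->]]] := frac_ex z.
suff key (t : R) : gen (ext (ext (Kb iKr) x) y) (tofrac t) by apply: gen_div.
rewrite [t]mpolyE rmorph_sum /=; apply: gen_sum => m.
rewrite -mul_mpolyC rmorphM; apply: genM; first by apply/gen_ext/gen_ext/gen_in; exists t@_m.
rewrite mpolyXE_id rmorph_prod /=; apply: gen_prod => i.
rewrite rmorphXn; apply: genX; move: i; apply: ord2P.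
  exact/gen_ext/gen_extr.
exact: gen_extr.
Qed.

End RatFun2.

Section Concrete.
Variables (k : fieldType) (K : fieldExtType k) (gT : finGroupType) (G : {group gT}).
Variable to : action G (ratfun2 K).
Hypothesis pqm : purely_quasi_monomial to.
Local Notation L := (ratfun2 K).
Local Notation x := (@xvar k K).
Local Notation y := (@yvar k K).
Local Notation iKr := (iKr K).

Lemma pqm_semilinear : semilinear_action iKr x y to.
Proof.
split.
- exact: pqm_add pqm.
- exact: pqm_mul pqm.
- by move=> s c; apply: pqm_k pqm s c.
- by move=> s c; apply: pqm_K pqm s c.
- by move=> c; apply: (pqm_fix pqm).
- exact: xvar_transc.
- exact: yvar_transc.
- exact: ratfun2_gen.
Qed.

Let sl := pqm_semilinear.
Let toB := sl_add sl.
Let toMm := sl_mul sl.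

Lemma pqm_mon s : s \in G -> exists M : 'M[int]_2,
  to x s = mon x y (M 0 0, M 1 0) /\ to y s = mon x y (M 0 1, M 1 1).
Proof. by move=> hs; have [A [_ h1 h2]] := pqm_monomial pqm hs; exists A. Qed.

Fact actN_group_set : group_set (actN to).
Proof.
apply/group_setP; split=> [|g h]; first by rewrite inE group1 !to_id !eqxx.
rewrite !inE => /and3P [hg /eqP gx /eqP gy] /and3P [hh /eqP hx /eqP hy].
by rewrite groupM // !to_comp // gx gy hx hy !eqxx.
Qed.
Definition actN_group := Group actN_group_set.

Fact actH_group_set : group_set (actH to).
Proof.
apply/group_setP; split=> [|g h].
  by rewrite inE group1; apply/asboolP => c; rewrite to_id.
rewrite !inE => /andP [hg /asboolP gc] /andP [hh /asboolP hc].
by rewrite groupM //; apply/asboolP => c; rewrite to_comp // gc hc.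
Qed.
Definition actH_group := Group actH_group_set.

Let sHG : actH_group \subset G.
Proof. by apply/subsetP => s; rewrite inE => /andP []. Qed.

Let memH s : s \in G -> (s \in actH_group <-> forall c, gen (Kb iKr) c -> to c s = c).
Proof.
move=> hs; rewrite inE hs /=; split=> [/asboolP h c /gen_base [d ->]|h]; first exact: h.
by apply/asboolP => c; apply: h; apply: gen_in; exists c.
Qed.

Let memN s : s \in G -> (s \in actN_group <-> to x s = x /\ to y s = y).
Proof.
by move=> hs; rewrite inE hs /=; split=> [/andP [/eqP h1 /eqP h2]|[/eqP h1 /eqP h2]] //; rewrite h1 h2.
Qed.

Let nNG : (actN_group <| G)%g.
Proof.
have NG n : n \in actN_group -> n \in G by rewrite inE => /andP [].
apply/andP; split; first by apply/subsetP.
apply/normsP => g hg; apply/eqP; rewrite eqEcard cardJg leqnn andbT.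
apply/subsetP => _ /imsetP [n hn ->]; have nG := NG n hn.
have /(memN nG) [nx ny] := hn; have hJ : (n ^ g)%g \in G by rewrite groupJ.
have [M [Mx My]] := pqm_mon (groupVr hg).
have fixm m : to (mon x y m) n = mon x y m.
  by have [f fE] := to_rmorph toB toMm nG; rewrite /mon -fE rmorphM !fmorphXz !fE nx ny.
apply/(memN hJ); rewrite conjgE !to_comp ?groupM ?groupV // Mx My !fixm -Mx -My.
by rewrite !toVK.
Qed.

Lemma uv_genP u v : uv_generators to u v <-> uv_gens iKr x y to actH_group actN_group u v.
Proof.
pose ikr : {rmorphism k -> L} := iKr \o in_alg K.
have hk u' v' z : k_gen2 u' v' z <-> gen (ext (ext (kb iKr) u') v') z := adjoin2_gen ikr u' v' z.
have hK u' v' z : K_gen2 u' v' z <-> gen (ext (ext (Kb iKr) u') v') z := adjoin2_gen iKr u' v' z.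
split=> -[h1 h2]; split=> z.
- by split=> [/hk/h1 [/hk]|[/hk h /(conj h)/h1/hk]].
- by split=> [/hK/h2|/h2/hK].
- by split=> [/hk/h1 [/hk]|[/hk h /(conj h)/h1/hk]].
- by split=> [/hK/h2|/h2/hK].
Qed.

Let twoL : 2%N \notin [pchar k] -> 2%:R != 0 :> k /\ 2%:R != 0 :> L.
Proof.
rewrite inE /= => two; split=> //.
by rewrite -(rmorph_nat (iKr \o in_alg K : {rmorphism k -> L})) fmorph_eq0.
Qed.

Lemma not_rational_exceptional : ~ fixed_rational to ->
  2%N \notin [pchar k] /\ (C4_case to \/ D4_case to).
Proof.
move=> nr; have [//|[two [X [Y [XY XYxy ex]]]]] := rational_or_exceptional sl sHG memH pqm_mon.
split.
  by apply: contra two; rewrite inE /= -(rmorph_nat (iKr \o in_alg K : {rmorphism k -> L})) fmorph_eq0.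
have [tr [s [h0 tri]]] := triples_of_exceptional sl sHG memN XY XYxy ex.
have [[iso|iso] c2] := isog_of_triples sHG nNG tri; [by left|by right].
Qed.

Lemma C4_data_exists : 2%N \notin [pchar k] -> C4_case to ->
  exists (a : k) (sa : K) (s : gT) (u v : L), C4_data to a sa s u v.
Proof.
move=> /twoL [two two'] [iso c2].
have [X [Y [tr [s [h0 tri]]]]] := triples_of_isog sl sHG memH nNG memN pqm_mon (or_introl iso) c2.
have [a [sa [u [v [/uv_genP uvP [h1 h2] h3 h4 h5]]]]] := C4_exists sl sHG memH nNG two' tri iso.
by exists a, sa, s, u, v; split.
Qed.

Lemma D4_data_exists : 2%N \notin [pchar k] -> D4_case to ->
  exists (a b : k) (sa sb : K) (s t : gT) (u v : L), D4_data to a b sa sb s t u v.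
Proof.
move=> /twoL [two two'] [iso c2].
have [X [Y [tr [s [h0 tri]]]]] := triples_of_isog sl sHG memH nNG memN pqm_mon (or_intror iso) c2.
have [a [b [sa [sb [t [u [v [/uv_genP uvP [h1 h2 h2' h3] h4 h5 h6]]]]]]]] := D4_exists sl sHG memH nNG two' tri iso.
by exists a, b, sa, sb, s, t, u, v; split.
Qed.

Let fixed_uv u v z : uv_generators to u v -> (z = u \/ z = v) -> forall n, n \in actN_group -> to z n = z.
Proof.
move=> [h1 _] zuv n hn; have [|_ ] := (h1 z).1; first exact: Defs.adjoin_gen.
by apply; rewrite -[n]mul1g mem_mulg // (group1 actH_group).
Qed.

Lemma C4_data_norm (a : k) (sa : K) s u v : 2%N \notin [pchar k] -> C4_data to a sa s u v ->
  [/\ nonsquare a, fixed_rational to <-> is_norm a (- 1) & fixed_unirational to -> is_norm a (- 1)].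
Proof.
move=> /twoL [two two'] [uvP [a_ns saE NE] [hs GE] [ss us vs]].
have gen_uv z : inv to z -> gen (ext (ext (Kb iKr) u) v) z.
  by move=> hz; apply/((proj1 (uv_genP u v) uvP).2) => h hh; apply/hz/(subsetP sHG).
have act g : g \in G -> twisted iKr to 1 sa u v g.
  apply: (quotient_ind (S := [set s]) nNG); rewrite ?sub1set ?imset_set1 //.
  - move=> n hn; exists false; rewrite mul1r; split.
    + by apply: (NE sa).2 => //; apply: memv_adjoin.
    + by apply: (fixed_uv uvP) => //; left.
    + by apply: (fixed_uv uvP) => //; right.
  - move=> _ /set1P ->; exists true; split=> //; first by rewrite expr1 mulN1r.
    by rewrite vs scale1r rmorph1 mulN1r.
  - by move=> g1 g2; apply: (twistedM sl); rewrite oner_eq0.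
split=> //; first exact: (rational_twistedP sl two saE a_ns (oner_neq0 k) gen_uv act).
exact: (norm_of_unirational_twisted sl two saE a_ns (oner_neq0 k) gen_uv act).
Qed.

(** The factor sqrt b makes w invariant under t, which changes the signs of both sqrt b and v. Under
    s it turns v |-> - 1 / v into w |-> - b / w. *)
Lemma D4_data_norm (a b : k) (sa sb : K) s t u v : 2%N \notin [pchar k] ->
    D4_data to a b sa sb s t u v ->
  [/\ nonsquare a, b != 0, fixed_rational to <-> is_norm a (- b) & fixed_unirational to -> is_norm a (- b)].
Proof.
move=> /twoL [two two'] [uvP [[a_ns b_ns] [saE sbE] _ NE] [hs ht GE] [sas sbs us vs] [sat sbt ut vt]].
have b0 : b != 0 by apply/eqP => b0; move: (b_ns 0); rewrite b0 expr0n eqxx.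
have sb0 : iKr sb != 0.
  rewrite fmorph_eq0; apply: contra b0 => /eqP e; move/eqP: sbE.
  by rewrite e expr0n eq_sym scaler_eq0 oner_eq0 orbF.
pose w := iKr sb * v.
have gen_uw z : inv to z -> gen (ext (ext (Kb iKr) u) w) z.
  move=> hz; have : gen (ext (ext (Kb iKr) u) v) z.
    by apply/((proj1 (uv_genP u v) uvP).2) => h hh; apply/hz/(subsetP sHG).
  apply: gen_ext_le => [r hr|]; first exact/gen_ext/gen_in.
  have -> : v = w / iKr sb by rewrite /w mulrAC divff ?mul1r.
  by apply: gen_div (gen_extr _ _) _; apply/gen_ext/gen_ext/gen_in; exists sb.
have toM z z' g : g \in G -> to (z * z') g = to z g * to z' g.
  by move=> hg; have [f fE] := to_rmorph toB toMm hg; rewrite -!fE rmorphM.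
have act g : g \in G -> twisted iKr to b sa u w g.
  apply: (quotient_ind (S := [set s; t]) nNG).
  - by rewrite subUset !sub1set hs.
  - by rewrite GE imsetU1 imset_set1.
  - move=> n hn; have nG := subsetP (normal_sub nNG) n hn; exists false; rewrite mul1r.
    have up : sa \in <<<<1; sa>>; sb>>%VS by apply: (subvP (subv_adjoin _ _)); apply: memv_adjoin.
    split; first by apply: (NE sa).2.
      by apply: (fixed_uv uvP) => //; left.
    rewrite toM // (fixed_uv uvP (or_intror erefl)) //; congr (_ * _).
    by apply: (NE sb).2 => //; apply: memv_adjoin.
  - move=> g1 /set2P [] ->; last first.
      by exists false; rewrite mul1r; split=> //; rewrite toM // vt [to _ _]sbt mulrNN.
    exists true; split=> //; first by rewrite expr1 mulN1r.
    rewrite toM // vs [to _ _]sbs -sbE rmorphXn /w invfM expr2.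
    by rewrite mulrN -mulNr mulrA -mulNr mulfK // mulrN mulNr.
  - by move=> g1 g2; apply: (twistedM sl b0).
split=> //; first exact: (rational_twistedP sl two saE a_ns b0 gen_uw act).
exact: (norm_of_unirational_twisted sl two saE a_ns b0 gen_uw act).
Qed.

End Concrete.

Theorem theorem1p8 (k : fieldType) (K : fieldExtType k) (gT : finGroupType)
    (G : {group gT}) (to : action G (ratfun2 K)) :
  purely_quasi_monomial to ->
  [/\ ~ (2%N \notin [pchar k] /\ (C4_case to \/ D4_case to)) -> fixed_rational to,
      2%N \notin [pchar k] -> C4_case to ->
        (exists (a : k) (sa : K) (s : gT) (u v : ratfun2 K), C4_data to a sa s u v)
        /\ (forall (a : k) (sa : K) (s : gT) (u v : ratfun2 K),
              C4_data to a sa s u v ->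
              (fixed_rational to <-> norm_residue_zero a (-1))),
      2%N \notin [pchar k] -> D4_case to ->
        (exists (a b : k) (sa sb : K) (s t : gT) (u v : ratfun2 K),
            D4_data to a b sa sb s t u v)
        /\ (forall (a b : k) (sa sb : K) (s t : gT) (u v : ratfun2 K),
              D4_data to a b sa sb s t u v ->
              (fixed_rational to <-> norm_residue_zero a (- b)))
    & ~ fixed_rational to ->
        [/\ infinite_field k, brauer_nontrivial k & ~ fixed_unirational to]].
Proof.
move=> pqm; have nr := not_rational_exceptional pqm.
have char2 : 2%N \notin [pchar k] -> 2%:R != 0 :> k by rewrite inE.
split.
- by move=> ex; apply: contrapT => /nr.
- move=> two c4; split=> [|a sa s u v D]; first exact: C4_data_exists.
  have [a_ns ratP _] := C4_data_norm pqm two D.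
  apply: iff_trans ratP (iff_sym (norm_residueP (char2 two) a_ns _)).
  by rewrite oppr_eq0 oner_eq0.
- move=> two d4; split=> [|a b sa sb s t u v D]; first exact: D4_data_exists.
  have [a_ns b0 ratP _] := D4_data_norm pqm two D.
  apply: iff_trans ratP (iff_sym (norm_residueP (char2 two) a_ns _)).
  by rewrite oppr_eq0.
- move=> r; have [two cases] := nr r; have two' := char2 two.
  (* Both cases at once: b is - 1 or the negative of the given b, and all three claims follow from
     its not being a norm from k(sqrt a). *)
  suff [a [b [a_ns b0 nn un]]] : exists a b : k,
      [/\ nonsquare a, b != 0, ~ is_norm a b & fixed_unirational to -> is_norm a b].
    by split; [apply: not_norm_infinite nn | apply: not_norm_brauer nn | move/un].
  case: cases => [c4|d4].
    have [a [sa [s [u [v D]]]]] := C4_data_exists pqm two c4.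
    have [a_ns ratP un] := C4_data_norm pqm two D.
    by exists a, (- 1); split=> //; [rewrite oppr_eq0 oner_eq0 | move/ratP].
  have [a [b [sa [sb [s [t [u [v D]]]]]]]] := D4_data_exists pqm two d4.
  have [a_ns b0 ratP un] := D4_data_norm pqm two D.
  by exists a, (- b); split=> //; [rewrite oppr_eq0 | move/ratP].
Qed.
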